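(* Let $p\in[2,\infty]$ and $\delta\in[0,\infty)$. Let $q=p/(p-1)$ be the conjugate exponent, with $q=1$ when $p=\infty$. Then $$V^\infty_{p,\delta}=P_{q,\delta}:=\sup_{Y}\Big\{\mathbb{E}[YB(1)]-\int_0^1\varphi_\delta\big(\big\|\mathbb{E}[Y\,|\,\mathcal{F}(t)]\big\|_2\big)\,dt\Big\},$$ where the supremum is over all random variables $Y:\Omega\to\mathbb{R}$ such that $\|Y\|_q\le1$ and $\mathbb{E}\big[|Y|\sqrt{\log(1+|Y|)}\big]<\infty$. Moreover, there exists $\alpha\in\mathbb{A}$ attaining the infimum defining $V^\infty_{p,\delta}$.
   Context: Fix a complete probability space $(\Omega,\mathcal{F},\mathbb{P})$ supporting a standard one-dimensional Brownian motion $B=(B(t))_{t\in[0,1]}$ started at zero, and let $\mathbb{F}=(\mathcal{F}(t))_{t\in[0,1]}$ be the completed filtration generated by $B$. Let $c_0=\sqrt{2/\pi}$. Let $\mathbb{A}$ be the set of $\mathbb{F}$-progressively measurable real processes $\alpha=(\alpha(t))_{t\in[0,1]}$ with $\|\alpha(t)\|_2\le c_0$ for a.e. $t\in[0,1]$, and set $X^\alpha(t)=\int_0^t\alpha(s)\,ds+B(t)$. Here $\|\cdot\|_r$ is the $L^r(\mathbb{P})$ norm. Define $$V^\infty_{p,\delta}=\inf_{\alpha\in\mathbb{A}}\Big\{\|X^\alpha(1)\|_p+\frac{\delta}{2}\mathbb{E}\int_0^1\alpha(t)^2\,dt\Big\},\qquad \varphi_\delta(y)=\sup_{|a|\le c_0}\Big(ay-\frac{\delta}{2}a^2\Big),\quad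 y\ge0.$$ (The objective in the supremum is interpreted as $-\infty$ when the time integral is $+\infty$, with $\varphi_\delta(\infty)=\infty$.) *)

(* Defs.v *)
From HB Require Import structures.
From mathcomp Require Import all_boot all_order all_algebra.
From mathcomp Require Import all_classical all_reals all_analysis.

Set Implicit Arguments.
Unset Strict Implicit.
Unset Printing Implicit Defensive.
Import Order.TTheory GRing.Theory Num.Theory.
Import numFieldNormedType.Exports.

Local Open Scope classical_set_scope.
Local Open Scope ring_scope.

(* Processes indexed by [0, 1] are functions R -> T -> R of which only the
   values at times in [0, 1] are ever used. *)

Section filtration.
Context {d : measure_display} {T : measurableType d} {R : realType}.
Variables (P : probability T R) (B : R -> T -> R).

Definition natural_gen (t : R) : set (set T) :=
  \bigcup_(s in `[0, t]) preimage_set_system [set: T] (B s) measurable.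

(* The null sets of P are added at every time: the filtration is completed
   in the whole probability space, not in each sigma-algebra separately. *)
Definition completed_gen (t : R) : set (set T) :=
  natural_gen t `|` P.-negligible.

(* Independence of the increments is stated as independence from the past,
   i.e. B t - B s is independent of sigma (B u, u <= s). *)
Record is_brownian_motion : Prop := IsBrownianMotion {
  bm_measurable : forall t : R, t \in `[0, 1] -> measurable_fun [set: T] (B t);
  bm_start : \forall w \ae P, B 0 w = 0;
  bm_increment : forall s t : R, 0 <= s -> s < t -> t <= 1 ->
    forall U : set R, measurable U ->
      P [set w | U (B t w - B s w)] = normal_prob 0 (Num.sqrt (t - s)) U;
  bm_independent : forall s t : R, 0 <= s -> s < t -> t <= 1 ->
    forall (A : set T) (U : set R), <<s natural_gen s >> A -> measurable U ->
      P (A `&` [set w | U (B t w - B s w)%R])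
      = (P A * P [set w | U (B t w - B s w)%R])%E;
  bm_continuous : \forall w \ae P, {within `[0, 1], continuous (B ^~ w)} }.

Definition progressively_measurable (alpha : R -> T -> R) : Prop :=
  forall t : R, t \in `[0, 1] ->
    measurable_fun (`[0, t] `*` setT)
      (fun x : R * g_sigma_algebraType (completed_gen t) => alpha x.1 x.2).

End filtration.

Section conditional_expectation.
Context {d : measure_display} {T : measurableType d} {R : realType}.
Variable P : probability T R.

Definition is_cond_exp (G : set (set T)) (Y Z : T -> R) : Prop :=
  [/\ measurable_fun [set: g_sigma_algebraType G] Z,
      P.-integrable [set: T] (EFin \o Z) &
      forall A, <<s G >> A ->
        (\int[P]_(w in A) (Z w)%:E = \int[P]_(w in A) (Y w)%:E)%E].

(* A version of E[Y | sigma(G)], unique up to P-null sets. The default value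
   is irrelevant when Y is integrable and G consists of measurable sets, as a
   version then exists. *)
Definition cond_exp (G : set (set T)) (Y : T -> R) : T -> R :=
  xget (cst 0) [set Z | is_cond_exp G Y Z].

End conditional_expectation.

Section problem.
Context {d : measure_display} {T : measurableType d} {R : realType}.
Variables (P : probability T R) (B : R -> T -> R).
Local Notation mu := (@lebesgue_measure R).

Definition c0 : R := Num.sqrt (2 / pi).

Definition admissible : set (R -> T -> R) :=
  [set alpha | progressively_measurable P B alpha /\
     {ae mu, forall t, t \in `[0, 1] ->
        ('N[P]_(2%:E) [EFin \o alpha t] <= c0%:E)%E}].

(* For alpha admissible the paths of alpha are almost surely integrable, so
   the junk value of Rintegral only matters on a null set. *)
Definition state (alpha : R -> T -> R) (t : R) (w : T) : R :=
  \int[mu]_(s in `[0, t]) alpha s w + B t w.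

Definition cost (p : \bar R) (delta : R) (alpha : R -> T -> R) : \bar R :=
  ('N[P]_p [EFin \o state alpha 1]
   + (delta / 2)%:E
     * \int[P]_w \int[mu]_(t in `[0%R, 1%R]) (alpha t w ^+ 2)%:E)%E.

Definition value (p : \bar R) (delta : R) : \bar R :=
  ereal_inf (cost p delta @` admissible).

Definition phi (delta : R) (y : \bar R) : \bar R :=
  if y is y'%:E then
    ereal_sup [set (a * y' - delta / 2 * a ^+ 2)%:E | a in [set a | `|a| <= c0]]
  else +oo%E.

Definition dual_admissible (q : \bar R) : set {RV P >-> R} :=
  [set Y | ('N[P]_q [EFin \o Y] <= 1)%E /\
     (\int[P]_w (`|Y w| * Num.sqrt (ln (1 + `|Y w|)))%:E < +oo)%E].

(* Subtraction in \bar R gives -oo when the time integral is +oo, since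
   E[Y B(1)] is finite for dual admissible Y. *)
Definition dual_objective (delta : R) (Y : T -> R) : \bar R :=
  ('E_P[(Y \* B 1)%R]
   - \int[mu]_(t in `[0%R, 1%R])
       phi delta ('N[P]_(2%:E) [EFin \o cond_exp P (completed_gen P B t) Y]))%E.

Definition dual_value (q : \bar R) (delta : R) : \bar R :=
  ereal_sup [set dual_objective delta Y | Y in dual_admissible q].

End problem.

(* Main.v *)
(** By duality of Lebesgue norms the cost of a control [alpha] is the supremum,
    over bounded [Y] in the unit ball of [L^q], of the Lagrangian
    [E[Y X^alpha(1)] + delta/2 E int alpha^2].  For fixed [Y], with
    [M(t) = E[Y | F(t)]], one has [E[Y alpha(t)] = E[M(t) alpha(t)]], and
    minimising under [||alpha(t)||_2 <= c0] at each time gives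
    [E[Y B(1)] - int phi(||M(t)||_2) dt]; controls pointing against [M], frozen
    on a fine grid, come arbitrarily close.

    To exchange infimum and supremum without weak compactness, penalise [Y] by
    [eta E[Y^2]].  The penalised problem is strongly concave in [Y], so an
    approximate minimiser in [alpha] satisfies an approximate first-order
    condition, and its penalised cost exceeds the dual value by at most [eta].
    As [eta] decreases to [0] the sets of such controls are convex and
    nonincreasing; by the parallelogram identity their elements of almost
    minimal energy converge strongly, and the limit is optimal.

    Weak duality for unbounded [Y] replaces [Y] by [M(t)], [t < 1], which is
    square integrable as soon as the time integral is finite; then [t -> 1],
    where the [L sqrt(log L)] condition controls [E[Y (B(1) - B(t))]]. *)

From HB Require Import structures.
Require Import Defs.
From mathcomp Require Import all_boot all_order all_algebra.
From mathcomp Require Import all_classical all_reals all_analysis.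
From mathcomp Require Import lra measurable_realfun ess_sup_inf.
Import Order.TTheory GRing.Theory Num.Theory.
Import numFieldNormedType.Exports.
Local Open Scope classical_set_scope.
Local Open Scope ring_scope.

Set Implicit Arguments.
Unset Strict Implicit.

(** For [delta = 0] the cost is not strictly convex in the control, so nothing forces a minimising
    sequence to converge. The energy therefore acts as a selection rule for every [delta]: among
    almost optimal controls those of least energy are retained. Convergence at a geometric rate then
    gives convergence almost everywhere, and a pointwise upper limit of the sequence is
    progressively measurable, which a limit known only up to null sets need not be. The penalty
    requires square integrable [Y]. Bounded [Y] suffice because an [L^p] norm is already computed by
    bounded functions of the variable itself. The weight [sqrt (log (1 + |Y|))] is what pairs with
    Gaussian tails: through a Young inequality, [Y] times an increment is controlled by the
    exponential moment of the squared increment, with a factor that vanishes with the length of the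
    increment. Time 1 has to be approached from below because a finite time integral says nothing
    about the single instant 1, and for [q < 2] the constraint on [Y] does not make [M(1)] square
    integrable. *)

(** * An abstract minimax argument without compactness *)

Section minimax.
Variables (R : realType) (V W : Type).
Variables (mixV : R -> V -> V -> V) (midW : W -> W -> W).
Variables (A : set V) (K : set W) (L : V -> W -> R).
(** In the application [L] is the Lagrangian without its energy term, [N] and [Q] are the squared
    norms of control and dual variable, [D] and [E] the squared distances, [c] is [delta / 2] and
    [v] the dual value. [cross] is Cauchy-Schwarz for the bilinear part of [L], with [C] bounding
    squared distances of controls; [dual] is the duality for one fixed [Y]. *)
Variables (N : V -> R) (D : V -> V -> R) (Q : W -> R) (E : W -> W -> R).
Variables (C c v : R) (a0 : V) (Y0 : W).
Hypothesis c_ge0 : 0 <= c.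
Hypothesis C_gt0 : 0 < C.
Hypothesis A_a0 : A a0.
Hypothesis A_mix : forall (s : R) a b, 0 <= s <= 1 -> A a -> A b -> A (mixV s a b).
Hypothesis K_mid : forall Y Z, K Y -> K Z -> K (midW Y Z).
Hypothesis L_mixV : forall (s : R) a b Z, 0 <= s <= 1 -> A a -> A b -> K Z ->
  L (mixV s a b) Z = (1 - s) * L a Z + s * L b Z.
Hypothesis L_midW : forall a Y Z, A a -> K Y -> K Z ->
  L a (midW Y Z) = (L a Y + L a Z) / 2.
Hypothesis N_mix : forall (s : R) a b, 0 <= s <= 1 -> A a -> A b ->
  N (mixV s a b) = (1 - s) * N a + s * N b - s * (1 - s) * D a b.
Hypothesis Q_mid : forall Y Z, K Y -> K Z ->
  Q (midW Y Z) = (Q Y + Q Z) / 2 - E Y Z / 4.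
Hypothesis N_ge0 : forall a, A a -> 0 <= N a.
Hypothesis N_le : forall a, A a -> N a <= C.
Hypothesis D_ge0 : forall a b, A a -> A b -> 0 <= D a b.
Hypothesis Q_ge0 : forall Y, K Y -> 0 <= Q Y.
Hypothesis cross : forall a b Y Z, A a -> A b -> K Y -> K Z ->
  (L b Z - L a Z - (L b Y - L a Y)) ^+ 2 <= C * E Y Z.
Hypothesis L_bound : forall eta : R, 0 < eta -> exists M : R, forall a Z, A a -> K Z ->
  L a Z - eta * Q Z <= M.
Hypothesis K_Y0 : K Y0.
Hypothesis L_Y0 : forall a, A a -> L a Y0 = 0.
Hypothesis Q_Y0 : Q Y0 = 0.
Hypothesis dual : forall Y (e : R), K Y -> 0 < e ->
  exists2 b, A b & L b Y + c * N b <= v + e.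

Let pen eta a : set R := [set L a Z - eta * Q Z | Z in K].

Let pen_has_sup eta a : 0 < eta -> A a -> has_sup (pen eta a).
Proof.
move=> eta0 Aa; split; first by exists (L a Y0 - eta * Q Y0); exists Y0.
have [M hM] := L_bound eta0.
by exists M => _ [Z KZ <-]; exact: hM.
Qed.

Let G eta a := sup (pen eta a) + c * N a.

Let penL eta a Z : 0 < eta -> A a -> K Z ->
  L a Z - eta * Q Z + c * N a <= G eta a.
Proof.
move=> eta0 Aa KZ; rewrite lerD2r; apply: ub_le_sup; last by exists Z.
by case: (pen_has_sup eta0 Aa).
Qed.

(* Near a minimiser [a] of the penalised problem with near-maximiser [Y], the
   strong concavity in [Y] makes the objective smooth, so that [Y] almost
   satisfies the first-order condition: no direction [b] decreases it. *)
Lemma penalised_minimax (eta e : R) : 0 < eta -> 0 < e ->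
  exists2 a, A a & forall Z, K Z -> L a Z + c * N a - eta * Q Z <= v + e.
Proof.
move=> eta0 e0.
(* Maximum over [x] of [x - eta * x ^+ 2 / (2 * C)]: first-order gain against concavity loss at unit
   step. *)
pose B := C / (2 * eta).
set k := 6 + B.
have k6 : 6 <= k by rewrite lerDl divr_ge0 ?mulr_ge0// ltW.
set s := Num.min 1 (e / k).
have s0 : 0 < s.
  by rewrite lt_min ltr01/= divr_gt0// (lt_le_trans _ k6).
have s1 : s <= 1 by rewrite ge_min lexx.
have sk : s * k <= e.
  by rewrite -ler_pdivlMr ?(lt_le_trans _ k6)// ge_min lexx orbT.
pose I := [set G eta a | a in A].
have I_inf : has_inf I.
  split; first by exists (G eta a0); exists a0.
  exists 0 => _ [a Aa <-]; apply: le_trans (penL eta0 Aa K_Y0).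
  by rewrite L_Y0// Q_Y0 mulr0 subrr add0r mulr_ge0// N_ge0.
(* The step is [s] and the tolerance [s ^+ 2]: after the division by [s] in [key] all errors are of
   order [s], and together they stay below [s * k]. *)
have ss : 0 < s ^+ 2 by rewrite exprn_gt0.
have [_ [a Aa <-] aI] := inf_adherent ss I_inf.
have [_ [Y KY <-] YS] := sup_adherent ss (pen_has_sup eta0 Aa).
have [b Ab bP] := dual KY s0.
have s01 : 0 <= s <= 1 by rewrite ltW.
(* Testing near-maximality of [Y] at the midpoint of [Y] and [Z] turns strong concavity into a loss
   quadratic in the distance from [Y] to [Z]. *)
have J_le Z : K Z -> L a Z - eta * Q Z <=
    L a Y - eta * Q Y + 2 * s ^+ 2 - eta / 2 * E Y Z.
  move=> KZ; have KM := K_mid KY KZ.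
  have := penL eta0 Aa KM.
  rewrite L_midW// Q_mid// /G lerD2r => h.
  lra.
have Amix : A (mixV s a b) by exact: A_mix.
have Fmix : sup (pen eta (mixV s a b)) <=
    L a Y - eta * Q Y + 2 * s ^+ 2 + s * (L b Y - L a Y)
    + s ^+ 2 * B.
  apply: ge_sup; first by exists (L (mixV s a b) Y0 - eta * Q Y0); exists Y0.
  move=> _ [Z KZ <-]; rewrite L_mixV//.
  have := J_le _ KZ; have := cross Aa Ab KY KZ.
  set x := L b Z - _ - _; set Ez := E Y Z => hx hJ.
  (* Since [x ^+ 2 <= C * Ez], the left side is at most a concave quadratic in [x]; what follows
     completes the square. *)
  suff : s * x - eta / 2 * Ez <= s ^+ 2 * B.
    by rewrite /x => h; lra.
  have kB : 4 * (eta / (2 * C)) * (C / (2 * eta)) = 1.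
    have h1 : eta / (2 * C) * (2 * C) = eta by rewrite divfK// gt_eqF ?mulr_gt0.
    have h2 : C / (2 * eta) * (2 * eta) = C by rewrite divfK// gt_eqF ?mulr_gt0.
    have h3 : (eta / (2 * C) * (2 * C)) * (C / (2 * eta) * (2 * eta)) = eta * C.
      by rewrite h1 h2.
    by apply: (@mulIf _ (eta * C)); [rewrite gt_eqF ?mulr_gt0 | lra].
  have kE : eta / 2 = eta / (2 * C) * C.
    by rewrite invfM mulrA -[RHS]mulrA mulVf ?mulr1 ?gt_eqF.
  rewrite -/B in kB; set k' := eta / (2 * C) in kB kE.
  have k'0 : 0 < k' by rewrite divr_gt0 ?mulr_gt0.
  have xE : k' * x ^+ 2 <= k' * (C * Ez) by rewrite ler_pM2l.
  rewrite kE; rewrite -subr_ge0 -(pmulr_rge0 _ k'0).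
  have sq := sqr_ge0 (k' * x - s / 2).
  have k'xE : k' * (k' * x ^+ 2) <= k' * (k' * (C * Ez)) by rewrite ler_pM2l.
  have : 4 * k' * B * s ^+ 2 = s ^+ 2 by rewrite kB mul1r.
  lra.
have Gmix : inf I <= G eta (mixV s a b).
  by apply: ge_inf; [case: I_inf | exists (mixV s a b)].
have Dab := D_ge0 Aa Ab.
have Nmix : N (mixV s a b) <= (1 - s) * N a + s * N b.
  rewrite N_mix// lerBlDr lerDl mulr_ge0 ?mulr_ge0 ?subr_ge0 // ltW//.
exists a => // Z KZ.
have := penL eta0 Aa KZ.
rewrite /G in aI Gmix *.
set S := sup (pen eta a) in YS aI *.
have cN := ler_wpM2l c_ge0 Nmix.
have QY := Q_ge0 KY.
have etaQ : 0 <= eta * Q Y by rewrite mulr_ge0// ltW.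
have key : 0 <= s * ((L b Y + c * N b) - (L a Y + c * N a)) + s * s * (3 + B).
  have := penL eta0 Aa KY; rewrite /G -/S; lra.
have {}key : 0 <= ((L b Y + c * N b) - (L a Y + c * N a)) + s * (3 + B).
  by rewrite -(pmulr_rge0 _ s0); lra.
have sB : s * s <= s by rewrite ger_pMr.
rewrite /k in sk; lra.
Qed.

(* [S n] below is the sublevel set of the [n]-th penalised problem.  It is
   convex and nonincreasing in [n], so by the parallelogram identity its
   elements of almost minimal [N] form a Cauchy sequence. *)
Lemma minimizing_sequence (u : nat -> R) : (forall n, 0 < u n) ->
  exists a : nat -> V, [/\ forall n, A (a n),
    forall n Z, K Z -> L (a n) Z + c * N (a n) - Q Z / n.+1%:R <= v + n.+1%:R^-1 &
    forall j k, D (a j) (a k) <= Num.max (u j) (u k)].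
Proof.
move=> u0.
pose S n := [set a | A a /\ forall Z, K Z ->
  L a Z + c * N a - Q Z / n.+1%:R <= v + n.+1%:R^-1].
have invn n : 0 < n.+1%:R^-1 :> R by rewrite invr_gt0.
have S_ex n : exists a, S n a.
  have [a Aa ha] := penalised_minimax (invn n) (invn n).
  by exists a; split=> // Z KZ; rewrite [Q Z / _]mulrC; exact: ha.
have S_le m n : (m <= n)%N -> S n `<=` S m.
  move=> mn a [Aa ha]; split=> // Z KZ; have := ha Z KZ; have QZ := Q_ge0 KZ.
  have le : n.+1%:R^-1 <= m.+1%:R^-1 :> R by rewrite lef_pV2 ?posrE// ler_nat.
  have := ler_wpM2l QZ le; move: le; generalize (n.+1%:R^-1 : R) (m.+1%:R^-1 : R) => x y; lra.
have S_mix s n a b : 0 <= s <= 1 -> S n a -> S n b -> S n (mixV s a b).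
  move=> s01 [Aa ha] [Ab hb]; split; first exact: A_mix.
  move=> Z KZ; rewrite L_mixV// N_mix//.
  have /andP[s0 s1] := s01.
  have s1' : 0 <= 1 - s by rewrite subr_ge0.
  have := ler_wpM2l s1' (ha Z KZ); have := ler_wpM2l s0 (hb Z KZ).
  generalize (n.+1%:R^-1 : R) => x.
  have : 0 <= c * (s * (1 - s) * D a b) by rewrite !mulr_ge0// D_ge0.
  lra.
pose nu n := inf [set N a | a in S n].
have nu_inf n : has_inf [set N a | a in S n].
  have [a Sa] := S_ex n; split; first by exists (N a); exists a.
  by exists 0 => _ [b [Ab _] <-]; exact: N_ge0.
have nuC n : nu n <= C.
  have [a Sa] := S_ex n; apply: le_trans (N_le (proj1 Sa)).
  by apply: ge_inf; [case: (nu_inf n) | exists a].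
pose mu := sup [set nu n | n in [set: nat]].
have mu_sup : has_sup [set nu n | n in [set: nat]].
  by split; [exists (nu 0%N); exists 0%N | exists C => _ [n _ <-]; exact: nuC].
(* The level is at least [k], to inherit the constraint of [S k], and high enough for [nu] to be
   close to its supremum. With the constant 8, the midpoint identity bounds [D] by four times a gap
   of at most [w / 4]. *)
have pick k : exists an : V * nat, [/\ (k <= an.2)%N, S an.2 an.1,
    mu - u k / 8 < nu an.2 & N an.1 < mu + u k / 8].
  have uk8 : 0 < u k / 8 by rewrite divr_gt0.
  have [_ [n _ <-] hn] := sup_adherent uk8 mu_sup.
  set m := maxn k n.
  have nm : nu n <= nu m.
    apply: lb_le_inf; first by have [a Sa] := S_ex m; exists (N a); exists a.
    move=> _ [a Sa <-]; apply: ge_inf; first by case: (nu_inf n).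
    by exists a => //; apply: S_le Sa; rewrite leq_maxr.
  have mmu : nu m <= mu by apply: ub_le_sup; [case: mu_sup | exists m].
  have [_ [a Sa <-] ha] := inf_adherent uk8 (nu_inf m).
  exists (a, m); split=> //=; rewrite ?leq_maxl//; rewrite -/mu -/(nu m) in hn ha *; lra.
have [f hf] := choice pick.
exists (fun k => (f k).1); split.
- by move=> n; have [_ []] := hf n.
- by move=> n; have [kn Sf _ _] := hf n; have [] := S_le _ _ kn _ Sf.
move=> j k; have [_ Sj mj Nj] := hf j; have [_ Sk mk Nk] := hf k.
have half : 0 <= (2^-1 : R) <= 1 by rewrite invr_ge0 ler0n invf_le1// ler1n.
have Aj := proj1 Sj; have Ak := proj1 Sk.
set w := Num.max (u j) (u k).
have wj : u j <= w by rewrite le_max lexx.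
have wk : u k <= w by rewrite le_max lexx orbT.
(* At the smaller of the two levels the sublevel set contains both controls, hence also their
   midpoint. *)
have [n [nS1 nS2 nmu]] : exists n, [/\ S n (f j).1, S n (f k).1 & mu - w / 8 < nu n].
  have [jk|kj] := leqP (f j).2 (f k).2.
    by exists (f j).2; split=> //; [exact: S_le Sk | lra].
  by exists (f k).2; split=> //; [apply: S_le Sj; exact: ltnW | lra].
have : nu n <= N (mixV 2^-1 (f j).1 (f k).1).
  apply: ge_inf; first by case: (nu_inf n).
  by exists (mixV 2^-1 (f j).1 (f k).1) => //; exact: S_mix.
rewrite N_mix//; lra.
Qed.
End minimax.

(** * Square integrable functions and their inner product *)

Section square_integrable.
Context {d : measure_display} {T : measurableType d} {R : realType}.
Variable mu : {measure set T -> \bar R}.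
Implicit Types (f g h : T -> R) (a b : R).

Definition sqint f := measurable_fun [set: T] f /\
  mu.-integrable [set: T] (EFin \o (fun x => f x ^+ 2)).

Definition ip f g : R := \int[mu]_x (f x * g x).

Lemma sqint_mul f g : sqint f -> sqint g ->
  mu.-integrable [set: T] (EFin \o (fun x => f x * g x)).
Proof.
move=> [mf f2] [mg g2].
apply: (@le_integrable _ _ _ _ _ measurableT _
  (EFin \o (fun x => f x ^+ 2 + g x ^+ 2))) => //.
- by apply/measurable_EFinP; exact: measurable_funM.
- move=> x _ /=; rewrite lee_fin.
  rewrite [leRHS]ger0_norm ?addr_ge0 ?sqr_ge0//.
  have := sqr_ge0 (f x - g x); have := sqr_ge0 (f x + g x) => h1 h2.
  by rewrite ler_norml; apply/andP; split; lra.
- have := integrableD measurableT f2 g2.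
  by apply: eq_integrable => // x _ /=; rewrite EFinD.
Qed.

Lemma sqint_lin a b f g : sqint f -> sqint g ->
  sqint (fun x => a * f x + b * g x).
Proof.
move=> sf sg; have [[mf f2] [mg g2]] := (sf, sg); split.
  by apply: measurable_funD; exact: measurable_funM.
have h1 := integrableZl measurableT (a ^+ 2) f2.
have h2 := integrableZl measurableT (b ^+ 2) g2.
have h3 := integrableZl measurableT (2 * a * b) (sqint_mul sf sg).
have := integrableD measurableT (integrableD measurableT h1 h2) h3.
apply: eq_integrable => // x _ /=.
by rewrite -!EFinM -!EFinD; congr (_%:E); lra.
Qed.

Lemma sqintB f g : sqint f -> sqint g -> sqint (fun x => f x - g x).
Proof.
move=> sf sg; have := sqint_lin 1 (-1) sf sg.
by under eq_fun do rewrite mul1r mulN1r.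
Qed.

Lemma ipC f g : ip f g = ip g f.
Proof. by apply: eq_Rintegral => x _; rewrite mulrC. Qed.

Lemma ip_linl a b f g h : sqint f -> sqint g -> sqint h ->
  ip (fun x => a * f x + b * g x) h = a * ip f h + b * ip g h.
Proof.
move=> sf sg sh; have fh := sqint_mul sf sh; have gh := sqint_mul sg sh.
have fh' := integrableZl measurableT a fh.
have gh' := integrableZl measurableT b gh.
rewrite /ip -RintegralZl// -RintegralZl//.
rewrite -RintegralD//.
by apply: eq_Rintegral => x _; rewrite mulrDl !mulrA.
Qed.

Lemma ipBl f g h : sqint f -> sqint g -> sqint h ->
  ip (fun x => f x - g x) h = ip f h - ip g h.
Proof.
move=> sf sg sh; have := ip_linl 1 (-1) sf sg sh.
rewrite mul1r mulN1r => <-.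
by apply: eq_Rintegral => x _; rewrite mul1r mulN1r.
Qed.

Lemma ip_ge0 f : 0 <= ip f f.
Proof. by apply: Rintegral_ge0 => x _; rewrite -expr2 sqr_ge0. Qed.

Lemma ip_sqr a b f g : sqint f -> sqint g ->
  ip (fun x => a * f x + b * g x) (fun x => a * f x + b * g x) =
  a ^+ 2 * ip f f + 2 * a * b * ip f g + b ^+ 2 * ip g g.
Proof.
move=> sf sg; have s := sqint_lin a b sf sg.
rewrite ip_linl// (ipC f) (ipC g) !ip_linl// (ipC g f); lra.
Qed.

Lemma ip_cauchy f g : sqint f -> sqint g -> ip f g ^+ 2 <= ip f f * ip g g.
Proof.
move=> sf sg; have [g0|g0] := eqVneq (ip g g) 0; last first.
  have gp : 0 < ip g g by rewrite lt_def g0 ip_ge0.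
  have := ip_ge0 (fun x => ip g g * f x + (- ip f g) * g x).
  rewrite ip_sqr// => h.
  by rewrite -(ler_pM2l gp); lra.
rewrite g0 mulr0; apply: le_trans (lexx 0).
rewrite le_eqVlt; apply/orP; left; rewrite sqrf_eq0; apply/eqP.
have h a : 0 <= ip f f + 2 * a * ip f g.
  by have := ip_ge0 (fun x => 1 * f x + a * g x); rewrite ip_sqr// g0; lra.
apply/eqP; apply: contraT => fg0.
(* For this [a] the right side of [h] equals -1. *)
set a := - (ip f f + 1) / (2 * ip f g).
have : a * (2 * ip f g) = - (ip f f + 1) by rewrite divfK// mulf_neq0.
have := h a; lra.
Qed.

Lemma ip_norm_le f g : sqint f -> sqint g ->
  `|ip f g| <= Num.sqrt (ip f f) * Num.sqrt (ip g g).
Proof.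
move=> sf sg; rewrite -sqrtrM ?ip_ge0// -sqrtr_sqr ler_sqrt ?mulr_ge0 ?ip_ge0//.
exact: ip_cauchy.
Qed.

Lemma EFin_ip f : sqint f -> (ip f f)%:E = (\int[mu]_x (f x ^+ 2)%:E)%E.
Proof.
move=> [mf f2]; rewrite /ip /Rintegral fineK.
  by apply: eq_integral => x _; rewrite expr2.
by have := integrable_fin_num measurableT f2.
Qed.

Lemma sqintP f : measurable_fun [set: T] f ->
  (\int[mu]_x (f x ^+ 2)%:E < +oo)%E -> sqint f.
Proof.
move=> mf f2; split=> //; apply/integrableP; split.
  by apply/measurable_EFinP; exact: measurable_funX.
by under eq_integral do rewrite /= ger0_norm ?sqr_ge0//.
Qed.

Lemma Lnorm2E f : ('N[mu]_(2%:E) [EFin \o f] =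
  (\int[mu]_x (f x ^+ 2)%:E) `^ 2^-1)%E.
Proof.
rewrite unlock; congr (_ `^ _)%E; apply: eq_integral => x _ /=.
by rewrite powR_mulrn// real_normK ?num_real.
Qed.

Lemma Lnorm2_le f a : 0 <= a ->
  ('N[mu]_(2%:E) [EFin \o f] <= a%:E)%E =
  (\int[mu]_x (f x ^+ 2)%:E <= (a ^+ 2)%:E)%E.
Proof.
move=> a0; rewrite Lnorm2E.
have : (0 <= \int[mu]_x (f x ^+ 2)%:E)%E.
  by apply: integral_ge0 => x _; rewrite lee_fin sqr_ge0.
case: (\int[mu]_x _)%E => [r| |]//; last by rewrite poweRyr ?invr_neq0// !leye_eq.
rewrite lee_fin => r0; rewrite poweR_EFin !lee_fin powR12_sqrt//.
rewrite -{1}(ger0_norm a0) -sqrtr_sqr ler_sqrt ?sqr_ge0//.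
Qed.

Lemma Lnorm2_sqint f : sqint f ->
  ('N[mu]_(2%:E) [EFin \o f] = (Num.sqrt (ip f f))%:E)%E.
Proof. by move=> sf; rewrite Lnorm2E -EFin_ip// poweR_EFin powR12_sqrt// ip_ge0. Qed.

Lemma Lnorm2_lty f : measurable_fun [set: T] f ->
  ('N[mu]_(2%:E) [EFin \o f] < +oo)%E -> sqint f.
Proof.
move=> mf; rewrite Lnorm2E => h; apply: sqintP => //.
exact: (lty_poweRy (r := 2^-1)).
Qed.

End square_integrable.

(** * Duality of Lebesgue norms on a probability space *)

Section Lnorm_duality.
Context {d : measure_display} {T : measurableType d} {R : realType}.
Variable P : probability T R.
Implicit Types (X Y : T -> R) (r : \bar R).

Lemma LnormyE (f : T -> \bar R) :
  ('N[P]_(+oo) [f] = ess_sup P (abse \o f))%E.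
Proof.
rewrite unlock ifT//; have : (0 < P [set: T])%E by rewrite probability_setT.
exact.
Qed.

Lemma bounded_integrable X : measurable_fun [set: T] X ->
  (exists M, forall w, `|X w| <= M) -> P.-integrable [set: T] (EFin \o X).
Proof.
move=> mX [M XM]; apply: measurable_bounded_integrable => //.
  have : (P [set: T] < +oo)%E by rewrite probability_setT ltry.
  exact.
exists M; split=> [|N MN w _ /=]; first exact: num_real.
by rewrite (le_trans (XM w))// ltW.
Qed.

Lemma hoelder_conj_fin (s : R) : 1 < s ->
  hoelder_conjugate s%:E = (s / (s - 1))%:E.
Proof.
move=> s1; rewrite /hoelder_conjugate/= eqe gt_eqF ?(lt_trans ltr01)//.
by rewrite -EFinB inver subr_eq0 gt_eqF// EFinM.
Qed.

Lemma hoelder_infty X Y : measurable_fun [set: T] X ->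
  measurable_fun [set: T] Y ->
  ('N[P]_1 [EFin \o (X \* Y)%R] <=
   'N[P]_(+oo) [EFin \o X] * 'N[P]_1 [EFin \o Y])%E.
Proof.
move=> mX mY; rewrite !Lnorm1 LnormyE.
set s := ess_sup _ _.
have s0 : (0 <= s)%E.
  by have := Lnorm_ge0 P +oo (EFin \o X); rewrite LnormyE.
rewrite -ge0_integralZl//; first last.
  by do 2 apply: measurableT_comp => //.
apply: ae_ge0_le_integral => //.
- by apply: measurableT_comp => //; apply/measurable_EFinP; exact: measurable_funM.
- by move=> x _; rewrite mule_ge0.
- by apply: measurable_funeM; do 2 apply: measurableT_comp => //.
apply: filterS (ess_sup_ge P (abse \o (EFin \o X))) => x Xs _.
by rewrite /= normrM EFinM lee_wpmul2r.
Qed.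

Lemma hoelder_ereal X Y r : (1 <= r)%E -> measurable_fun [set: T] X ->
  measurable_fun [set: T] Y ->
  ('N[P]_1 [EFin \o (X \* Y)%R] <=
   'N[P]_r [EFin \o X] * 'N[P]_(hoelder_conjugate r) [EFin \o Y])%E.
Proof.
case: r => [s| |//] r1 mX mY; last exact: hoelder_infty.
move: r1; rewrite lee_fin le_eqVlt => /orP[/eqP <-|s1].
  rewrite hoelder_conjugate1 muleC.
  apply: le_trans (hoelder_infty mY mX).
  by rewrite le_eqVlt; apply/orP; left; apply/eqP; apply: eq_Lnorm => x /=; rewrite mulrC.
have s0 : 0 < s by rewrite (lt_trans ltr01).
rewrite hoelder_conj_fin//; apply: hoelder => //.
  by rewrite divr_gt0// subr_gt0.
rewrite invf_div mulrBl divff ?gt_eqF// mul1r; lra.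
Qed.

(** A sign equal to 1 at 0, hence of modulus 1 everywhere; indicators make its measurability
    immediate. *)
Let sgn (x : R) : R := \1_(`[0, +oo[%classic) x - \1_(`]-oo, 0[%classic) x.

Let sgnE x : sgn x = if 0 <= x then 1 else -1.
Proof.
rewrite /sgn !indicE !mem_setE !in_itv/= andbT.
by case: (leP 0 x) => _; rewrite mulr1n mulr0n ?subr0 ?sub0r.
Qed.

Let sgnM x : x * sgn x = `|x|.
Proof. rewrite sgnE; case: (leP 0 x) => h; first by rewrite mulr1 ger0_norm.
by rewrite mulrN1 ltr0_norm.
Qed.

Let sgn1 x : `|sgn x| = 1.
Proof. by rewrite sgnE; case: ifP; rewrite ?normrN normr1. Qed.

Let measurable_sgn : measurable_fun [set: R] sgn.
Proof. by apply: measurable_funB; exact: measurable_indic. Qed.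

(** Only bounded functions of [X] itself serve as tests. Boundedness makes all pairings integrable,
    and a function of [X] is measurable for any sigma-algebra for which [X] is. *)
Definition dual_test r X (c : R) := forall g : R -> R,
  measurable_fun [set: R] g -> (exists M, forall x, `|g x| <= M) ->
  ('N[P]_(hoelder_conjugate r) [EFin \o (g \o X)] <= 1)%E ->
  \int[P]_w (X w * g (X w)) <= c.

(** If [|X| > c] had positive probability [p], the test [sgn x / p] on [|x| > c] would have [L^1]
    norm 1 and bound the mean of [|X|] over that event by [c]. Then [(|X| - c)^+] integrates to 0,
    which contradicts its being positive there. *)
Lemma Lnorm_le_dual_infty X (c : R) : 0 <= c -> P.-integrable [set: T] (EFin \o X) ->
  dual_test +oo X c -> ('N[P]_(+oo) [EFin \o X] <= c%:E)%E.
Proof.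
move=> c0 iX hX; have mX : measurable_fun [set: T] X.
  by apply/measurable_EFinP; exact: measurable_int iX.
rewrite LnormyE; apply/ess_supP.
have mnX : measurable_fun [set: T] (Num.norm \o X) by exact: measurableT_comp.
set S := [set w | c < `|X w|].
have mS : measurable S.
  have := mnX measurableT _ (measurable_itv `]c, +oo[).
  rewrite setTI; congr measurable; apply/seteqP; split => x /=;
    by rewrite in_itv/= andbT.
suff PS : P S = 0%E.
  exists S; split=> // w /=.
  by rewrite lee_fin => /negP; rewrite -ltNge.
apply/eqP; apply: contraT => PS0.
have PSpos : (0 < P S)%E by rewrite lt0e PS0 measure_ge0.
set p := fine (P S).
have pE : P S = p%:E by rewrite fineK// fin_num_measure.
have p0 : 0 < p by rewrite -lte_fin -pE.
pose I := (fun x : R => \1_[set x | c < `|x|] x : R).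
have mI : measurable_fun [set: R] I.
  apply: measurable_indic.
  have := (@normr_measurable R [set: R]) measurableT _ (measurable_itv `]c, +oo[).
  rewrite setTI; congr measurable; apply/seteqP; split => x /=;
    by rewrite in_itv/= andbT.
have I01 x : 0 <= I x <= 1 by rewrite /I indicE; case: (_ \in _); rewrite ?lexx ?ler01.
pose g x := p^-1 * (sgn x * I x).
have mg : measurable_fun [set: R] g.
  by apply: measurable_funM => //; apply: measurable_funM.
have gE x : `|g x| = p^-1 * I x.
  by rewrite /g !normrM sgn1 mul1r !ger0_norm ?invr_ge0 ?(ltW p0)//; case/andP: (I01 x).
have IP : (\int[P]_w (I (X w))%:E = p%:E)%E.
  transitivity (\int[P]_w (\1_S w)%:E)%E; last by rewrite integral_indic// setIT.
  by apply: eq_integral => w _; rewrite /I !indicE.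
have {hX}: \int[P]_w (X w * g (X w)) <= c.
  apply: hX => //.
  - exists p^-1 => x; rewrite gE ger_pMr ?invr_gt0//; by case/andP: (I01 x).
  - rewrite hoelder_conjugatey Lnorm1.
    under eq_integral do rewrite /= gE EFinM.
    rewrite ge0_integralZl//; first last.
    + by rewrite lee_fin invr_ge0 ltW.
    + by move=> w _; rewrite lee_fin; case/andP: (I01 (X w)).
    + by apply/measurable_EFinP; exact: measurableT_comp.
    by rewrite IP -EFinM mulVf// gt_eqF.
have mIX : measurable_fun [set: T] (I \o X) by exact: measurableT_comp.
have iIX : P.-integrable [set: T] (EFin \o (I \o X)).
  apply: bounded_integrable => //; exists 1 => w.
  by have /andP[h0 h1] := I01 (X w); rewrite /= ger0_norm.
pose h w := (`|X w| - c) * I (X w).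
have h0 w : 0 <= h w.
  rewrite /h /I indicE; have [/set_mem /= cX|_] := boolP (_ \in _).
    by rewrite mulr1 subr_ge0 ltW.
  by rewrite mulr0.
have ih : P.-integrable [set: T] (EFin \o h).
  apply: (@le_integrable _ _ _ _ _ measurableT _ (EFin \o (fun w => `|X w| + c * I (X w)))).
  - apply/measurable_EFinP; apply: measurable_funM => //.
    by apply: measurable_funB.
  - move=> w _ /=; rewrite lee_fin ger0_norm// ger0_norm; last first.
      by rewrite addr_ge0 ?mulr_ge0//; case/andP: (I01 (X w)).
    rewrite /h mulrBl; have /andP[i0 i1] := I01 (X w).
    have := ler_piMr (normr_ge0 (X w)) i1; have := mulr_ge0 c0 i0; lra.
  - have := integrableD measurableT (integrable_norm iX) (integrableZl measurableT c iIX).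
    by apply: eq_integrable.
have -> : \int[P]_w (X w * g (X w)) = p^-1 * \int[P]_w (h w + c * I (X w)).
  rewrite -RintegralZl//.
    by apply: eq_Rintegral => w _; rewrite /g mulrCA [X w * (_ * _)]mulrA sgnM /h; lra.
  have := integrableD measurableT ih (integrableZl measurableT c iIX).
  by apply: eq_integrable.
have icI := integrableZl measurableT c iIX.
rewrite RintegralD// RintegralZl// {2}/Rintegral IP /= -ler_pdivlMl ?invr_gt0// invrK.
rewrite [p * c]mulrC gerDr => hle.
have hz : (\int[P]_w `|(h w)%:E| = 0)%E.
  apply/eqP; rewrite eq_le; apply/andP; split; last exact: integral_ge0.
  under eq_integral do rewrite gee0_abs ?lee_fin//.
  by rewrite -(fineK (integrable_fin_num measurableT ih)) lee_fin.
have [N [mN N0 hN]] : ae_eq P [set: T] (EFin \o h) (cst 0%E).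
  by apply/(ae_eq_integral_abs P measurableT _) => //; exact: measurable_int ih.
have SN : S `<=` N.
  move=> w Sw; apply: hN => /= /(_ Logic.I) [].
  by move/eqP; rewrite /h /I indicE mem_set// mulr1 subr_eq0 gt_eqF.
by rewrite (subset_measure0 mS mN SN N0) eqxx in PS0.
Qed.

(** The test is the extremal of Hoelder's inequality, [sgn x * |x|^(s-1)], truncated to [|x| <= m]
    and divided by its conjugate norm [K]. Pairing it with [X] gives the [L^s] norm of the
    truncation of [X], and monotone convergence removes [m]. *)
Lemma Lnorm_le_dual_fin X (s c : R) : 1 <= s -> 0 <= c ->
  P.-integrable [set: T] (EFin \o X) ->
  dual_test s%:E X c -> ('N[P]_(s%:E) [EFin \o X] <= c%:E)%E.
Proof.
move=> s1 c0 iX hX; have mX : measurable_fun [set: T] X.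
  by apply/measurable_EFinP; exact: measurable_int iX.
have s0 : 0 < s by rewrite (lt_le_trans ltr01).
pose I (m : nat) := (fun x : R => \1_(`[- m%:R, m%:R]%classic) x : R).
have mI m : measurable_fun [set: R] (I m) by exact: measurable_indic.
have IE m x : I m x = (`|x| <= m%:R)%R%:R.
  by rewrite /I indicE mem_setE in_itv/= ler_norml.
have I0 m x : 0 <= I m x by rewrite IE ler0n.
pose X_ m w := `|X w| `^ s * I m (X w).
have mX_ m : measurable_fun [set: T] (X_ m).
  apply: measurable_funM; last exact: measurableT_comp.
  apply: (@measurableT_comp _ _ _ _ _ _ (fun x : R => x `^ s)) => //.
  exact: measurableT_comp.
have X_ge0 m w : 0 <= X_ m w by rewrite mulr_ge0 ?powR_ge0.
have iX_ m : P.-integrable [set: T] (EFin \o X_ m).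
  apply: bounded_integrable => //; exists (m%:R `^ s) => w.
  rewrite ger0_norm// /X_ IE; case: (lerP `|X w| m%:R) => h.
    by rewrite mulr1 ge0_ler_powR// ?nnegrE ?(ltW s0).
  by rewrite mulr0 powR_ge0.
pose k m := \int[P]_w X_ m w.
have kE m : (\int[P]_w (X_ m w)%:E = (k m)%:E)%E.
  by rewrite /k /Rintegral fineK//; exact: (integrable_fin_num measurableT (iX_ m)).
have k_ge0 m : 0 <= k m by exact: Rintegral_ge0.
have kle m : k m <= c `^ s.
  have [k0|k0] := eqVneq (k m) 0; first by rewrite k0 powR_ge0.
  have kp : 0 < k m by rewrite lt_def k0 k_ge0.
  pose K := k m `^ ((s - 1) / s).
  have Kp : 0 < K by exact: powR_gt0.
  pose g x := K^-1 * (sgn x * (`|x| `^ (s - 1) * I m x)).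
  have mg : measurable_fun [set: R] g.
    apply: measurable_funM => //; apply: measurable_funM => //.
    apply: measurable_funM => //.
    by apply: (@measurableT_comp _ _ _ _ _ _ (fun x : R => x `^ (s - 1))).
  have gE x : `|g x| = K^-1 * (`|x| `^ (s - 1) * I m x).
    rewrite /g !normrM sgn1 mul1r (ger0_norm (powR_ge0 _ _)) (ger0_norm (I0 _ _)).
    by rewrite ger0_norm// invr_ge0 ltW.
  have gb x : `|g x| <= K^-1 * m%:R `^ (s - 1).
    rewrite gE ler_pM2l ?invr_gt0// IE; case: (lerP `|x| m%:R) => h.
      by rewrite mulr1 ge0_ler_powR// ?nnegrE ?subr_ge0.
    by rewrite mulr0 powR_ge0.
  have : \int[P]_w (X w * g (X w)) <= c.
    apply: hX => //; first by exists (K^-1 * m%:R `^ (s - 1)).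
    (* At [s = 1] the conjugate exponent is infinite, [K] is 1 and [g] is a truncated sign. *)
    move: s1; rewrite le_eqVlt => /orP[/eqP s1|s1].
      rewrite -s1 hoelder_conjugate1 LnormyE.
      apply/ess_supP/aeW => w /=.
      rewrite lee_fin gE /K -s1 subrr mul0r !powRr0 invr1 !mul1r IE.
      by rewrite lern1; case: (_ <= _).
    rewrite hoelder_conj_fin// unlock.
    set q := s / (s - 1).
    have s10 : 0 < s - 1 by rewrite subr_gt0.
    have q0 : 0 < q by rewrite divr_gt0.
    have sq : (s - 1) * q = s by rewrite /q mulrCA mulfV ?mulr1// gt_eqF.
    have Kq : K `^ q = k m.
      rewrite /K -powRrM /q mulrA mulfVK ?gt_eqF// divff ?gt_eqF// powRr1//.
    rewrite [X in (X `^ _)%E](_ : _ = 1%E) ?poweR1r//.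
    transitivity (\int[P]_w (((k m)^-1)%:E * (X_ m w)%:E))%E.
      apply: eq_integral => w _ /=; rewrite -EFinM; congr (_%:E).
      rewrite gE powRM ?invr_ge0 ?(ltW Kp)//; last first.
        by rewrite mulr_ge0 ?powR_ge0.
      rewrite -powR_inv1 ?(ltW Kp)// powRAC Kq powR_inv1//; congr (_ * _).
      rewrite powRM ?powR_ge0//.
      rewrite -powRrM sq /X_ IE; congr (_ * _).
      by case: (_ <= _); rewrite ?powR1// powR0// gt_eqF.
    rewrite ge0_integralZl//; first last.
    - by rewrite lee_fin invr_ge0 k_ge0.
    - by move=> w _; rewrite lee_fin.
    - exact/measurable_EFinP.
    by rewrite kE -EFinM mulVf.
  have -> : \int[P]_w (X w * g (X w)) = K^-1 * k m.
    rewrite /k -RintegralZl//; apply: eq_Rintegral => w _.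
    rewrite /g mulrCA [X w * (_ * _)]mulrA sgnM [`|X w| * (_ * _)]mulrA.
    by rewrite mulr_powRB1.
  have kK : K^-1 * k m = k m `^ s^-1.
    rewrite /K -powRN -{2}(powRr1 (ltW kp)) -powRD ?k0 ?implybT//.
    by congr (_ `^ _); rewrite mulrBl divff ?gt_eqF// mul1r opprB subrK.
  rewrite kK => h.
  have := @ge0_ler_powR _ s (ltW s0) (k m `^ s^-1) c.
  rewrite !nnegrE powR_ge0 => /(_ isT c0 h).
  by rewrite -powRrM mulVf ?gt_eqF// powRr1// ltW.
rewrite unlock.
have h : (\int[P]_w (`|X w| `^ s)%:E <= (c `^ s)%:E)%E.
  have -> : (\int[P]_w (`|X w| `^ s)%:E =
      \int[P]_w (limn (fun m => (X_ m w)%:E)))%E.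
    apply: eq_integral => w _; apply/esym/cvg_lim => //.
    apply: cvg_near_cst; exists (Num.truncn `|X w|).+1 => // m /= hm.
    rewrite /X_ IE [X in _ * X](_ : _ = 1) ?mulr1//.
    rewrite (_ : `|X w| <= m%:R)//.
    by rewrite (le_trans (ltW (truncnS_gt _)))// ler_nat.
  rewrite monotone_convergence//.
  - apply: lime_le.
      apply: ereal_nondecreasing_is_cvgn => a b ab; apply: ge0_le_integral => //.
      + by move=> w _; rewrite lee_fin.
      + exact/measurable_EFinP.
      + exact/measurable_EFinP.
      move=> w _; rewrite lee_fin /X_ ler_wpM2l ?powR_ge0// !IE ler_nat.
      case: (lerP `|X w| a%:R) => // h.
      by rewrite (le_trans h)// ler_nat.
    by apply: nearW => m; rewrite kE lee_fin.
  - by move=> m; exact/measurable_EFinP.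
  - by move=> m w _; rewrite lee_fin.
  - move=> w _ a b ab; rewrite lee_fin /X_ ler_wpM2l ?powR_ge0// !IE ler_nat.
    case: (lerP `|X w| a%:R) => // h.
    by rewrite (le_trans h)// ler_nat.
have -> : c%:E = ((c `^ s)%:E `^ s^-1)%E.
  by rewrite poweR_EFin -powRrM mulfV ?gt_eqF// powRr1.
apply: gt0_ler_poweR => //; rewrite ?invr_ge0 ?(ltW s0)//.
- by rewrite in_itv/= leey integral_ge0.
- by rewrite in_itv/= leey lee_fin powR_ge0.
Qed.

Lemma Lnorm_le_dual X r (c : R) : (1 <= r)%E -> 0 <= c ->
  P.-integrable [set: T] (EFin \o X) ->
  dual_test r X c -> ('N[P]_r [EFin \o X] <= c%:E)%E.
Proof.
case: r => [s| |//] r1; last exact: Lnorm_le_dual_infty.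
exact: Lnorm_le_dual_fin.
Qed.

End Lnorm_duality.

(** * Conditional expectation *)

Section conditional_expectation_theory.
Context {d : measure_display} {T : measurableType d} {R : realType}.
Variable P : probability T R.
Variable G : set (set T).
Hypothesis GM : forall A, G A -> measurable A.
Implicit Types (X Y Z W : T -> R).
Local Notation TG := (g_sigma_algebraType G).

Lemma sigma_sub A : <<s G >> A -> measurable A.
Proof.
have : <<s G >> `<=` @measurable d T by apply: smallest_sub => //; exact: sigma_algebra_measurable.
exact.
Qed.

Lemma measurable_fun_sub d' (T' : measurableType d') (f : T -> T') :
  measurable_fun [set: TG] f -> measurable_fun [set: T] f.
Proof.
move=> mf _ A mA; apply: sigma_sub.
exact: (mf measurableT A mA).
Qed.

Let mid : measurable_fun [set: T] (id : T -> TG).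
Proof. by move=> _ A mA; rewrite setTI; exact: sigma_sub. Qed.

Section existence.
Variables (Y : T -> R) (iY : P.-integrable [set: T] (EFin \o Y)).

Let nu (A : set TG) : \bar R := (\int[P]_(w in A) (Y w)%:E)%E.

Let nu0 : nu set0 = 0%E.
Proof. by rewrite /nu integral_set0. Qed.

Let nu_fin A : measurable A -> nu A \is a fin_num.
Proof. by move=> mA; exact: (@fin_num_measure _ _ _ (induced_charge iY) A (sigma_sub mA)). Qed.

Let nu_sigma : semi_sigma_additive nu.
Proof.
move=> F mF tF mUF; apply: (@charge_semi_sigma_additive _ _ _ (induced_charge iY)) => //.
- by move=> n; exact: sigma_sub (mF n).
- exact: sigma_sub mUF.
Qed.

HB.instance Definition _ := isCharge.Build _ TG R nu nu0 nu_fin nu_sigma.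

Let Q (A : set TG) : \bar R := P A.

Let Q0 : Q set0 = 0%E. Proof. exact: measure0. Qed.
Let Q_ge0 A : (0 <= Q A)%E. Proof. exact: measure_ge0. Qed.
Let Q_sigma : semi_sigma_additive Q.
Proof.
move=> F mF tF mUF; apply: (@measure_semi_sigma_additive _ _ _ P) => //.
- by move=> n; exact: sigma_sub (mF n).
- exact: sigma_sub mUF.
Qed.
HB.instance Definition _ := isMeasure.Build _ TG R Q Q0 Q_ge0 Q_sigma.
Let QT : Q setT = 1%E. Proof. exact: probability_setT. Qed.
HB.instance Definition _ := Measure_isProbability.Build _ TG R Q QT.

(** The version is the Radon-Nikodym derivative of the charge [nu] with respect to [Q], the
    restriction of [P] to the sub-sigma-algebra. *)
Lemma cond_exp_exists : exists Z, is_cond_exp P G Y Z.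
Proof.
have dom : nu `<< Q.
  apply/null_content_dominatesP => A mA QA.
  apply: null_set_integral => //; first exact: sigma_sub.
  exact: measurable_funTS (measurable_int _ iY).
(* [Q] is the image of [P] under the identity from [T] to [TG], so integrals transfer by change of
   variables. *)
have QE (A : set TG) (f : TG -> \bar R) : measurable A ->
    measurable_fun [set: TG] f -> (forall x, 0 <= f x)%E ->
    (\int[Q]_(x in A) f x = \int[P]_(x in A) f x)%E.
  move=> mA mf f0.
  have -> : (\int[Q]_(x in A) f x = \int[pushforward P (id : T -> TG)]_(x in A) f x)%E.
    exact: eq_measure_integral.
  by rewrite ge0_integral_pushforward//; exact: measurable_funTS.
pose f := Radon_Nikodym nu Q.
have ff x : f x \is a fin_num by exact: Radon_Nikodym_fin_num.
have iF : Q.-integrable [set: TG] f by exact: Radon_Nikodym_integrable.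
have mf : measurable_fun [set: TG] f by exact: measurable_int iF.
exists (fine \o f).
have fE : EFin \o (fine \o f) = f by apply/funext => x /=; rewrite fineK.
have iPf : P.-integrable [set: T] f.
  apply/integrableP; split; first exact: measurable_fun_sub.
  have [_] := integrableP _ _ _ iF; rewrite QE//.
  exact: measurableT_comp.
split.
- exact: measurableT_comp.
- by rewrite fE.
- move=> A GA; have mA := sigma_sub GA.
  have -> : (\int[P]_(w in A) ((fine \o f) w)%:E = \int[P]_(w in A) f w)%E.
    by apply: eq_integral => w _; rewrite /= fineK.
  have -> : (\int[P]_(w in A) (Y w)%:E = \int[Q]_(w in A) f w)%E.
    exact: (Radon_Nikodym_integral dom).
  rewrite integralE [RHS]integralE; congr (_ - _)%E.
    by rewrite QE//; exact: measurable_funepos.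
  by rewrite QE//; exact: measurable_funeneg.
Qed.

End existence.

Lemma cond_expP Y : P.-integrable [set: T] (EFin \o Y) ->
  is_cond_exp P G Y (cond_exp P G Y).
Proof. by move=> iY; apply: (@xgetPex _ (cst 0) _ (cond_exp_exists iY)). Qed.

Import HBNNSimple.

Lemma ge0_integral_sub_nnsfun (f : T -> R) (h : {nnsfun TG >-> R}) :
  measurable_fun [set: T] f -> (forall w, 0 <= f w) ->
  (\int[P]_w (h w * f w)%:E =
   \sum_(r \in range h) (r%:E * \int[P]_(w in h @^-1` [set r]) (f w)%:E))%E.
Proof.
move=> mf f0.
have mh r : measurable (h @^-1` [set r] : set T).
  by apply: sigma_sub; exact: (measurable_funPTI h (measurable_set1 r)).
transitivity (\int[P]_w (\sum_(r \in range h) (r * (f \_ (h @^-1` [set r])) w)%:E))%E.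
  apply: eq_integral => w _; rewrite fsumEFin//; congr (_%:E).
  rewrite {1}fimfunE mulr_fsuml//; apply: eq_fsbigr => r _.
  by rewrite -mulrA patchE indicE; case: (_ \in _); rewrite ?mul1r// mul0r.
rewrite ge0_integral_fsum//; last 2 first.
- move=> r; apply/measurable_EFinP; apply: measurable_funM => //.
  by apply/(measurable_restrictT _ _).1 => //; exact: measurable_funTS.
- move=> r w _; rewrite lee_fin patchE; case: ifPn => [/set_mem hr|_]; last by rewrite mulr0.
  by rewrite mulr_ge0// -hr.
apply: eq_fsbigr => r /set_mem [x _ hx].
under eq_integral do rewrite EFinM.
rewrite ge0_integralZl//; first last.
- by rewrite lee_fin -hx.
- by move=> w _; rewrite lee_fin patchE; case: ifP.
- apply/measurable_EFinP/(measurable_restrictT _ _).1 => //; exact: measurable_funTS.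
congr (_ * _)%E; rewrite [RHS]integral_mkcond; apply: eq_integral => w _.
by rewrite !patchE; case: ifP.
Qed.

(** Equality of integrals over sets passes to simple weights by linearity and to nonnegative ones by
    monotone convergence, with no integrability assumption. It serves conditional expectations, and
    also independence, with an indicator as [f] and a constant as [g]. *)
Lemma ge0_integral_subM (f g W : T -> R) :
  measurable_fun [set: T] f -> (forall w, 0 <= f w) ->
  measurable_fun [set: T] g -> (forall w, 0 <= g w) ->
  (forall A, <<s G >> A -> \int[P]_(w in A) (f w)%:E = \int[P]_(w in A) (g w)%:E)%E ->
  measurable_fun [set: TG] W -> (forall w, 0 <= W w) ->
  (\int[P]_w (W w * f w)%:E = \int[P]_w (W w * g w)%:E)%E.
Proof.
move=> mf f0 mg g0 fg mW W0.
have mW' : measurable_fun [set: TG] (EFin \o W) by exact/measurable_EFinP.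
pose h := nnsfun_approx measurableT mW'.
have lim_h (k : T -> R) : measurable_fun [set: T] k -> (forall w, 0 <= k w) ->
    (\int[P]_w (W w * k w)%:E = limn (fun n => \int[P]_w (h n w * k w)%:E))%E.
  move=> mk k0; rewrite -monotone_convergence//.
  - apply: eq_integral => w _; apply/esym/cvg_lim => //.
    under eq_fun do rewrite EFinM.
    rewrite EFinM; apply: cvgeZr => //.
    by apply: cvg_nnsfun_approx => // x _; rewrite lee_fin.
  - move=> n; apply/measurable_EFinP/measurable_funM => //.
    exact/measurable_fun_sub/measurable_funP.
  - by move=> n w _; rewrite lee_fin mulr_ge0.
  - move=> w _ a b ab; rewrite lee_fin ler_wpM2r//.
    by have /lefP := nd_nnsfun_approx measurableT mW' ab; apply.
rewrite !lim_h//; congr (limn _); apply/funext => n.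
rewrite !ge0_integral_sub_nnsfun//; apply: eq_fsbigr => r _; congr (_ * _)%E.
by apply: fg; exact: (measurable_funPTI (h n) (measurable_set1 r)).
Qed.

(** The positive parts of [Y] and [Z] need not have equal integrals over sets of the
    sub-sigma-algebra. The sums [Y^+ + Z^-] and [Z^+ + Y^-] do, and to these the nonnegative case
    applies. *)
Let cond_exp_mul_ge0 Y Z W : P.-integrable [set: T] (EFin \o Y) ->
  is_cond_exp P G Y Z -> measurable_fun [set: TG] W -> (forall w, 0 <= W w) ->
  P.-integrable [set: T] (EFin \o (fun w => W w * Y w)) ->
  P.-integrable [set: T] (EFin \o (fun w => W w * Z w)) ->
  \int[P]_w (W w * Y w) = \int[P]_w (W w * Z w).
Proof.
move=> iY [_ iZ YZ] mW W0 iWY iWZ.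
have mWT : measurable_fun [set: T] W by exact: measurable_fun_sub.
have mY : measurable_fun [set: T] Y by exact/measurable_EFinP/(measurable_int _ iY).
have mZ : measurable_fun [set: T] Z by exact/measurable_EFinP/(measurable_int _ iZ).
(* [Y - Z = f - g] with [f] and [g] nonnegative. *)
pose f w := Num.max (Y w) 0 + Num.max (- Z w) 0.
pose g w := Num.max (Z w) 0 + Num.max (- Y w) 0.
have fgE w : f w - g w = Y w - Z w.
  rewrite /f /g; case: (leP (Y w) 0); case: (leP (Z w) 0); case: (leP (- Y w) 0);
    case: (leP (- Z w) 0); lra.
have fle w : 0 <= f w <= `|Y w| + `|Z w|.
  by rewrite addr_ge0 ?le_max ?lexx ?orbT//= lerD// ge_max ?normr_ge0 ?andbT
    ?ler_norm// -normrN ler_norm.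
have gle w : 0 <= g w <= `|Y w| + `|Z w|.
  by rewrite addr_ge0 ?le_max ?lexx ?orbT//= addrC lerD// ge_max ?normr_ge0
    ?andbT ?ler_norm// -normrN ler_norm.
have mf : measurable_fun [set: T] f.
  apply: measurable_funD; apply: measurable_maxr => //.
  exact: measurable_funN.
have mg : measurable_fun [set: T] g.
  apply: measurable_funD; apply: measurable_maxr => //.
  exact: measurable_funN.
have i_le (h : T -> R) : measurable_fun [set: T] h ->
    (forall w, 0 <= h w <= `|Y w| + `|Z w|) ->
    P.-integrable [set: T] (EFin \o h) /\
    P.-integrable [set: T] (EFin \o (fun w => W w * h w)).
  move=> mh hle; split.
    apply: (@le_integrable _ _ _ _ _ measurableT _ (EFin \o (fun w => `|Y w| + `|Z w|))).
    - exact/measurable_EFinP.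
    - move=> w _ /=; have /andP[h0 h1] := hle w.
      by rewrite lee_fin ger0_norm// ger0_norm// (le_trans h0).
    - have := integrableD measurableT (integrable_norm iY) (integrable_norm iZ).
      by apply: eq_integrable.
  apply: (@le_integrable _ _ _ _ _ measurableT _
    (EFin \o (fun w => `|W w * Y w| + `|W w * Z w|))).
  - exact/measurable_EFinP/measurable_funM.
  - move=> w _ /=; have /andP[h0 h1] := hle w.
    rewrite lee_fin ger0_norm ?mulr_ge0// ger0_norm ?addr_ge0//.
    by rewrite !normrM (ger0_norm (W0 w)) -mulrDr ler_wpM2l.
  - have := integrableD measurableT (integrable_norm iWY) (integrable_norm iWZ).
    by apply: eq_integrable.
have [if_ iWf] := i_le f mf fle.
have [ig iWg] := i_le g mg gle.
have fgA A : <<s G >> A -> (\int[P]_(w in A) (f w)%:E = \int[P]_(w in A) (g w)%:E)%E.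
  move=> GA; have mA := sigma_sub GA.
  have S (h : T -> R) : P.-integrable [set: T] (EFin \o h) -> P.-integrable A (EFin \o h).
    by apply: integrableS.
  have fin h ih := integrable_fin_num mA (S h ih).
  rewrite -[LHS](fineK (fin f if_)) -[RHS](fineK (fin g ig)); congr (_%:E).
  apply/eqP; rewrite -subr_eq0 -[_ - _]/(Rintegral P A f - Rintegral P A g).
  rewrite -RintegralB ?S//.
  under eq_Rintegral do rewrite fgE.
  by rewrite RintegralB ?S// /Rintegral YZ// subrr.
have := ge0_integral_subM mf (fun w => proj1 (andP (fle w))) mg
  (fun w => proj1 (andP (gle w))) fgA mW W0.
move=> /(congr1 fine); rewrite -/(Rintegral P setT (fun w => W w * f w)).
rewrite -/(Rintegral P setT (fun w => W w * g w)) => /eqP.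
rewrite -subr_eq0 -RintegralB//.
under eq_Rintegral do rewrite -mulrBr fgE mulrBr.
by rewrite RintegralB// subr_eq0 => /eqP.
Qed.

Lemma cond_exp_mul Y Z W : P.-integrable [set: T] (EFin \o Y) ->
  is_cond_exp P G Y Z -> measurable_fun [set: TG] W ->
  P.-integrable [set: T] (EFin \o (fun w => W w * Y w)) ->
  P.-integrable [set: T] (EFin \o (fun w => W w * Z w)) ->
  \int[P]_w (W w * Y w) = \int[P]_w (W w * Z w).
Proof.
move=> iY YZ mW iWY iWZ; have [_ iZ _] := YZ.
have mWT : measurable_fun [set: T] W by exact: measurable_fun_sub.
pose Wp w := Num.max (W w) 0; pose Wn w := Num.max (- W w) 0.
have mWp : measurable_fun [set: TG] Wp by exact: measurable_maxr.
have mWn : measurable_fun [set: TG] Wn by apply: measurable_maxr => //; exact: measurable_funN.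
have WE w : W w = Wp w - Wn w.
  by rewrite /Wp /Wn; case: (leP (W w) 0); case: (leP (- W w) 0); lra.
have Wp0 w : 0 <= Wp w by rewrite le_max lexx orbT.
have Wn0 w : 0 <= Wn w by rewrite le_max lexx orbT.
have Wple w : `|Wp w| <= `|W w| by rewrite ger0_norm// ge_max ler_norm/=.
have Wnle w : `|Wn w| <= `|W w| by rewrite ger0_norm// ge_max normr_ge0 andbT -normrN ler_norm.
have i_le (V X : T -> R) : measurable_fun [set: TG] V -> (forall w, `|V w| <= `|W w|) ->
    P.-integrable [set: T] (EFin \o X) ->
    P.-integrable [set: T] (EFin \o (fun w => W w * X w)) ->
    P.-integrable [set: T] (EFin \o (fun w => V w * X w)).
  move=> mV VW iX iWX; apply: le_integrable iWX => //.
    apply/measurable_EFinP/measurable_funM; first exact: measurable_fun_sub.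
    exact/measurable_EFinP/(measurable_int _ iX).
  by move=> w _ /=; rewrite lee_fin !normrM ler_wpM2r.
have E X : P.-integrable [set: T] (EFin \o X) ->
    P.-integrable [set: T] (EFin \o (fun w => W w * X w)) ->
    \int[P]_w (W w * X w) = \int[P]_w (Wp w * X w) - \int[P]_w (Wn w * X w).
  move=> iX iWX; have iWp := i_le Wp X mWp Wple iX iWX.
  have iWn := i_le Wn X mWn Wnle iX iWX; rewrite -RintegralB//.
  by apply: eq_Rintegral => w _; rewrite WE mulrBl.
rewrite (E Y iY iWY) (E Z iZ iWZ); congr (_ - _).
  by apply: cond_exp_mul_ge0 => //; exact: (i_le Wp _ mWp Wple).
by apply: cond_exp_mul_ge0 => //; exact: (i_le Wn _ mWn Wnle).
Qed.

(** Conditional Jensen obtained from duality: a test [g \o Z] is measurable for the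
    sub-sigma-algebra, so [Z] may be replaced by [Y] in its pairing with it, and Hoelder's
    inequality concludes. *)
Lemma cond_exp_Lnorm (r : \bar R) Y Z : (1 <= r)%E ->
  P.-integrable [set: T] (EFin \o Y) -> is_cond_exp P G Y Z ->
  ('N[P]_r [EFin \o Z] <= 'N[P]_r [EFin \o Y])%E.
Proof.
move=> r1 iY YZ; have [mZ iZ _] := YZ.
have mY : measurable_fun [set: T] Y by exact/measurable_EFinP/(measurable_int _ iY).
have := Lnorm_ge0 P r (EFin \o Y).
case E : ('N[P]_r [EFin \o Y])%E => [c| |] //; last by move=> _; rewrite leey.
rewrite lee_fin => c0; apply: Lnorm_le_dual => // g mg [M gM] gN.
have mgZ : measurable_fun [set: TG] (g \o Z) by exact: measurableT_comp.
have mgZT : measurable_fun [set: T] (g \o Z) by exact: measurable_fun_sub.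
have bd : [bounded (g \o Z) w | w in [set: T]].
  exists M; split=> [|N MN w _ /=]; first exact: num_real.
  by rewrite (le_trans (gM _))// ltW.
have i_mul X : P.-integrable [set: T] (EFin \o X) ->
    P.-integrable [set: T] (EFin \o (fun w => (g \o Z) w * X w)).
  by move=> iX; have := integrableMr measurableT mgZT bd iX; apply: eq_integrable.
have -> : \int[P]_w (Z w * g (Z w)) = \int[P]_w ((g \o Z) w * Y w).
  rewrite (cond_exp_mul iY YZ mgZ) ?i_mul//.
  by apply: eq_Rintegral => w _; rewrite mulrC.
rewrite -lee_fin; apply: (@le_trans _ _ ('N[P]_1 [EFin \o (Y \* (g \o Z))%R])%E).
  rewrite Lnorm1 /Rintegral fineK; last exact: integrable_fin_num (i_mul _ iY).
  apply: (le_trans (lee_abs _)); apply: (le_trans (le_abse_integral P measurableT _)).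
    exact: measurable_int (i_mul _ iY).
  apply: ge0_le_integral => //.
  - by apply: measurableT_comp => //; exact: measurable_int (i_mul _ iY).
  - by apply: measurableT_comp => //; apply/measurable_EFinP/measurable_funM.
  - by move=> w _ /=; rewrite mulrC.
apply: (le_trans (hoelder_ereal P r1 mY mgZT)).
rewrite E -[leRHS]mule1; exact: lee_wpmul2l.
Qed.

End conditional_expectation_theory.

Lemma cond_exp_tower {d} {T : measurableType d} {R : realType}
    (P : probability T R) (G H : set (set T)) (Y Z1 Z2 : T -> R) :
  <<s G >> `<=` <<s H >> -> is_cond_exp P G Y Z1 -> is_cond_exp P H Y Z2 ->
  is_cond_exp P G Z2 Z1.
Proof.
move=> GH [m1 i1 h1] [m2 i2 h2]; split=> // A GA.
by rewrite h1// h2//; exact: GH.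
Qed.

(** * Gaussian integrals *)

Section gaussian.
Context {R : realType}.
Local Notation mu := (@lebesgue_measure R).
Implicit Types (f : R -> R).

Lemma ge0_integral_normal_prob s f : measurable_fun [set: R] f ->
  (forall x, 0 <= f x) ->
  (\int[normal_prob 0%R s]_x (f x)%:E =
   \int[mu]_x (f x * normal_pdf 0 s x)%:E)%E.
Proof.
move=> mf f0.
have dom := normal_prob_dominates 0%R s.
pose h := Radon_Nikodym_SigmaFinite.f (normal_prob 0%R s) mu.
have ih : mu.-integrable [set: R] h by exact: Radon_Nikodym_SigmaFinite.f_integrable.
have h0 x : (0 <= h x)%E by exact: Radon_Nikodym_SigmaFinite.f_ge0.
have mp : measurable_fun [set: R] (EFin \o normal_pdf 0 s).
  by apply/measurable_EFinP; exact: measurable_normal_pdf.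
rewrite -(Radon_Nikodym_SigmaFinite.change_of_variables dom)//; last exact/measurable_EFinP.
apply: ge0_ae_eq_integral => //.
- apply: emeasurable_funM; first exact/measurable_EFinP.
  exact: measurable_int ih.
- by apply/measurable_EFinP/measurable_funM => //; exact: measurable_normal_pdf.
- by move=> x _; rewrite mule_ge0 ?lee_fin.
- by move=> x _; rewrite lee_fin mulr_ge0 ?normal_pdf_ge0.
have : ae_eq mu [set: R] h (EFin \o normal_pdf 0 s).
  apply: integral_ae_eq => //.
  move=> A _ mA; rewrite -Radon_Nikodym_SigmaFinite.f_integral//.
apply: filterS => x hx _; rewrite EFinM; congr (_ * _)%E; exact: hx.
Qed.

Lemma integral_normal_prob_opp (s : R) f : s != 0 -> measurable_fun [set: R] f ->
  (forall x, 0 <= f x) ->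
  (\int[normal_prob 0%R s]_x (f (- x))%:E = \int[normal_prob 0%R s]_x (f x)%:E)%E.
Proof.
move=> s0 mf f0; have mN : measurable_fun [set: R] (fun x : R => - x) by exact: measurable_funN.
rewrite !ge0_integral_normal_prob//; last exact: measurableT_comp.
have pE x : normal_pdf 0 s (- x) = normal_pdf 0 s x :> R.
  by rewrite !normal_pdfE// /normal_fun !subr0 sqrrN.
have -> : (\int[mu]_x (f x * normal_pdf 0 s x)%:E =
    \int[pushforward mu (-%R : _ -> measurableTypeR R)]_x (f x * normal_pdf 0 s x)%:E)%E.
  by apply: eq_measure_integral => A mA _; exact/esym/(lebesgue_measureN mA).
rewrite ge0_integral_pushforward//.
- by rewrite preimage_setT; apply: eq_integral => x _ /=; rewrite pE.
- by apply/measurable_EFinP/measurable_funM => //; exact: measurable_normal_pdf.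
- by move=> x _; rewrite lee_fin mulr_ge0 ?normal_pdf_ge0.
Qed.

(** The weight turns the density of variance [s ^+ 2] into [sqrt 2] times the density of variance
    [2 * s ^+ 2]. The coefficient 1/4 is half the critical value 1/2. *)
Lemma integral_normal_prob_expR_sqr (s : R) : 0 < s ->
  (\int[normal_prob 0%R s]_x (expR (x ^+ 2 / (4 * s ^+ 2)) : R)%:E = (Num.sqrt 2 : R)%:E)%E.
Proof.
move=> s0; rewrite ge0_integral_normal_prob//; last first.
  apply: measurableT_comp => //; exact: measurable_funM.
have s20 : 0 < Num.sqrt 2 * s by rewrite mulr_gt0// sqrtr_gt0.
transitivity (\int[mu]_x ((Num.sqrt 2)%:E * (normal_pdf 0 (Num.sqrt 2 * s) x)%:E))%E.
  apply: eq_integral => x _; rewrite -EFinM; congr (_%:E).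
  rewrite !normal_pdfE ?gt_eqF// /normal_peak /normal_fun !subr0.
  rewrite mulrCA -expRD exprMn sqr_sqrtr//.
  have -> : 2 * s ^+ 2 * pi *+ 2 = 2 * (s ^+ 2 * pi *+ 2) :> R by lra.
  rewrite sqrtrM// [(_ * Num.sqrt (_ *+ 2))^-1]invfM -[X in _ = _ * X]mulrA.
  rewrite mulVKf ?gt_eqF ?sqrtr_gt0//; congr (_ * expR _).
  rewrite -[s ^+ 2 *+ 2]mulr_natr -[2 * s ^+ 2 *+ 2]mulr_natr !invfM; lra.
rewrite ge0_integralZl//.
- by rewrite integral_normal_pdf mule1.
- by apply/measurable_EFinP; exact: measurable_normal_pdf.
- by move=> x _; rewrite lee_fin normal_pdf_ge0.
Qed.

End gaussian.

(** * Brownian increments and the completed filtration *)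

Section brownian.
Context {d : measure_display} {T : measurableType d} {R : realType}.
Variables (P : probability T R) (B : R -> T -> R).
Hypothesis P_complete : measure_is_complete P.
Hypothesis B_bm : is_brownian_motion P B.

(** Completeness of [P] is what makes the adjoined negligible sets measurable. *)
Lemma completed_gen_measurable (t : R) A : t <= 1 ->
  completed_gen P B t A -> measurable A.
Proof.
move=> t1 [[s /=]|/P_complete//]; rewrite in_itv/= => /andP[s0 st] [U mU <-].
have mB : measurable_fun [set: T] (B s).
  by apply: (bm_measurable B_bm); rewrite in_itv/= s0 (le_trans st).
exact: mB.
Qed.

Lemma completed_gen_mono (s t : R) : s <= t ->
  completed_gen P B s `<=` completed_gen P B t.
Proof.
move=> st A [[u /=]|nA]; last by right.
rewrite in_itv/= => /andP[u0 us] h; left; exists u => //=.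
by rewrite in_itv/= u0 (le_trans us).
Qed.

Lemma completed_sigma_mono (s t : R) : s <= t ->
  <<s completed_gen P B s >> `<=` <<s completed_gen P B t >>.
Proof. by move=> st; apply: sub_sigma_algebra2; exact: completed_gen_mono. Qed.

Lemma bm_adapted (t : R) : 0 <= t ->
  measurable_fun [set: g_sigma_algebraType (completed_gen P B t)] (B t).
Proof.
move=> t0 _ U mU; apply: sub_sigma_algebra; left; exists t => //=.
  by rewrite in_itv/= t0 lexx.
by exists U.
Qed.

(** Brownian independence is given for the natural filtration only. It extends to the completed one
    because sets equal to a natural set up to null sets form a sigma-algebra. *)
Lemma completed_sigma_ae (t : R) A : <<s completed_gen P B t >> A ->
  exists A', [/\ <<s natural_gen B t >> A', P.-negligible (A `\` A') &
                 P.-negligible (A' `\` A)].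
Proof.
pose S A := exists A', [/\ <<s natural_gen B t >> A', P.-negligible (A `\` A') &
                 P.-negligible (A' `\` A)].
have : <<s completed_gen P B t >> `<=` S.
  apply: smallest_sub; last first.
    move=> C [nC|nC].
      exists C; split; rewrite ?setDv; [exact: sub_sigma_algebra|exact: negligible_set0..].
    exists set0; split; [exact: sigma_algebra0 |by rewrite setD0|].
    by rewrite set0D; exact: negligible_set0.
  split.
  - by exists set0; split; rewrite ?setDv; [exact: sigma_algebra0|exact: negligible_set0..].
  - move=> C [C' [sC' n1 n2]]; exists (setT `\` C'); split.
    + exact: sigma_algebraCD.
    + by apply: negligibleS n2 => x /= [[_ nCx] h]; split=> //; apply: contrapT => nC'x; apply: h.
    + by apply: negligibleS n1 => x /= [[_ nCx] h]; split=> //; apply: contrapT => nC'x; apply: h.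
  - move=> F SF; have [F' hF'] := choice SF.
    exists (\bigcup_i F' i); split.
    + by apply: sigma_algebra_bigcup => i; have [] := hF' i.
    + apply: (@negligibleS _ _ _ _ (\bigcup_i (F i `\` F' i))).
        by move=> x [[i _ Fi] h]; exists i => //; split=> // F'i; apply: h; exists i.
      by apply: negligible_bigcup => i; have [] := hF' i.
    + apply: (@negligibleS _ _ _ _ (\bigcup_i (F' i `\` F i))).
        by move=> x [[i _ Fi] h]; exists i => //; split=> // F'i; apply: h; exists i.
      by apply: negligible_bigcup => i; have [] := hF' i.
exact.
Qed.

Section increment.
Variables s t : R.
Hypotheses (s0 : 0 <= s) (st : s < t) (t1 : t <= 1).
Let Z w := B t w - B s w.

Lemma bm_increment_measurable : measurable_fun [set: T] Z.
Proof.
apply: measurable_funB; apply: (bm_measurable B_bm); rewrite in_itv/=.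
  by rewrite t1 (le_trans s0) ?ltW.
by rewrite s0 (le_trans _ t1) ?ltW.
Qed.
Let mZ := bm_increment_measurable.

Lemma bm_increment_integral (f : R -> R) : measurable_fun [set: R] f ->
  (forall x, 0 <= f x) ->
  (\int[P]_w (f (Z w))%:E = \int[normal_prob 0%R (Num.sqrt (t - s))]_x (f x)%:E)%E.
Proof.
move=> mf f0.
transitivity (\int[pushforward P (Z : T -> measurableTypeR R)]_x (f x)%:E)%E.
  rewrite ge0_integral_pushforward//; first exact/measurable_EFinP.
  by move=> x _; rewrite lee_fin.
by apply: eq_measure_integral => U mU _; exact: (bm_increment B_bm).
Qed.

Lemma bm_increment_expR_sqr :
  (\int[P]_w (expR (Z w ^+ 2 / (4 * (t - s))))%:E = (Num.sqrt 2 : R)%:E)%E.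
Proof.
have ts : 0 < t - s by rewrite subr_gt0.
rewrite (@bm_increment_integral (fun x => expR (x ^+ 2 / (4 * (t - s)))))//.
  have := @integral_normal_prob_expR_sqr R (Num.sqrt (t - s)).
  by rewrite sqr_sqrtr ?(ltW ts)// sqrtr_gt0 => /(_ ts).
by apply: measurableT_comp => //; exact: measurable_funM.
Qed.

(** The exponential moment dominates the square through [1 + x <= expR x]. *)
Lemma bm_increment_sqint : sqint P Z.
Proof.
apply: sqintP => //; have ts : 0 < t - s by rewrite subr_gt0.
apply: (@le_lt_trans _ _ (\int[P]_w ((4 * (t - s))%:E *
    (expR (Z w ^+ 2 / (4 * (t - s))))%:E))%E).
  apply: ge0_le_integral => //.
  - by move=> w _; rewrite lee_fin sqr_ge0.
  - exact/measurable_EFinP/measurable_funX.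
  - apply: measurable_funeM; apply/measurable_EFinP/measurableT_comp => //.
    by apply: measurable_funM => //; exact: measurable_funX.
  - move=> w _; rewrite -EFinM lee_fin.
    rewrite mulrC -ler_pdivrMr ?mulr_gt0//.
    by rewrite (le_trans _ (expR_ge1Dx _))// lerDr.
rewrite ge0_integralZl//.
- by rewrite bm_increment_expR_sqr ltry.
- apply/measurable_EFinP/measurableT_comp => //.
  by apply: measurable_funM => //; exact: measurable_funX.
- by rewrite lee_fin mulr_ge0// ltW.
Qed.

Lemma bm_increment_indep A U : <<s completed_gen P B s >> A -> measurable U ->
  (P (A `&` Z @^-1` U) = P A * P (Z @^-1` U))%E.
Proof.
move=> cA mU; have s1 : s <= 1 by rewrite (le_trans _ t1) ?ltW.
have mA := sigma_sub (fun A => @completed_gen_measurable s A s1) cA.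
have [A' [nA' n1 n2]] := completed_sigma_ae cA.
have cA' : <<s completed_gen P B s >> A'.
  by move: A' nA' {n1 n2}; apply: sub_sigma_algebra2 => C hC; left.
have mA' := sigma_sub (fun A => @completed_gen_measurable s A s1) cA'.
have mZU : measurable (Z @^-1` U) by rewrite -[_ @^-1` _]setTI; exact: mZ.
have eqP C : measurable C -> P (A `&` C) = P (A' `&` C).
  move=> mC; have mD1 := measurableD mA mA'; have mD2 := measurableD mA' mA.
  have z1 : P (A `\` A') = 0%E by apply/negligibleP.
  have z2 : P (A' `\` A) = 0%E by apply/negligibleP.
  apply/eqP; rewrite eq_le; apply/andP; split.
    apply: (@le_trans _ _ (P ((A' `&` C) `|` (A `\` A')))%E).
      apply: le_measure; rewrite ?inE;
        [exact: measurableI|exact: measurableU (measurableI _ _ mA' mC) mD1|].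
      move=> x [Ax Cx]; have [A'x|nA'x] := pselect (A' x); [by left|by right].
    apply: le_trans (measureU2 _ _ _) _ => //; first exact: measurableI.
    by rewrite [X in (_ + X)%E]z1 adde0.
  apply: (@le_trans _ _ (P ((A `&` C) `|` (A' `\` A)))%E).
    apply: le_measure; rewrite ?inE;
        [exact: measurableI|exact: measurableU (measurableI _ _ mA mC) mD2|].
    move=> x [Ax Cx]; have [A'x|nA'x] := pselect (A x); [by left|by right].
  apply: le_trans (measureU2 _ _ _) _ => //; first exact: measurableI.
  by rewrite [X in (_ + X)%E]z2 adde0.
rewrite eqP// -[X in (P X * _)%E]setIT eqP// setIT.
exact: (bm_independent B_bm).
Qed.

(** Independence says that the indicator of [A] and the constant [P A] have the same integral over
    every event of the sigma-algebra of [Z]; hence also against the weight [f (Z w)]. *)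
Lemma bm_increment_integral_in A (f : R -> R) : <<s completed_gen P B s >> A ->
  measurable_fun [set: R] f -> (forall x, 0 <= f x) ->
  (\int[P]_(w in A) (f (Z w))%:E =
   P A * \int[normal_prob 0%R (Num.sqrt (t - s))]_x (f x)%:E)%E.
Proof.
move=> cA mf f0; have s1 : s <= 1 by rewrite (le_trans _ t1) ?ltW.
have mA := sigma_sub (fun A => @completed_gen_measurable s A s1) cA.
pose GZ := preimage_set_system [set: T] Z measurable.
have GZM C : GZ C -> measurable C by move=> [U mU <-]; exact: mZ.
have PAfin : P A \is a fin_num by exact: fin_num_measure.
have key : (\int[P]_w (f (Z w) * \1_A w)%:E = \int[P]_w (f (Z w) * fine (P A))%:E)%E.
  apply: (ge0_integral_subM GZM) => //.
  - by move=> w; rewrite fine_ge0.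
  - move=> C; rewrite sigma_algebra_id; last first.
      exact/sigma_algebra_preimage/sigma_algebra_measurable.
    move=> [U mU <-]; rewrite setTI.
    have mZU : measurable (Z @^-1` U) by rewrite -[_ @^-1` _]setTI; exact: mZ.
    rewrite integral_indic// integral_cst// fineK//; exact: bm_increment_indep.
  - apply: measurableT_comp => //.
    exact: preimage_set_system_measurable_fun.
rewrite integral_mkcond.
have -> : (\int[P]_w ((fun w => (f (Z w))%:E) \_ A) w = \int[P]_w (f (Z w) * \1_A w)%:E)%E.
  apply: eq_integral => w _; rewrite patchE indicE; case: (_ \in _).
    by rewrite mulr1.
  by rewrite mulr0.
rewrite key; under eq_integral do rewrite mulrC EFinM fineK//.
rewrite ge0_integralZl//.
- by rewrite bm_increment_integral.
- by apply/measurable_EFinP; exact: measurableT_comp.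
- by move=> w _; rewrite lee_fin.
Qed.

(** By independence the integrals of [Z^+] and [Z^-] over [A] are [P A] times Gaussian integrals,
    which agree by symmetry of the normal law. *)
Lemma bm_increment_cond_exp : is_cond_exp P (completed_gen P B s) Z (cst 0).
Proof.
split; first exact: measurable_cst.
  by apply: bounded_integrable => //; exists 0 => w; rewrite normr0.
move=> A cA; rewrite integral0_eq//.
have s1 : s <= 1 by rewrite (le_trans _ t1) ?ltW.
have mA := sigma_sub (fun A => @completed_gen_measurable s A s1) cA.
have ss : Num.sqrt (t - s) != 0 by rewrite gt_eqF// sqrtr_gt0 subr_gt0.
rewrite integralE.
have E1 : (\int[P]_(w in A) (fun w => (Z w)%:E)^\+ w =
    \int[P]_(w in A) (Num.max (Z w) 0)%:E)%E.
  by apply: eq_integral => w _; rewrite funeposE EFin_max.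
have E2 : (\int[P]_(w in A) (fun w => (Z w)%:E)^\- w =
    \int[P]_(w in A) (Num.max (- Z w) 0)%:E)%E.
  by apply: eq_integral => w _; rewrite funenegE EFin_max.
have iZ : P.-integrable [set: T] (EFin \o Z).
  have s1c : sqint P (cst 1).
    split=> //; apply: bounded_integrable; first exact: measurable_funX.
    by exists 1 => w /=; rewrite expr1n normr1.
  have := sqint_mul bm_increment_sqint s1c.
  by under eq_fun do rewrite /= mulr1.
have iA := integrable_neg_fin_num mA (integrableS measurableT mA (@subsetT _ _) iZ).
move: iA; rewrite E1 [X in X \is a fin_num]E2 [X in (_ - X)%E]E2.
rewrite (@bm_increment_integral_in A (fun x => Num.max x 0))//; first last.
- by move=> x; rewrite le_max lexx orbT.
- exact: measurable_maxr.
rewrite (@bm_increment_integral_in A (fun x => Num.max (- x) 0))//; first last.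
- by move=> x; rewrite le_max lexx orbT.
- by apply: measurable_maxr => //; exact: measurable_funN.
rewrite (@integral_normal_prob_opp R _ (fun x => Num.max x 0))//; first last.
- by move=> x; rewrite le_max lexx orbT.
- exact: measurable_maxr.
by move=> fin; rewrite subee.
Qed.

End increment.
End brownian.

(** * The [L sqrt(log L)] condition against Gaussian tails *)

Section LlogL.
Context {d : measure_display} {T : measurableType d} {R : realType}.
Variables (P : probability T R) (B : R -> T -> R).
Hypothesis B_bm : is_brownian_motion P B.
Implicit Types Y : T -> R.

(** Either [g] is at most [3 * sqrt (ln (1 + y))] and the first term suffices, or
    [y <= expR (g ^+ 2 / 9)], while always [g <= 8 * expR (g ^+ 2 / 8)]. The constants work because
    1/9 + 1/8 is below 1/4, the exponent whose Gaussian moment is known. *)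
Lemma young_LlogL (y g : R) : 0 <= y -> 0 <= g ->
  y * g <= 3 * (y * Num.sqrt (ln (1 + y))) + 8 * expR (g ^+ 2 / 4).
Proof.
move=> y0 g0; have y1 : 0 < 1 + y by rewrite ltr_wpDr.
have ln0 : 0 <= ln (1 + y) by rewrite ln_ge0// lerDl.
have e0 : 0 <= expR (g ^+ 2 / 4) by exact: expR_ge0.
have [h|h] := leP g (3 * Num.sqrt (ln (1 + y))).
  by have := ler_wpM2l y0 h; lra.
have s0 : 0 <= 3 * Num.sqrt (ln (1 + y)) by rewrite mulr_ge0// sqrtr_ge0.
have g2 : 9 * ln (1 + y) < g ^+ 2.
  have : (3 * Num.sqrt (ln (1 + y))) ^+ 2 < g ^+ 2.
    by rewrite ltr_pXn2r ?nnegrE.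
  by rewrite exprMn sqr_sqrtr//; lra.
have yle : y <= expR (g ^+ 2 / 9).
  rewrite (@le_trans _ _ (1 + y)) ?lerDr// -[leLHS]lnK ?posrE// ler_expR; lra.
have gle : g <= 8 * expR (g ^+ 2 / 8).
  apply: (@le_trans _ _ (8 * (1 + g ^+ 2 / 8))).
    have := sqr_ge0 (g - 1); have := sqr_ge0 g; lra.
  by rewrite ler_pM2l// expR_ge1Dx.
have ys0 : 0 <= 3 * (y * Num.sqrt (ln (1 + y))).
  by rewrite !mulr_ge0// sqrtr_ge0.
apply: (@le_trans _ _ (8 * expR (g ^+ 2 / 4))); last by lra.
apply: (@le_trans _ _ (expR (g ^+ 2 / 9) * (8 * expR (g ^+ 2 / 8)))).
  by apply: ler_pM.
rewrite mulrCA ler_pM2l// -expRD ler_expR; have := sqr_ge0 g; lra.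
Qed.

Definition LlogL Y := (\int[P]_w (`|Y w| * Num.sqrt (ln (1 + `|Y w|)))%:E)%E.

Lemma measurable_LlogL Y : measurable_fun [set: T] Y ->
  measurable_fun [set: T] (fun w => `|Y w| * Num.sqrt (ln (1 + `|Y w|))).
Proof.
move=> mY; have mnY : measurable_fun [set: T] (fun w => `|Y w|).
  exact: measurableT_comp.
apply: measurable_funM => //.
apply: (@measurableT_comp _ _ _ _ _ _ (@Num.sqrt R)) => //.
  apply: continuous_measurable_fun; exact: sqrt_continuous.
apply: (@measurableT_comp _ _ _ _ _ _ (@ln R)); first exact: measurable_ln.
exact: measurable_funD.
Qed.

Lemma LlogL_bounded Y : measurable_fun [set: T] Y ->
  (exists M, forall w, `|Y w| <= M) -> (LlogL Y < +oo)%E.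
Proof.
move=> mY [M YM].
have iL : P.-integrable [set: T]
    (EFin \o (fun w => `|Y w| * Num.sqrt (ln (1 + `|Y w|)))).
  apply: bounded_integrable; first exact: measurable_LlogL.
  exists (M * Num.sqrt (ln (1 + M))) => w.
  rewrite ger0_norm ?mulr_ge0 ?sqrtr_ge0//.
  apply: ler_pM; rewrite ?sqrtr_ge0//.
  rewrite ler_sqrt ?ln_ge0 ?lerDl ?(le_trans _ (YM w))//.
  by rewrite ler_ln ?posrE ?ltr_wpDr ?lerD2l ?(le_trans _ (YM w)).
by have := integrable_lty measurableT iL.
Qed.

(** Young's inequality is applied to the increment divided by its standard deviation, so that the
    bound carries the factor [Num.sqrt (t - s)] and vanishes as [s] tends to [t]. *)
Lemma LlogL_mul_increment Y (s t : R) : measurable_fun [set: T] Y ->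
  0 <= s -> s < t -> t <= 1 ->
  (\int[P]_w `|(Y w * (B t w - B s w))%:E| <=
   (Num.sqrt (t - s))%:E * (3%:E * LlogL Y + (8 * Num.sqrt 2)%:E))%E.
Proof.
move=> mY s0 st t1; have ts : 0 < t - s by rewrite subr_gt0.
set r := Num.sqrt (t - s); have r0 : 0 < r by rewrite sqrtr_gt0.
have r2 : r ^+ 2 = t - s by rewrite sqr_sqrtr// ltW.
have mZ := bm_increment_measurable B_bm s0 st t1.
have mL := measurable_LlogL mY.
have L0 w : 0 <= `|Y w| * Num.sqrt (ln (1 + `|Y w|)) by rewrite mulr_ge0 ?sqrtr_ge0.
pose e w := expR ((B t w - B s w) ^+ 2 / (4 * (t - s))).
have me : measurable_fun [set: T] e.
  apply: measurableT_comp => //.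
  by apply: measurable_funM => //; exact: measurable_funX.
apply: (@le_trans _ _ (\int[P]_w (r%:E * (3%:E *
    (`|Y w| * Num.sqrt (ln (1 + `|Y w|)))%:E + 8%:E * (e w)%:E)))%E).
  apply: ge0_le_integral => //.
  - by apply/measurableT_comp => //; apply/measurable_EFinP/measurable_funM.
  - by apply: measurable_funeM; apply: emeasurable_funD;
      apply: measurable_funeM; exact/measurable_EFinP.
  - move=> w _; rewrite -!EFinM lee_fin normrM.
    have zr0 : 0 <= `|B t w - B s w| / r by rewrite divr_ge0// ltW.
    have := young_LlogL (normr_ge0 (Y w)) zr0.
    rewrite expr_div_n real_normK ?num_real// r2 -[_ / (t - s) / 4]mulrA -invfM.
    rewrite [(t - s) * 4]mulrC -/(e w) -(ler_pM2l r0) => h.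
    by rewrite (le_trans _ h)// mulrCA [r * _]mulrC divfK ?gt_eqF.
rewrite ge0_integralZl//.
- rewrite ge0_integralD//.
  + rewrite !ge0_integralZl//; last 3 first.
    * exact/measurable_EFinP.
    * by move=> w _; rewrite lee_fin expR_ge0.
    * exact/measurable_EFinP.
    by rewrite bm_increment_expR_sqr// -EFinM.
  + by apply: measurable_funeM; exact/measurable_EFinP.
  + by move=> w _; rewrite mule_ge0 ?lee_fin ?expR_ge0.
  + by apply: measurable_funeM; exact/measurable_EFinP.
- by apply: emeasurable_funD; apply: measurable_funeM; exact/measurable_EFinP.
- by move=> w _; rewrite adde_ge0 ?mule_ge0 ?lee_fin ?expR_ge0.
- by rewrite lee_fin ltW.
Qed.

Lemma ae_eq_integrable (f g : T -> R) : measurable_fun [set: T] f ->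
  P.-integrable [set: T] (EFin \o g) -> (\forall w \ae P, f w = g w) ->
  P.-integrable [set: T] (EFin \o f).
Proof.
move=> mf ig fg; apply/integrableP; split; first exact/measurable_EFinP.
have mg := measurable_int _ ig; have [_] := integrableP _ _ _ ig.
rewrite (@ge0_ae_eq_integral _ _ _ P _ _ (fun w => `|(EFin \o f) w|%E))//.
- exact: measurableT_comp.
- by apply: measurableT_comp => //; exact/measurable_EFinP.
- by apply: filterS fg => w fgw _; rewrite /= fgw.
Qed.

Lemma bm_measurableT (t : R) : 0 <= t <= 1 -> measurable_fun [set: T] (B t).
Proof. by move=> t01; apply: (bm_measurable B_bm); rewrite in_itv. Qed.

Lemma bm_ae_increment (t : R) : \forall w \ae P, B t w = B t w - B 0 w.
Proof. by apply: filterS (bm_start B_bm) => w ->; rewrite subr0. Qed.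

Lemma bm_sqint (t : R) : 0 < t <= 1 -> sqint P (B t).
Proof.
move=> /andP[t0 t1]; have mB : measurable_fun [set: T] (B t).
  by apply: bm_measurableT; rewrite t1 ltW.
have [_ iZ] := bm_increment_sqint B_bm (lexx 0) t0 t1; split=> //.
apply: ae_eq_integrable iZ _; first exact: measurable_funX.
by apply: filterS (bm_ae_increment t) => w <-.
Qed.

Section dual.
Variable Y : T -> R.
Hypotheses (mY : measurable_fun [set: T] Y) (LY : (LlogL Y < +oo)%E).

Lemma LlogL_increment_integrable (s t : R) : 0 <= s -> s < t -> t <= 1 ->
  P.-integrable [set: T] (EFin \o (fun w => Y w * (B t w - B s w))).
Proof.
move=> s0 st t1; apply/integrableP; split.
  apply/measurable_EFinP/measurable_funM => //.
  exact: (bm_increment_measurable B_bm s0 st t1).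
apply: le_lt_trans (LlogL_mul_increment mY s0 st t1) _.
rewrite lte_mul_pinfty ?lee_fin ?sqrtr_ge0//.
by rewrite lte_add_pinfty ?ltry// lte_mul_pinfty ?lee_fin.
Qed.

Lemma LlogL_bm_integrable (t : R) : 0 < t <= 1 ->
  P.-integrable [set: T] (EFin \o (fun w => Y w * B t w)).
Proof.
move=> /andP[t0 t1]; have mB : measurable_fun [set: T] (B t).
  by apply: bm_measurableT; rewrite t1 ltW.
apply: ae_eq_integrable (LlogL_increment_integrable (lexx 0) t0 t1) _.
  exact: measurable_funM.
by apply: filterS (bm_ae_increment t) => w {1}->.
Qed.

Lemma LlogL_bm_cvg (e : R) : 0 < e -> exists t0 : R, [/\ 0 < t0, t0 < 1 &
  forall t, t0 < t -> t < 1 ->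
  \int[P]_w (Y w * B 1 w) <= \int[P]_w (Y w * B t w) + e].
Proof.
move=> e0; have L0 : (0 <= LlogL Y)%E.
  by apply: integral_ge0 => w _; rewrite lee_fin mulr_ge0 ?sqrtr_ge0.
have Lfin : LlogL Y \is a fin_num by rewrite ge0_fin_numE.
set K := 3 * fine (LlogL Y) + 8 * Num.sqrt 2 + 1.
have K0 : 0 < K by rewrite ltr_wpDl// addr_ge0 ?mulr_ge0 ?sqrtr_ge0 ?fine_ge0.
(* For [1 - t < x] the product [K * Num.sqrt (1 - t)] is at most [e]; the bound 1/2 keeps [1 - x]
   positive. *)
set x := Num.min ((e / K) ^+ 2) (1 / 2).
have x0 : 0 < x by rewrite lt_min exprn_gt0 ?divr_gt0.
have x1 : x <= 1 / 2 by rewrite ge_min lexx orbT.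
exists (1 - x); split; [lra..|] => t tx t1.
have t0 : 0 < t by lra.
have iB1 := @LlogL_bm_integrable 1 _; have iBt := @LlogL_bm_integrable t _.
have {}iB1 := iB1 (introT andP (conj ltr01 (lexx 1))).
have {}iBt := iBt (introT andP (conj t0 (ltW t1))).
rewrite -lerBlDl -RintegralB//.
have iZ := LlogL_increment_integrable (ltW t0) t1 (lexx 1).
under eq_Rintegral do rewrite -mulrBr.
apply: le_trans (ler_norm _) _; apply: le_trans (le_normr_Rintegral measurableT iZ) _.
rewrite -lee_fin /Rintegral fineK; last exact: integrable_fin_num (integrable_norm iZ).
apply: le_trans (LlogL_mul_increment mY (ltW t0) t1 (lexx 1)) _.
rewrite -(fineK Lfin) -!EFinM lee_fin.
have : Num.sqrt (1 - t) <= e / K.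
  have eK : 0 <= e / K by rewrite divr_ge0 ?(ltW e0) ?(ltW K0).
  rewrite -[leRHS](ger0_norm eK) -sqrtr_sqr ler_sqrt ?sqr_ge0//.
  have : x <= (e / K) ^+ 2 by rewrite ge_min lexx.
  lra.
move=> h; apply: (@le_trans _ _ (e / K * K)); last by rewrite divfK ?gt_eqF.
apply: ler_pM; rewrite ?sqrtr_ge0 ?addr_ge0 ?mulr_ge0 ?sqrtr_ge0 ?fine_ge0//.
by rewrite lerDl.
Qed.

End dual.
End LlogL.

(** * Controls as square integrable functions of time and chance *)

Section processes.
Context {d : measure_display} {T : measurableType d} {R : realType}.
Variables (P : probability T R) (B : R -> T -> R).
Hypothesis P_complete : measure_is_complete P.
Hypothesis B_bm : is_brownian_motion P B.
Local Notation mu := (@lebesgue_measure R).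
Local Notation pi := (mu \x P)%E.
Local Notation RT := (measurableTypeR R * T)%type.
Local Notation c0 := (@c0 R).
Implicit Types (a b : R -> T -> R) (Z : T -> R).

(* Processes only matter at times in [0, 1]; they are extended by 0. *)
Definition pth a (x : RT) : R := if 0 <= x.1 <= 1 then a x.1 x.2 else 0.

Definition lift Z (x : RT) : R := if 0 <= x.1 <= 1 then Z x.2 else 0.

Definition energy a := ip pi (pth a) (pth a).
Definition pairing a Z := ip pi (pth a) (lift Z).

Lemma pthE a r w : 0 <= r <= 1 -> pth a (r, w) = a r w.
Proof. by rewrite /pth /= => ->. Qed.

Lemma ae_lebesgue_imp (p q : R -> Prop) : (forall t, p t -> q t) ->
  {ae mu, forall t, p t} -> {ae mu, forall t, q t}.
Proof. by move=> pq; apply: negligibleS => t /= nq pt; apply: nq; exact: pq. Qed.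

Lemma ae_lebesgue_and (p q : R -> Prop) : {ae mu, forall t, p t} ->
  {ae mu, forall t, q t} -> {ae mu, forall t, p t /\ q t}.
Proof. exact: (@filterI _ _ (ae_filter_ringOfSetsType mu) p q). Qed.

Lemma c0_ge0 : 0 <= c0. Proof. exact: sqrtr_ge0. Qed.

Lemma measurable_unit_strip : measurable (`[0, 1]%classic `*` [set: T] : set RT).
Proof. exact: measurableX. Qed.

Lemma progressively_measurable_pth a : progressively_measurable P B a ->
  measurable_fun [set: RT] (pth a).
Proof.
move=> /(_ 1); rewrite in_itv/= ler01 lexx => /(_ isT) ma.
have mD : measurable (`[0, 1]%classic `*` [set: T] :
    set (measurableTypeR R * g_sigma_algebraType (completed_gen P B 1))).
  exact: measurableX.
have /(measurable_restrictT _ mD) := ma.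
set f := (_ \_ _) => mf.
have mid : measurable_fun [set: RT] (fun x : RT =>
    (x.1, x.2) : measurableTypeR R * g_sigma_algebraType (completed_gen P B 1)).
  apply: measurable_fun_pair => //.
  move=> _ A mA; rewrite setTI.
  have mA' : measurable (A : set T).
    by apply: sigma_sub mA => C; exact: completed_gen_measurable.
  rewrite -[X in measurable X]setTI; exact: (@measurable_snd _ _ _ T).
have -> : pth a = f \o (fun x : RT => (x.1, x.2)).
  apply/funext => -[r w]; rewrite /f /pth /= patchE.
  rewrite [in RHS](_ : _ \in _ = (0 <= r <= 1)) //.
  by apply/idP/idP => [/set_mem [/= + _]|h]; rewrite ?in_itv//= inE /= in_itv.
exact: measurableT_comp mf mid.
Qed.

Lemma progressively_measurable_section a (t : R) : 0 <= t <= 1 ->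
  progressively_measurable P B a ->
  measurable_fun [set: g_sigma_algebraType (completed_gen P B t)] (a t).
Proof.
move=> t01 /(_ t); rewrite in_itv/= => /(_ t01) ma.
have mpair : measurable_fun [set: g_sigma_algebraType (completed_gen P B t)]
  (fun w => (t, w) : measurableTypeR R * g_sigma_algebraType (completed_gen P B t)).
  exact: measurable_fun_pair.
have mD : measurable (`[0, t]%classic `*` [set: T] :
    set (measurableTypeR R * g_sigma_algebraType (completed_gen P B t))).
  exact: measurableX.
apply: (measurable_comp mD _ ma mpair) => _ [w _ <-]; split=> //=.
by rewrite in_itv/= lexx andbT; case/andP: t01.
Qed.

Lemma admissible_section a (t : R) : 0 <= t <= 1 -> admissible P B a ->
  measurable_fun [set: T] (a t).
Proof.
move=> t01 [pa _]; apply: measurable_fun_sub (progressively_measurable_section t01 pa).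
by move=> C; apply: completed_gen_measurable => //; case/andP: t01.
Qed.

Lemma admissible_ae a : admissible P B a ->
  {ae mu, forall t, 0 <= t <= 1 -> (\int[P]_w (a t w ^+ 2)%:E <= (c0 ^+ 2)%:E)%E}.
Proof.
move=> [_]; apply: ae_lebesgue_imp => t h t01.
by have := h; rewrite in_itv/= => /(_ t01); rewrite Lnorm2_le// c0_ge0.
Qed.

Lemma integral_unit_itv (f : R -> \bar R) :
  (\int[mu]_(t in `[0%R, 1%R]) f t =
   \int[mu]_t (if (0 <= t <= 1)%R then f t else 0))%E.
Proof.
rewrite integral_mkcond; apply: eq_integral => t _.
rewrite patchE; congr (if _ then _ else _).
by apply/idP/idP => [/set_mem|h]; rewrite ?inE /= in_itv.
Qed.

Lemma admissible_energy a : admissible P B a ->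
  (\int[pi]_x (pth a x ^+ 2)%:E <= (c0 ^+ 2)%:E)%E.
Proof.
move=> aA; have [pa _] := aA; have mp := progressively_measurable_pth pa.
have mp2 : measurable_fun [set: RT] (fun x => (pth a x ^+ 2)%:E).
  by apply/measurable_EFinP; exact: measurable_funX.
rewrite (fubini_tonelli1 (m1 := mu) (m2 := P) _ mp2); last first.
  by move=> x; rewrite lee_fin sqr_ge0.
apply: (@le_trans _ _ (\int[mu]_(t in `[0%R, 1%R]) (c0 ^+ 2)%:E)%E); last first.
  by rewrite integral_cst//= lebesgue_measure_itv/= lte01 oppr0 adde0 mule1.
rewrite (_ : (\int[mu]_t _ = \int[mu]_(t in `[0%R, 1%R])
    fubini_F P (fun x => (pth a x ^+ 2)%:E) t)%E); last first.
  rewrite integral_unit_itv; apply: eq_integral => t _; rewrite /fubini_F.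
  case: ifPn => // t01; rewrite integral0_eq// => w _.
  by rewrite /pth /= (negbTE t01) expr0n.
have mF : measurable_fun [set: R] (fubini_F P (fun x : RT => (pth a x ^+ 2)%:E)).
  by apply: measurable_fun_fubini_tonelli_F => // x; rewrite lee_fin sqr_ge0.
apply: ae_ge0_le_integral => //.
- by move=> t _; apply: integral_ge0 => w _; rewrite lee_fin sqr_ge0.
- exact: measurable_funTS.
- by move=> t _; rewrite lee_fin sqr_ge0.
- apply: ae_lebesgue_imp (admissible_ae aA) => t h; rewrite /= in_itv/= => t01.
  apply: le_trans (h t01); rewrite le_eqVlt; apply/orP; left; apply/eqP.
  by apply: eq_integral => w _; rewrite pthE.
Qed.

Lemma admissible_sqint a : admissible P B a -> sqint pi (pth a).
Proof.
move=> aA; have [pa _] := aA; apply: sqintP.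
  exact: progressively_measurable_pth.
by apply: le_lt_trans (admissible_energy aA) _; rewrite ltry.
Qed.

Lemma energy_le a : admissible P B a -> energy a <= c0 ^+ 2.
Proof.
move=> aA; rewrite -lee_fin EFin_ip; last exact: admissible_sqint.
exact: admissible_energy.
Qed.

Lemma measurable_lift Z : measurable_fun [set: T] Z -> measurable_fun [set: RT] (lift Z).
Proof.
move=> mZ; have -> : lift Z = ((fun x : RT => Z x.2) \_ (`[0, 1]%classic `*` setT)).
  apply/funext => -[r w]; rewrite /lift /= patchE.
  rewrite [in RHS](_ : _ \in _ = (0 <= r <= 1)) //.
  by apply/idP/idP => [/set_mem [/= + _]|h]; rewrite ?in_itv//= inE /= in_itv.
have mZ2 : measurable_fun [set: RT] (fun x => Z x.2).
  exact: measurableT_comp mZ (@measurable_snd _ _ (measurableTypeR R) T).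
exact: (measurable_restrictT _ measurable_unit_strip).1 (measurable_funTS mZ2).
Qed.

Lemma ge0_integral_lift (f : R -> T -> R) :
  measurable_fun [set: RT] (pth f) -> (forall t w, 0 <= f t w) ->
  (\int[pi]_x (pth f x)%:E =
   \int[mu]_(t in `[0%R, 1%R]) \int[P]_w (f t w)%:E)%E.
Proof.
move=> mf f0; rewrite (fubini_tonelli1 (m1 := mu) (m2 := P)).
- rewrite integral_unit_itv; apply: eq_integral => t _; rewrite /fubini_F.
  case: ifPn => t01; first by apply: eq_integral => w _; rewrite pthE.
  by rewrite integral0_eq// => w _; rewrite /pth /= (negbTE t01).
- exact/measurable_EFinP.
- by move=> x; rewrite lee_fin /pth; case: ifP.
Qed.

Lemma lift_sqint Z : sqint P Z -> sqint pi (lift Z).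
Proof.
move=> [mZ iZ]; apply: sqintP; first exact: measurable_lift.
have -> : (\int[pi]_x (lift Z x ^+ 2)%:E = \int[pi]_x (pth (fun _ w => Z w ^+ 2) x)%:E)%E.
  by apply: eq_integral => x _; rewrite /lift /pth; case: ifP => //; rewrite expr0n.
rewrite ge0_integral_lift; last by move=> t w; exact: sqr_ge0.
  have := integrable_lty measurableT iZ; rewrite integral_cst//=.
  by rewrite lebesgue_measure_itv/= lte01 oppr0 adde0 mule1.
have -> : pth (fun _ w => Z w ^+ 2) = (fun x => lift Z x ^+ 2).
  by apply/funext => x; rewrite /lift /pth; case: ifP => //; rewrite expr0n.
by apply: measurable_funX; exact: measurable_lift.
Qed.

Lemma ip_lift Z : sqint P Z -> ip pi (lift Z) (lift Z) = ip P Z Z.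
Proof.
move=> sZ; have [mZ iZ] := sZ; have sl := lift_sqint sZ.
apply: EFin_inj; rewrite !EFin_ip//.
have -> : (\int[pi]_x (lift Z x ^+ 2)%:E = \int[pi]_x (pth (fun _ w => Z w ^+ 2) x)%:E)%E.
  by apply: eq_integral => x _; rewrite /lift /pth; case: ifP => //; rewrite expr0n.
rewrite ge0_integral_lift; last by move=> t w; exact: sqr_ge0.
  by rewrite integral_cst//= lebesgue_measure_itv/= lte01 oppr0 adde0 mule1.
have -> : pth (fun _ w => Z w ^+ 2) = (fun x => lift Z x ^+ 2).
  by apply/funext => x; rewrite /lift /pth; case: ifP => //; rewrite expr0n.
by case: sl => ml _; exact: measurable_funX.
Qed.

Lemma sqint_cst (c : R) : sqint P (cst c).
Proof.
split=> //; apply: bounded_integrable; first exact: measurable_funX.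
by exists `|c ^+ 2| => w.
Qed.

(** Fubini links the pathwise drift in [state] to the inner product on the product space. Square
    integrability of [Z] makes the product of [pth a] and [lift Z] integrable. *)
Lemma state_integral a Z : admissible P B a -> sqint P Z ->
  [/\ measurable_fun [set: T] (fun w => \int[mu]_(s in `[0, 1]) a s w),
    P.-integrable [set: T] (EFin \o (fun w => Z w * \int[mu]_(s in `[0, 1]) a s w)) &
    \int[P]_w (Z w * \int[mu]_(s in `[0, 1]) a s w) = pairing a Z].
Proof.
move=> aA sZ; have spa := admissible_sqint aA; have slZ := lift_sqint sZ.
have [mZ _] := sZ.
pose f (x : RT) := (pth a x * lift Z x)%:E.
have if_ : pi.-integrable [set: RT] f by exact: sqint_mul.
have ip : pi.-integrable [set: RT] (EFin \o pth a).
  have := sqint_mul spa (lift_sqint (sqint_cst 1)).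
  apply: eq_integrable => // x _ /=; congr (_%:E).
  by rewrite /pth /lift; case: ifP; rewrite ?mulr1 ?mulr0.
pose I w := \int[mu]_(s in `[0, 1]) a s w.
have IE w : I w = fine (\int[mu]_x (pth a (x, w))%:E)%E.
  rewrite /I /Rintegral integral_unit_itv; congr fine.
  by apply: eq_integral => t _; rewrite /pth /=; case: ifP.
have mI : measurable_fun [set: T] I.
  have -> : I = fine \o fubini_G mu (EFin \o pth a) by apply/funext => w; rewrite IE.
  apply: measurableT_comp => //.
  exact: (measurable_fubini_G ip).
(* Only almost every path is known to be integrable; elsewhere [I] may be the default value of
   [fine]. *)
have GE : {ae P, forall w, (Z w * I w)%:E = fubini_G mu f w}.
  apply: filterS (ae_integrable2 ip) => w iw.
  rewrite /fubini_G EFinM IE fineK; last exact: integrable_fin_num iw.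
  rewrite -integralZl//; apply: eq_integral => t _.
  by rewrite /f -EFinM /pth /lift /=; case: ifP => _; rewrite ?mulr0// mulrC.
have mG : measurable_fun [set: T] (fubini_G mu f).
  exact: (measurable_fubini_G if_).
have iG : P.-integrable [set: T] (fubini_G mu f).
  apply/integrableP; split=> //.
  have mf := measurable_int _ if_.
  have h := (integrable21ltyP mu P mf).1 if_; apply: le_lt_trans h.
  apply: ge0_le_integral => //.
  - exact: measurableT_comp.
  - apply: (measurable_fun_fubini_tonelli_G (m1 := mu) (fun x => `|f x|%E)) => //.
    exact: measurableT_comp.
  - move=> w _; apply: le_abse_integral => //.
    exact: (measurable_fun_pair1 w mf).
have mZI : measurable_fun [set: T] (EFin \o (fun w => Z w * I w)).
  by apply/measurable_EFinP; exact: measurable_funM.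
have iZI : P.-integrable [set: T] (EFin \o (fun w => Z w * I w)).
  apply/integrableP; split=> //; have [_] := integrableP _ _ _ iG.
  rewrite (@ge0_ae_eq_integral _ _ _ P _ _ (fun w => `|(Z w * I w)%:E|%E))//.
  - exact: measurableT_comp.
  - exact: measurableT_comp.
  - by apply: filterS GE => w h _ /=; rewrite -h.
split=> //.
rewrite /Rintegral (ae_eq_integral (fubini_G mu f))//; last first.
  by apply: filterS GE => w h _.
by rewrite (integral21_prod_meas1 if_).
Qed.

(** Splits the Lagrangian into time slices. The formula for [K] holds at every time, so slicewise
    estimates in either direction can be integrated. *)
Lemma lagrangian_sections a Z (c : R) : admissible P B a -> sqint P Z ->
  exists K : R -> \bar R, [/\ mu.-integrable [set: R] K,
    (\int[mu]_t K t = (pairing a Z + c * energy a)%:E)%E &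
    forall t, K t = if 0 <= t <= 1 then
      (\int[P]_w (a t w * Z w + c * a t w ^+ 2)%:E)%E else 0%E].
Proof.
move=> aA sZ; have spa := admissible_sqint aA; have slZ := lift_sqint sZ.
have [mp ip2] := spa.
pose f (x : RT) := (pth a x * lift Z x + c * pth a x ^+ 2)%:E.
have i1 := sqint_mul spa slZ; have i2 := integrableZl measurableT c ip2.
have if_ : pi.-integrable [set: RT] f.
  by have := integrableD measurableT i1 i2; apply: eq_integrable.
exists (fubini_F P f); split.
- exact: (integrable_fubini_F if_).
- rewrite (integral12_prod_meas1 if_).
  have fin := integrable_fin_num measurableT if_.
  rewrite -(fineK fin) -/(Rintegral pi setT (fun x => pth a x * lift Z x + c * pth a x ^+ 2)).
  rewrite RintegralD// RintegralZl//; congr ((_ + _ * _)%:E).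
- move=> t; rewrite /fubini_F; case: ifPn => t01.
    by apply: eq_integral => w _; rewrite /f /pth /lift /= t01.
  by rewrite integral0_eq// => w _; rewrite /f /pth /lift /= (negbTE t01) mul0r expr0n mulr0 addr0.
Qed.

End processes.

(** * Almost everywhere convergence and Fatou bounds *)

Section almost_sure_limits.
Context {d : measure_display} {T : measurableType d} {R : realType}.
Variable m : {measure set T -> \bar R}.

Lemma fatou_le (f : nat -> T -> R) (g : T -> R) (c : \bar R) :
  (forall n, measurable_fun [set: T] (f n)) -> measurable_fun [set: T] g ->
  (forall n x, 0 <= f n x) -> (forall x, 0 <= g x) ->
  {ae m, forall x, f n x @[n --> \oo] --> g x} ->
  (forall n, \int[m]_x (f n x)%:E <= c)%E -> (\int[m]_x (g x)%:E <= c)%E.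
Proof.
move=> mf mg f0 g0 fg fc.
have mfE n : measurable_fun [set: T] (fun x => (f n x)%:E) by exact/measurable_EFinP.
apply: (@le_trans _ _ (\int[m]_x limn_einf (fun n => (f n x)%:E))%E).
  apply: ae_ge0_le_integral => //.
  - by move=> x _; rewrite lee_fin.
  - exact/measurable_EFinP.
  - move=> x _; rewrite limn_einf_lim; apply: lime_ge; first exact: is_cvg_einfs.
    by apply: nearW => n; apply: le_ereal_inf_tmp => _ [k _ <-]; rewrite lee_fin.
  - under eq_fun do rewrite -[limn_einf _]oppeK -limn_esupN.
    by apply: measurableT_comp => //; apply: measurable_fun_limn_esup => n; exact: measurableT_comp.
  - apply: filterS fg => x fgx _.
    have h : (fun n => (f n x)%:E) @ \oo --> (g x)%:E by apply/fine_cvgP; split => //; exact: nearW.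
    rewrite is_cvg_limn_einfE; last by apply/cvg_ex; exists (g x)%:E.
    by rewrite (cvg_lim _ h).
apply: le_trans; first by apply: fatou => // n x _; rewrite lee_fin.
rewrite limn_einf_lim; apply: lime_le; first exact: is_cvg_einfs.
apply: nearW => n; apply: le_trans (fc n).
by apply: ereal_inf_lbound; exists n => //=.
Qed.

Lemma cvg_sqr (x : nat -> R) (l : R) : x @ \oo --> l ->
  x n ^+ 2 @[n --> \oo] --> l ^+ 2.
Proof. by move=> xl; under eq_fun do rewrite expr2; rewrite expr2; exact: cvgM. Qed.

(** The increments are at most [sqrt C / 2 ^ n], so the telescoping series converges absolutely. *)
Lemma cvg_of_weighted_sqr (x : nat -> R) (C : R) :
  (forall n, 4 ^+ n * (x n.+1 - x n) ^+ 2 <= C) -> cvgn x.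
Proof.
move=> xC; have C0 : 0 <= C.
  by apply: le_trans (xC 0%N); rewrite mulr_ge0 ?sqr_ge0// exprn_ge0.
have le n : `|x n.+1 - x n| <= Num.sqrt C * 2^-1 ^+ n.
  have p2 : 0 < (2 : R) ^+ n by rewrite exprn_gt0.
  rewrite exprVn ler_pdivlMr// -[leLHS]ger0_norm; last by rewrite mulr_ge0// ltW.
  rewrite -sqrtr_sqr ler_sqrt// exprMn real_normK ?num_real//.
  rewrite mulrC -exprM mulnC exprM (_ : 2 ^+ 2 = 4) ?xC//; lra.
have h : cvgn (series (telescope x)).
  apply: normed_cvg; apply: (@series_le_cvg _ _ (geometric (Num.sqrt C) 2^-1)).
  - by move=> n; exact: normr_ge0.
  - by move=> n; rewrite /geometric /= mulr_ge0 ?sqrtr_ge0// exprn_ge0// invr_ge0.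
  - by move=> n; exact: le.
  - apply: is_cvg_geometric_series; rewrite ger0_norm ?invr_ge0//.
    by rewrite invf_lt1// ltr1n.
have -> : x = (fun n => x 0%N + series (telescope x) n).
  by apply/funext => n; rewrite -eq_sum_telescope.
by apply: is_cvgD => //; exact: is_cvg_cst.
Qed.

(* With [|f (n+1) - f n|^2] integrating to at most [8^-n / 2], the function
   [sum_n 4^n |f (n+1) - f n|^2] is integrable, hence almost everywhere finite. *)
Lemma ae_cvg_of_fast_cauchy (f : nat -> T -> R) :
  (forall n, measurable_fun [set: T] (f n)) ->
  (forall n, \int[m]_x ((f n.+1 x - f n x) ^+ 2)%:E <= ((8 ^+ n * 2)^-1)%:E)%E ->
  exists G : T -> \bar R, [/\ measurable_fun [set: T] G, m.-integrable [set: T] G &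
    forall x, G x \is a fin_num -> cvgn (fun n => f n x)].
Proof.
move=> mf hf.
pose g n x : \bar R := (4 ^+ n * (f n.+1 x - f n x) ^+ 2)%:E.
have g0 n x : (0 <= g n x)%E by rewrite lee_fin mulr_ge0 ?sqr_ge0// exprn_ge0.
have mg n : measurable_fun [set: T] (g n).
  by apply/measurable_EFinP/measurable_funM => //; apply: measurable_funX; exact: measurable_funB.
pose G x := (\sum_(n <oo) g n x)%E.
have G0 x : (0 <= G x)%E by apply: nneseries_ge0 => n _ _; exact: g0.
have mG : measurable_fun [set: T] G by apply: ge0_emeasurable_sum => // n x _ _; exact: g0.
have iG : m.-integrable [set: T] G.
  apply/integrableP; split=> //.
  under eq_integral do rewrite gee0_abs//.
  rewrite integral_nneseries//.
  apply: (@le_lt_trans _ _ (\sum_(n <oo) (1 / (2 ^ n.+1)%:R)%:E)%E).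
    apply: lee_nneseries => [n _ _|n _]; first by apply: integral_ge0 => x _; exact: g0.
    rewrite /g; under eq_integral do rewrite EFinM.
    rewrite ge0_integralZl//.
    - apply: le_trans; first by apply: lee_wpmul2l (hf n); rewrite lee_fin exprn_ge0.
      rewrite -EFinM lee_fin le_eqVlt; apply/orP; left; apply/eqP.
      rewrite invfM mulrA div1r natrX exprSr invfM; congr (_ * _).
      have -> : (8 : R) ^+ n = 4 ^+ n * 2 ^+ n by rewrite -exprMn; congr (_ ^+ _); lra.
      by rewrite invfM mulrA mulfV ?mul1r// expf_neq0.
    - by apply/measurable_EFinP/measurable_funX/measurable_funB.
    - by move=> x _; rewrite lee_fin sqr_ge0.
  by apply: le_lt_trans (epsilon_trick0 xpredT ler01) _; rewrite ltry.
exists G; split=> // x Gx.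
apply: (@cvg_of_weighted_sqr _ (fine (G x))) => n.
rewrite -lee_fin fineK//; apply: le_trans (nneseries_lim_ge n.+1 _) => //.
rewrite big_nat_recr//= leeDr//; exact: sume_ge0.
Qed.

End almost_sure_limits.

(** * Convexity and completeness of the set of admissible controls *)

Section admissible_set.
Context {d : measure_display} {T : measurableType d} {R : realType}.
Variables (P : probability T R) (B : R -> T -> R).
Hypothesis P_complete : measure_is_complete P.
Hypothesis B_bm : is_brownian_motion P B.
Local Notation mu := (@lebesgue_measure R).
Local Notation pi := (mu \x P)%E.
Local Notation RT := (measurableTypeR R * T)%type.
Local Notation c0 := (@c0 R).
Implicit Types (a b : R -> T -> R) (Z : T -> R).

Definition mix (s : R) a b : R -> T -> R := fun t w => (1 - s) * a t w + s * b t w.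

Definition dist a b : R :=
  ip pi (fun x => pth a x - pth b x) (fun x => pth a x - pth b x).

Lemma pth_mix s a b : pth (mix s a b) = (fun x => (1 - s) * pth a x + s * pth b x).
Proof. by apply/funext => x; rewrite /pth /mix; case: ifP => //; rewrite !mulr0 addr0. Qed.

Lemma admissible_mix (s : R) a b : 0 <= s <= 1 -> admissible P B a -> admissible P B b ->
  admissible P B (mix s a b).
Proof.
move=> /andP[s0 s1] aA bA; have [pa na] := aA; have [pb nb] := bA; split.
  by move=> t t01; apply: measurable_funD; apply: measurable_funM => //; [exact: pa|exact: pb].
have ha := admissible_ae aA; have hb := admissible_ae bA.
have := ae_lebesgue_and ha hb; apply: ae_lebesgue_imp => t [hat hbt].
rewrite in_itv/= => t01; rewrite Lnorm2_le ?c0_ge0//.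
have s1' : 0 <= 1 - s by rewrite subr_ge0.
have ma := admissible_section P_complete B_bm t01 aA.
have mb := admissible_section P_complete B_bm t01 bA.
apply: (@le_trans _ _ (\int[P]_w ((1 - s)%:E * (a t w ^+ 2)%:E + s%:E * (b t w ^+ 2)%:E))%E).
  apply: ge0_le_integral => //.
  - by move=> w _; rewrite lee_fin sqr_ge0.
  - by apply/measurable_EFinP/measurable_funX/measurable_funD; apply: measurable_funM.
  - by apply: emeasurable_funD; apply: measurable_funeM; apply/measurable_EFinP/measurable_funX.
  - move=> w _; rewrite -!EFinM lee_fin /mix.
    have := mulr_ge0 (mulr_ge0 s0 s1') (sqr_ge0 (a t w - b t w)); lra.
rewrite ge0_integralD//; last 4 first.
- by move=> w _; rewrite mule_ge0 ?lee_fin ?sqr_ge0.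
- by apply: measurable_funeM; apply/measurable_EFinP/measurable_funX.
- by move=> w _; rewrite mule_ge0 ?lee_fin ?sqr_ge0.
- by apply: measurable_funeM; apply/measurable_EFinP/measurable_funX.
have Z2 (f : T -> R) (k : R) : measurable_fun [set: T] f -> 0 <= k ->
    (\int[P]_w (k%:E * (f w ^+ 2)%:E) = k%:E * \int[P]_w (f w ^+ 2)%:E)%E.
  move=> mf k0; rewrite ge0_integralZl//; first exact/measurable_EFinP/measurable_funX.
  by move=> w _; rewrite lee_fin sqr_ge0.
rewrite !Z2//.
have -> : (c0 ^+ 2)%:E = ((1 - s)%:E * (c0 ^+ 2)%:E + s%:E * (c0 ^+ 2)%:E)%E.
  by rewrite -!EFinM -EFinD; congr (_%:E); lra.
by apply: leeD; apply: lee_wpmul2l; rewrite ?lee_fin//; [exact: hat|exact: hbt].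
Qed.

Lemma energy_mix (s : R) a b : admissible P B a -> admissible P B b ->
  energy P (mix s a b) = (1 - s) * energy P a + s * energy P b - s * (1 - s) * dist a b.
Proof.
move=> aA bA; have sa := admissible_sqint P_complete B_bm aA.
have sb := admissible_sqint P_complete B_bm bA.
rewrite /energy pth_mix ip_sqr// /dist.
have -> : (fun x => pth a x - pth b x) = (fun x => 1 * pth a x + (-1) * pth b x).
  by apply/funext => x; rewrite mul1r mulN1r.
rewrite ip_sqr//; lra.
Qed.

Lemma dist_ge0 a b : 0 <= dist a b. Proof. exact: ip_ge0. Qed.

Lemma pairing_mixl (s : R) a b Z : admissible P B a -> admissible P B b -> sqint P Z ->
  pairing P (mix s a b) Z = (1 - s) * pairing P a Z + s * pairing P b Z.
Proof.
move=> aA bA sZ; have sa := admissible_sqint P_complete B_bm aA.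
have sb := admissible_sqint P_complete B_bm bA.
by rewrite /pairing pth_mix ip_linl//; exact: lift_sqint.
Qed.

Lemma pairing_linr (x y : R) a Y Z : admissible P B a -> sqint P Y -> sqint P Z ->
  pairing P a (fun w => x * Y w + y * Z w) = x * pairing P a Y + y * pairing P a Z.
Proof.
move=> aA sY sZ; rewrite /pairing ipC.
have -> : lift (fun w => x * Y w + y * Z w) = (fun r => x * lift Y r + y * lift Z r).
  by apply/funext => r; rewrite /lift; case: ifP => //; rewrite !mulr0 addr0.
have sa := admissible_sqint P_complete B_bm aA.
rewrite ip_linl//; try exact: lift_sqint.
by rewrite ![ip _ _ (pth a)]ipC.
Qed.

Lemma pairing_diff_sqr a b Y Z : admissible P B a -> admissible P B b ->
  sqint P Y -> sqint P Z ->
  (pairing P b Z - pairing P a Z - (pairing P b Y - pairing P a Y)) ^+ 2 <=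
  dist b a * ip P (fun w => Z w - Y w) (fun w => Z w - Y w).
Proof.
move=> aA bA sY sZ; have sa := admissible_sqint P_complete B_bm aA.
have sb := admissible_sqint P_complete B_bm bA.
have sYZ := sqintB sZ sY.
rewrite -ip_lift//; apply: le_trans (ip_cauchy (sqintB sb sa) (lift_sqint sYZ)).
rewrite ipBl//; last exact: lift_sqint.
have E c : admissible P B c ->
    ip pi (pth c) (lift (fun w => Z w - Y w)) = pairing P c Z - pairing P c Y.
  move=> cA; have := pairing_linr 1 (-1) cA sZ sY; rewrite mul1r mulN1r => <-.
  by rewrite /pairing; congr (ip _ _ (lift _)); apply/funext => w; rewrite mul1r mulN1r.
rewrite !E// le_eqVlt; apply/orP; left; apply/eqP; congr (_ ^+ 2); lra.
Qed.

(** Nonnegativity of the energy of the midpoint, read through [energy_mix]. *)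
Lemma dist_le a b : admissible P B a -> admissible P B b ->
  dist a b <= 4 * c0 ^+ 2.
Proof.
move=> aA bA; have half : 0 <= (2^-1 : R) <= 1 by rewrite invr_ge0 ler0n invf_le1// ler1n.
have h0 : 0 <= energy P (mix 2^-1 a b) by exact: ip_ge0.
have ea := energy_le P_complete B_bm aA; have eb := energy_le P_complete B_bm bA.
by move: h0; rewrite energy_mix//; lra.
Qed.

Lemma cost_energy (p : \bar R) (delta : R) a : admissible P B a ->
  cost P B p delta a =
  ('N[P]_p [EFin \o state B a 1%R] + (delta / 2 * energy P a)%:E)%E.
Proof.
move=> aA; have sa := admissible_sqint P_complete B_bm aA; have [mp _] := sa.
rewrite /cost [in RHS](EFinM (delta / 2)) /energy EFin_ip//; congr (_ + _ * _)%E.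
rewrite (fubini_tonelli2 (m1 := mu) (m2 := P)).
- apply: eq_integral => w _; rewrite integral_unit_itv /fubini_G.
  by apply: eq_integral => t _; rewrite /pth /=; case: ifP => //; rewrite expr0n.
- exact/measurable_EFinP/measurable_funX.
- by move=> x; rewrite lee_fin sqr_ge0.
Qed.

(** The rate required by [ae_cvg_of_fast_cauchy], so that the minimising sequence converges almost
    everywhere without passing to a subsequence. *)
Definition fast (n : nat) : R := (8 ^+ n * 2)^-1.

Lemma fast_gt0 n : 0 < fast n.
Proof. by rewrite invr_gt0 mulr_gt0// exprn_gt0. Qed.

Lemma fast_le m n : (m <= n)%N -> fast n <= fast m.
Proof.
move=> mn; rewrite lef_pV2 ?posrE ?mulr_gt0 ?exprn_gt0// ler_pM2r//.
by rewrite ler_eXn2l// ltr1n.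
Qed.

Lemma EFin_dist a b : admissible P B a -> admissible P B b ->
  ((dist a b)%:E = \int[pi]_x ((pth a x - pth b x) ^+ 2)%:E)%E.
Proof.
move=> aA bA; have sa := admissible_sqint P_complete B_bm aA.
have sb := admissible_sqint P_complete B_bm bA.
by rewrite /dist EFin_ip//; exact: sqintB.
Qed.

Lemma admissible_complete (a : nat -> R -> T -> R) :
  (forall n, admissible P B (a n)) ->
  (forall j k, dist (a j) (a k) <= Num.max (fast j) (fast k)) ->
  exists2 b, admissible P B b & forall n, dist (a n) b <= fast n.
Proof.
move=> aA da; pose f n := pth (a n).
have mf n : measurable_fun [set: RT] (f n).
  by have [pa _] := aA n; exact: (progressively_measurable_pth P_complete B_bm pa).
have hf n : (\int[pi]_x ((f n.+1 x - f n x) ^+ 2)%:E <= ((8 ^+ n * 2)^-1)%:E)%E.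
  rewrite -EFin_dist// lee_fin; apply: le_trans (da _ _) _.
  by rewrite ge_max lexx andbT fast_le.
have [G [mG iG Gcvg]] := ae_cvg_of_fast_cauchy mf hf.
(* An upper limit is defined at every point and is measurable whenever the terms are, so progressive
   measurability is inherited at each [t]; it equals the limit wherever one exists. *)
pose b t w := fine (limn_esup (fun n => (a n t w)%:E)).
have bE t w (l : R) : (fun n => a n t w) @ \oo --> l -> b t w = l.
  move=> h; have hE : (fun n => (a n t w)%:E) @ \oo --> l%:E.
    by apply/fine_cvgP; split => //; exact: nearW.
  rewrite /b is_cvg_limn_esupE; last by apply/cvg_ex; exists l%:E.
  by rewrite (cvg_lim _ hE).
have pb : progressively_measurable P B b.
  move=> t t01; apply: measurableT_comp => //.
  apply: measurable_fun_limn_esup => n; apply/measurable_EFinP.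
  by have [pa _] := aA n; exact: pa.
have fcvg x : G x \is a fin_num -> f n x @[n --> \oo] --> pth b x.
  case: x => t w Gx; have := Gcvg _ Gx; rewrite /f /pth /=.
  case: ifP => _ h; last exact: cvg_cst.
  by rewrite (bE t w _ h).
have mpb := progressively_measurable_pth P_complete B_bm pb.
have Gae : {ae pi, forall x, G x \is a fin_num}.
  by apply: filterS (integrable_ae measurableT iG) => x; apply.
have bA : admissible P B b.
  split=> //.
  have h1 : {ae mu, forall t, forall n, 0 <= t <= 1 ->
      (\int[P]_w (a n t w ^+ 2)%:E <= (c0 ^+ 2)%:E)%E}.
    by apply: ae_foralln => n; exact: admissible_ae.
  (* The norm constraint is imposed time by time, so almost sure convergence is needed on almost
     every time section before Fatou's lemma applies. *)
  have h2 : {ae mu, forall t, P.-integrable [set: T] (fun w => G (t, w))}.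
    exact: ae_integrable1 iG.
  have := ae_lebesgue_and h1 h2; apply: ae_lebesgue_imp => t [hat iGt].
  rewrite in_itv/= => t01; rewrite Lnorm2_le ?c0_ge0//.
  apply: (@fatou_le _ _ _ P (fun n w => a n t w ^+ 2)).
  - move=> n; apply: measurable_funX; exact: (admissible_section P_complete B_bm t01 (aA n)).
  - apply: measurable_funX; apply: measurable_fun_sub (progressively_measurable_section t01 pb).
    by move=> C; apply: completed_gen_measurable => //; case/andP: t01.
  - by move=> n w; exact: sqr_ge0.
  - by move=> w; exact: sqr_ge0.
  - apply: filterS (integrable_ae measurableT iGt) => w /(_ Logic.I) /fcvg.
    rewrite /f pthE// => h; have : (fun n => a n t w) @ \oo --> b t w.
      by under eq_fun do rewrite -(pthE (a _) w t01).
    by move=> {}h; exact: cvg_sqr.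
  - by move=> n; exact: hat.
exists b => // n; rewrite -lee_fin EFin_dist//.
apply: (@fatou_le _ _ _ pi (fun j x => (f n x - f (j + n)%N x) ^+ 2)).
- by move=> j; apply: measurable_funX; exact: (measurable_funB (mf n) (mf _)).
- by apply: measurable_funX; exact: (measurable_funB (mf n) mpb).
- by move=> j x; exact: sqr_ge0.
- by move=> x; exact: sqr_ge0.
- apply: filterS Gae => x Gx; apply: cvg_sqr; apply: cvgB; first exact: cvg_cst.
  by rewrite (@cvg_shiftn n _ (fun k => f k x)); exact: fcvg.
- move=> j; rewrite -EFin_dist// lee_fin; apply: le_trans (da _ _) _.
  by rewrite ge_max lexx/= fast_le// leq_addl.
Qed.

Lemma energy_lsc a b : admissible P B a -> admissible P B b ->
  energy P b <= energy P a + 2 * c0 * Num.sqrt (dist a b).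
Proof.
move=> aA bA; have sa := admissible_sqint P_complete B_bm aA.
have sb := admissible_sqint P_complete B_bm bA; have sab := sqintB sa sb.
have /ler_normlP[h1 _] := ip_norm_le sab sb.
have h2 : ip pi (fun x => pth a x - pth b x) (pth b) = ip pi (pth a) (pth b) - energy P b.
  by rewrite ipBl.
have h3 : dist a b = energy P a - 2 * ip pi (pth a) (pth b) + energy P b.
  rewrite /dist.
  have -> : (fun x => pth a x - pth b x) = (fun x => 1 * pth a x + (-1) * pth b x).
    by apply/funext => x; rewrite mul1r mulN1r.
  by rewrite ip_sqr// /energy; lra.
have h4 : Num.sqrt (energy P b) <= c0.
  rewrite -(ger0_norm c0_ge0) -sqrtr_sqr ler_sqrt ?sqr_ge0//; exact: (energy_le P_complete B_bm bA).
have h5 := ler_wpM2l (sqrtr_ge0 (dist a b)) h4.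
have h6 := dist_ge0 a b.
move: h1; rewrite h2 -/(dist a b) -/(energy P b) => h1; lra.
Qed.

Lemma pairing_lipschitz a b Z : admissible P B a -> admissible P B b -> sqint P Z ->
  pairing P b Z <= pairing P a Z + Num.sqrt (dist a b) * Num.sqrt (ip P Z Z).
Proof.
move=> aA bA sZ; have sa := admissible_sqint P_complete B_bm aA.
have sb := admissible_sqint P_complete B_bm bA; have sl := lift_sqint sZ.
have /ler_normlP[h1 _] := ip_norm_le (sqintB sa sb) sl.
move: h1; rewrite ipBl// ip_lift// -/(dist a b) -/(pairing P a Z) -/(pairing P b Z); lra.
Qed.

End admissible_set.

(** * The function [phi] and monotone functions of time *)

Section phi_theory.
Context {R : realType}.
Local Notation c0 := (@c0 R).
Variable delta : R.
Hypothesis delta_ge0 : 0 <= delta.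
Implicit Types (x y : \bar R) (r a : R).

Lemma phi_ge r a : `|a| <= c0 -> ((a * r - delta / 2 * a ^+ 2)%:E <= phi delta r%:E)%E.
Proof. by move=> ac; apply: ereal_sup_ubound; exists a. Qed.

Lemma phi_le_linear r : (phi delta r%:E <= (c0 * `|r|)%:E)%E.
Proof.
apply: ge_ereal_sup => _ [a /= ac <-]; rewrite lee_fin.
have h : 0 <= delta / 2 * a ^+ 2 by rewrite mulr_ge0 ?sqr_ge0 ?divr_ge0.
rewrite lerBlDr (@le_trans _ _ `|a * r|) ?ler_norm// normrM.
by rewrite (@le_trans _ _ (c0 * `|r|)) ?ler_wpM2r// lerDl.
Qed.

Lemma phi_ge0 y : (0 <= phi delta y)%E.
Proof.
case: y => [r| |] //=; rewrite ?le0y//.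
have := @phi_ge r 0; rewrite normr0 mul0r expr0n mulr0 subr0; apply.
exact: sqrtr_ge0.
Qed.

Lemma phi_fin_num r : phi delta r%:E \is a fin_num.
Proof. by rewrite ge0_fin_numE ?phi_ge0// (le_lt_trans (phi_le_linear r))// ltry. Qed.

(** The constraint on [a] is symmetric, so for nonnegative arguments [a] may be replaced by
    [|a|]. *)
Lemma phi_mono x y : (0 <= x)%E -> (x <= y)%E -> (phi delta x <= phi delta y)%E.
Proof.
case: y => [s| |]; last 2 first.
- by move=> _ _; rewrite leey.
- by case: x.
case: x => [r| |] //; rewrite !lee_fin => r0 rs.
apply: ge_ereal_sup => _ [a /= ac <-].
apply: (@le_trans _ _ (`|a| * s - delta / 2 * `|a| ^+ 2)%:E); last first.
  by apply: phi_ge; rewrite normr_id.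
rewrite lee_fin real_normK ?num_real// lerB//.
apply: (@le_trans _ _ (`|a| * r)); first by rewrite ler_wpM2r ?ler_norm.
by rewrite ler_wpM2l.
Qed.

Lemma phi_near_max r (e : R) : 0 < e -> exists2 a, `|a| <= c0 &
  (phi delta r%:E <= (a * r - delta / 2 * a ^+ 2 + e)%:E)%E.
Proof.
move=> e0; have fin := phi_fin_num r.
have [_ [a /= ac <-] h] := ub_ereal_sup_adherent e0 fin.
exists a => //; rewrite EFinD -leeBlDr//; exact: ltW.
Qed.

(** Superlevel sets are intervals. This gives measurability in time of the norm of the chosen
    versions of [E[Y | F(t)]] without any path regularity. *)
Lemma nondecreasing_unit_measurable (g : R -> \bar R) :
  (forall s t, 0 <= s -> s <= t -> t <= 1 -> (g s <= g t)%E) ->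
  measurable_fun (`[0, 1]%classic : set R) g.
Proof.
move=> g_nd; apply: (measurability (@ErealGenOInfty.G R)) => [|/= _ [_] [r] -> <-].
  exact: ErealGenOInfty.measurableE.
apply: is_interval_measurable.
move=> s t [/= s01 sr] [t01 tr] u /andP[su ut].
move: s01 t01; rewrite /= !in_itv/= => /andP[s0 s1] /andP[t0 t1].
have u0 : 0 <= u by exact: le_trans su.
have u1 : u <= 1 by exact: le_trans t1.
move: sr; rewrite in_itv/= andbT => sr; rewrite u0 u1; split=> //.
by rewrite andbT; exact: (lt_le_trans sr (g_nd _ _ s0 su u1)).
Qed.

End phi_theory.

(** * Left Riemann sums of a nondecreasing function *)

Section left_endpoint_sums.
Context {R : realType}.
Local Notation mu := (@lebesgue_measure R).
Variables (n : nat) (g : R -> \bar R).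
Hypothesis g_nd : forall s t : R, 0 <= s -> s <= t -> t <= 1 -> (g s <= g t)%E.
Hypothesis g_ge0 : forall s : R, (0 <= g s)%E.
Local Notation step k := (k%:R / n.+1%:R : R).

Definition grid (s : R) : R := step (Num.truncn (n.+1%:R * s)).

Lemma n1_gt0 : 0 < n.+1%:R :> R. Proof. by rewrite ltr0n. Qed.

Lemma grid_itv (s : R) : 0 <= s -> grid s <= s < grid s + n.+1%:R^-1.
Proof.
move=> s0; have ns0 : 0 <= n.+1%:R * s by rewrite mulr_ge0.
have /andP[h1 h2] := truncn_itv ns0; apply/andP; split.
  by rewrite /grid ler_pdivrMr ?n1_gt0// [s * _]mulrC.
by rewrite /grid -[X in _ + X]div1r -mulrDl ltr_pdivlMr ?n1_gt0// [s * _]mulrC natr1.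
Qed.

Lemma grid_ge0 (s : R) : 0 <= grid s.
Proof. by rewrite divr_ge0. Qed.

Lemma grid_mono (s t : R) : 0 <= s -> s <= t -> grid s <= grid t.
Proof.
move=> s0 st; rewrite ler_pM2r ?invr_gt0 ?n1_gt0// ler_nat.
by apply: le_truncn; rewrite ler_pM2l ?n1_gt0.
Qed.

Lemma grid_step (s : R) k : step k <= s -> s < step k.+1 -> grid s = step k.
Proof.
move=> h1 h2; rewrite /grid (@truncn_def _ _ k)//.
move: h1 h2; rewrite ler_pdivrMr ?n1_gt0// ltr_pdivlMr ?n1_gt0// mulrC => h1 h2.
by rewrite h1.
Qed.

Lemma measurable_grid : measurable_fun (`[0, 1]%classic : set R) (g \o grid).
Proof.
apply: nondecreasing_unit_measurable => s t s0 st t1 /=; apply: g_nd.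
- exact: grid_ge0.
- exact: grid_mono.
- by have /andP[h _] := grid_itv (le_trans s0 st); apply: le_trans t1.
Qed.

(** On a new cell the integral of [g] is at most the new boundary term, while the old boundary term
    equals the integral of [g \o grid] there. The error thus telescopes, and no subtraction of
    possibly infinite values occurs. *)
Lemma integral_le_left_sums_step k : (k <= n.+1)%N ->
  (\int[mu]_(t in `[0%R, step k[) g t <=
   \int[mu]_(t in `[0%R, step k[) g (grid t) + (n.+1%:R^-1)%:E * g (step k))%E.
Proof.
elim: k => [_|k IH kn].
  rewrite mul0r set_itvco0 !integral_set0 add0e mule_ge0// lee_fin invr_ge0 ltW// n1_gt0.
have n0 := n1_gt0.
have {}IH := IH (ltnW kn).
have k1 : step k.+1 <= 1 by rewrite ler_pdivrMr// mul1r ler_nat.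
have kk : step k <= step k.+1 by rewrite ler_pM2r ?invr_gt0// ler_nat.
have k0 : 0 <= step k by rewrite divr_ge0.
have sub (a b : R) : 0 <= a -> b <= 1 ->
    (`[a, b[%classic : set R) `<=` `[0, 1]%classic.
  move=> a0 b1 x /=; rewrite !in_itv/= => /andP[ax xb].
  by rewrite (le_trans a0)//= ltW// (lt_le_trans xb).
have U : `[0%R, step k.+1[%classic = `[0%R, step k[%classic `|` `[step k, step k.+1[%classic.
  by apply: itv_bndbnd_setU; rewrite bnd_simp.
have D : [disjoint `[0%R, step k[%classic & `[step k, step k.+1[%classic].
  apply/disj_setPS => x [/=]; rewrite !in_itv/= => /andP[_ xk] /andP[kx _].
  by move: (lt_le_trans xk kx); rewrite ltxx.
have mg := nondecreasing_unit_measurable g_nd.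
have mg' := measurable_grid.
have mS f : measurable_fun (`[0, 1]%classic : set R) f ->
    measurable_fun (`[0%R, step k[%classic `|` `[step k, step k.+1[%classic) f.
  move=> mf; rewrite -U; apply: measurable_funS mf => //; exact: sub.
rewrite U !ge0_integral_setU//; try exact: mS.
have len : mu `[step k, step k.+1[%classic = (n.+1%:R^-1)%:E.
  rewrite lebesgue_measure_itv/= lte_fin ltr_pM2r ?invr_gt0// ltr_nat ltnSn.
  by rewrite -EFinB -mulrBl -natrB// subSnn mul1r.
have h1 : (\int[mu]_(t in `[step k, step k.+1[) g t <= (n.+1%:R^-1)%:E * g (step k.+1))%E.
  apply: (@le_trans _ _ (\int[mu]_(t in `[step k, step k.+1[) (cst (g (step k.+1)) t))%E).
    apply: ge0_le_integral => //.
    - by apply: measurable_funS mg => //; exact: sub.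
    - move=> t /=; rewrite in_itv/= => /andP[kt tk]; apply: g_nd => //.
        exact: le_trans kt.
      exact: ltW.
  by rewrite integral_cst// [X in (_ * X)%E]len muleC.
have h2 : (\int[mu]_(t in `[step k, step k.+1[) g (grid t) = (n.+1%:R^-1)%:E * g (step k))%E.
  rewrite (eq_integral (cst (g (step k)))); last first.
    by move=> t /set_mem /=; rewrite in_itv/= => /andP[kt tk]; rewrite (grid_step kt tk).
  by rewrite integral_cst// [X in (_ * X)%E]len muleC.
rewrite h2; exact: leeD.
Qed.

Lemma integral_le_left_sums :
  (\int[mu]_(t in `[0%R, 1%R]) g t <=
   \int[mu]_(t in `[0%R, 1%R]) g (grid t) + (n.+1%:R^-1)%:E * g 1%R)%E.
Proof.
have := integral_le_left_sums_step (leqnn n.+1).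
rewrite mulfV ?gt_eqF ?n1_gt0// !integral_itv_bndo_bndc//.
- apply: measurable_funS measurable_grid => // x /=.
  by rewrite !in_itv/= => /andP[-> /ltW].
- apply: measurable_funS (nondecreasing_unit_measurable g_nd) => // x /=.
  by rewrite !in_itv/= => /andP[-> /ltW].
Qed.

End left_endpoint_sums.

(** * Minimising the Lagrangian for a fixed bounded [Y] *)

Section dual_objective_bounds.
Context {d : measure_display} {T : measurableType d} {R : realType}.
Variables (P : probability T R) (B : R -> T -> R).
Hypothesis P_complete : measure_is_complete P.
Hypothesis B_bm : is_brownian_motion P B.
Local Notation mu := (@lebesgue_measure R).
Local Notation c0 := (@c0 R).
Local Notation F t := (completed_gen P B t).
Variables (delta : R) (Y : T -> R).
Hypothesis delta_ge0 : 0 <= delta.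
Hypothesis iY : P.-integrable [set: T] (EFin \o Y).
Local Notation M t := (cond_exp P (F t) Y).
Local Notation nm t := ('N[P]_(2%:E) [EFin \o M t])%E.

Lemma martP (t : R) : t <= 1 -> is_cond_exp P (F t) Y (M t).
Proof.
by move=> t1; apply: cond_expP iY => A; exact: completed_gen_measurable.
Qed.

Lemma mart_measurable (t : R) : t <= 1 -> measurable_fun [set: T] (M t).
Proof.
move=> t1; have [mM _ _] := martP t1.
by apply: measurable_fun_sub mM => A; exact: completed_gen_measurable.
Qed.

Lemma mart_tower (s t : R) : s <= t -> t <= 1 -> is_cond_exp P (F s) (M t) (M s).
Proof.
move=> st t1; apply: cond_exp_tower (martP (le_trans st t1)) (martP t1).
exact: completed_sigma_mono.
Qed.

Lemma mart_norm_mono (s t : R) : 0 <= s -> s <= t -> t <= 1 -> (nm s <= nm t)%E.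
Proof.
move=> s0 st t1; have [_ iM _] := martP t1.
apply: cond_exp_Lnorm iM (mart_tower st t1); last by rewrite lee1n.
by move=> A; apply: completed_gen_measurable => //; exact: le_trans t1.
Qed.

Lemma phi_mart_mono (s t : R) : 0 <= s -> s <= t -> t <= 1 ->
  (phi delta (nm s) <= phi delta (nm t))%E.
Proof.
by move=> s0 st t1; apply: phi_mono; [exact: Lnorm_ge0|exact: mart_norm_mono].
Qed.

Section bounded.
Hypothesis Y_bounded : exists C, forall w, `|Y w| <= C.

Let mY : measurable_fun [set: T] Y.
Proof. exact/measurable_EFinP/(measurable_int _ iY). Qed.

Lemma bounded_sqint : sqint P Y.
Proof.
split=> //; apply: bounded_integrable; first exact: measurable_funX.
have [C YC] := Y_bounded; exists (C ^+ 2) => w.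
rewrite normrX; apply: lerXn2r; rewrite ?nnegrE//.
exact: le_trans (YC w).
Qed.

Lemma mart_sqint (t : R) : t <= 1 -> sqint P (M t).
Proof.
move=> t1; apply: Lnorm2_lty; first exact: mart_measurable.
apply: (@le_lt_trans _ _ ('N[P]_(2%:E) [EFin \o Y])%E).
  apply: cond_exp_Lnorm iY (martP t1); last by rewrite lee1n.
  by move=> A; exact: completed_gen_measurable.
by rewrite Lnorm2_sqint ?ltry//; exact: bounded_sqint.
Qed.

Let m t := Num.sqrt (ip P (M t) (M t)).

Let nmE (t : R) : t <= 1 -> nm t = (m t)%:E.
Proof. by move=> t1; rewrite Lnorm2_sqint//; exact: mart_sqint. Qed.

Lemma ip_mart (t : R) : t <= 1 -> ip P Y (M t) = ip P (M t) (M t).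
Proof.
move=> t1; have [mM iM _] := martP t1.
have sM := mart_sqint t1; have sY := bounded_sqint.
rewrite ipC; apply: (cond_exp_mul _ iY (martP t1)) => //.
- by move=> A; exact: completed_gen_measurable.
- exact: sqint_mul.
- exact: sqint_mul.
Qed.

Section step_control.
Variables (n : nat) (a : nat -> R).
Hypothesis a_c0 : forall k, `|a k| <= c0.
Local Notation tk k := (k%:R / n.+1%:R : R).

(* At [m = 0] the quotient is [0] by convention, which is what is needed. *)
Definition step_value k w := - (a k / m (tk k)) * M (tk k) w.
Definition step_control (t : R) w := step_value (Num.truncn (n.+1%:R * t)) w.

Let step_le1 (t : R) : 0 <= t -> t <= 1 -> tk (Num.truncn (n.+1%:R * t)) <= 1.
Proof. by move=> t0 t1; have /andP[h _] := grid_itv n t0; exact: le_trans t1. Qed.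

(** On each time slab the control is constant in time and measurable for the sigma-algebra at the
    left endpoint of the slab; slabs that start after [t] are empty. *)
Lemma step_control_progressive : progressively_measurable P B step_control.
Proof.
move=> t; rewrite in_itv/= => /andP[t0 t1].
pose E k : set (measurableTypeR R * g_sigma_algebraType (F t)) :=
  (`[0, t]%classic `&` `[tk k, tk k.+1[%classic) `*` setT.
have mE k : measurable (E k) by apply: measurableX => //; apply: measurableI.
have -> : (`[0, t]%classic `*` setT) = \bigcup_k E k.
  apply/seteqP; split => [[s w] /= [st _]|[s w] [k _ /= [[st _] _]]] //.
  move: (st); rewrite in_itv/= => /andP[s0 _].
  exists (Num.truncn (n.+1%:R * s)) => //; split => //; split => //=.
  rewrite in_itv/=; have /andP[h1 h2] := grid_itv n s0; rewrite h1/=.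
  by rewrite -natr1 mulrDl div1r.
apply/measurable_fun_bigcup => // k.
have [kt|tk_gt] := leP (tk k) t; last first.
  rewrite (_ : E k = set0); first exact: measurable_fun_set0.
  apply/seteqP; split => // -[s w] [[/= + +] _]; rewrite !in_itv/=.
  by move=> /andP[_ st] /andP[ks _]; move: (le_lt_trans st tk_gt); rewrite ltNge ks.
apply: (eq_measurable_fun (fun x : measurableTypeR R * g_sigma_algebraType (F t) =>
  step_value k x.2)).
  move=> [s w] /set_mem [[/= _ +] _]; rewrite in_itv/= => /andP[h1 h2].
  rewrite /step_control.
  have -> // : Num.truncn (n.+1%:R * s) = k.
  apply: truncn_def; move: h1 h2.
  by rewrite ler_pdivrMr ?n1_gt0// ltr_pdivlMr ?n1_gt0// [s * _]mulrC => -> ->.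
apply: measurable_funTS.
have mS : measurable_fun [set: g_sigma_algebraType (F t)] (step_value k).
  apply: measurable_funM => // _ U mU.
  have [mM _ _] := martP (le_trans kt t1).
  rewrite setTI; apply: (completed_sigma_mono kt).
  by have := mM measurableT U mU; rewrite setTI.
exact: measurableT_comp mS (@measurable_snd _ _ (measurableTypeR R) (g_sigma_algebraType (F t))).
Qed.

Let step_sqr k : tk k <= 1 ->
  ip P (step_value k) (step_value k) = (a k / m (tk k)) ^+ 2 * m (tk k) ^+ 2.
Proof.
move=> k1; have sM := mart_sqint k1.
have := ip_sqr (- (a k / m (tk k))) 0 sM sM.
rewrite mulr0 mul0r expr0n mul0r !addr0 sqrrN [m _ ^+ 2]sqr_sqrtr ?ip_ge0// => <-.
by congr (ip P _ _); apply/funext => w; rewrite mul0r addr0.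
Qed.

Let step_sqint k : tk k <= 1 -> sqint P (step_value k).
Proof.
move=> k1; have sM := mart_sqint k1.
have := sqint_lin (- (a k / m (tk k))) 0 sM sM.
by under eq_fun do rewrite mul0r addr0.
Qed.

Let step_sqr_le k : tk k <= 1 -> ip P (step_value k) (step_value k) <= a k ^+ 2.
Proof.
move=> k1; rewrite step_sqr// -exprMn; have [->|m0] := eqVneq (m (tk k)) 0.
  by rewrite mulr0 expr0n sqr_ge0.
by rewrite divfK.
Qed.

Lemma step_control_admissible : admissible P B step_control.
Proof.
split; first exact: step_control_progressive.
apply: aeW => t; rewrite in_itv/= => /andP[t0 t1].
have k1 := step_le1 t0 t1.
rewrite Lnorm2_le ?c0_ge0// -EFin_ip; last exact: step_sqint.
rewrite lee_fin (le_trans (step_sqr_le k1))//.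
rewrite -real_normK ?num_real//; apply: lerXn2r; rewrite ?nnegrE ?c0_ge0//.
Qed.

(** Pairing [Y] with its projection [M] gives the squared norm of [M], so the linear term is [- a k]
    times that norm. The energy term is only bounded by [a k ^+ 2], since the control vanishes where
    [m] does. *)
Lemma step_lagrangian_le (t : R) : 0 <= t -> t <= 1 ->
  (\int[P]_w (step_control t w * Y w + delta / 2 * step_control t w ^+ 2)%:E <=
   (- (a (Num.truncn (n.+1%:R * t)) * m (grid n t)
       - delta / 2 * a (Num.truncn (n.+1%:R * t)) ^+ 2))%:E)%E.
Proof.
move=> t0 t1; rewrite /grid; set k := Num.truncn _; have k1 : tk k <= 1 by exact: step_le1.
have sS := step_sqint k1; have sM := mart_sqint k1; have sY := bounded_sqint.
have i1 := sqint_mul sS sY.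
have i2 := integrableZl measurableT (delta / 2) (proj2 sS).
have fin : (\int[P]_w (step_value k w * Y w + delta / 2 * step_value k w ^+ 2)%:E)%E \is a fin_num.
  apply: (integrable_fin_num measurableT).
  by have := integrableD measurableT i1 i2; apply: eq_integrable.
rewrite /step_control -/k -(fineK fin) lee_fin.
rewrite -/(Rintegral P setT (fun w => step_value k w * Y w + delta / 2 * step_value k w ^+ 2)).
rewrite RintegralD// RintegralZl//; last exact: (proj2 sS).
have -> : \int[P]_w (step_value k w * Y w) = - (a k / m (tk k)) * m (tk k) ^+ 2.
  have := ip_linl (- (a k / m (tk k))) 0 sM sM sY.
  rewrite mul0r addr0 [ip P (M _) Y]ipC ip_mart// [m _ ^+ 2]sqr_sqrtr ?ip_ge0// => <-.
  by rewrite /ip; apply: eq_Rintegral => w _; rewrite mul0r addr0.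
have -> : \int[P]_w (step_value k w ^+ 2) = ip P (step_value k) (step_value k).
  by rewrite /ip; apply: eq_Rintegral => w _; rewrite expr2.
have h := ler_wpM2l (divr_ge0 delta_ge0 (ler0n _ 2)) (step_sqr_le k1).
have -> : - (a k / m (tk k)) * m (tk k) ^+ 2 = - (a k * m (tk k)).
  have [->|m0] := eqVneq (m (tk k)) 0; first by rewrite expr0n !mulr0 oppr0.
  by rewrite expr2 mulrA mulNr divfK// mulNr.
by rewrite opprB addrC lerD2r.
Qed.

End step_control.

(* Freezing [M] at the left endpoints of a fine grid and pointing the control
   against it nearly attains the infimum of the Lagrangian at [Y]. *)
Lemma lagrangian_near_min (e : R) : 0 < e ->
  exists2 al, admissible P B al &
  (\int[mu]_(t in `[0%R, 1%R]) phi delta (nm t) <=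
   (e - (pairing P al Y + delta / 2 * energy P al))%:E)%E.
Proof.
move=> e0; have e2 : 0 < e / 2 by rewrite divr_gt0.
pose g t := phi delta (nm t).
have g0 t : (0 <= g t)%E by exact: phi_ge0.
have g_nd := phi_mart_mono.
have g1 : g 1 = (fine (phi delta (m 1)%:E))%:E.
  by rewrite /g nmE// fineK//; exact: phi_fin_num.
set C := fine _ in g1; have C0 : 0 <= C by rewrite -lee_fin -g1.
(* The grid error is [C / n.+1], at most half of [e]; the other half pays for the near-maximisers
   [a k] in [phi]. *)
pose n := Num.truncn (C / (e / 2)).
have nC : n.+1%:R^-1 * C <= e / 2.
  rewrite ler_pdivrMl ?n1_gt0// mulrC -ler_pdivrMl// mulrC.
  by apply: ltW; exact: truncnS_gt.
pose tk k : R := k%:R / n.+1%:R.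
have pick k : exists ak : R, `|ak| <= c0 /\
    (phi delta (m (tk k))%:E <= (ak * m (tk k) - delta / 2 * ak ^+ 2 + e / 2)%:E)%E.
  by have [ak h1 h2] := phi_near_max delta_ge0 (m (tk k)) e2; exists ak.
have [a ha] := choice pick.
have ac k : `|a k| <= c0 by have [] := ha k.
have sY := bounded_sqint.
have alA := step_control_admissible n ac.
exists (step_control n a) => //.
have [K [iK KE Kt]] := lagrangian_sections P_complete B_bm (delta / 2) alA sY.
set Lg := pairing _ _ _ + _ in KE *.
have mD : measurable (`[0, 1]%classic : set R) by [].
have iKD : mu.-integrable `[0, 1]%classic K by apply: integrableS iK.
have KD : (\int[mu]_(t in `[0%R, 1%R]) K t = Lg%:E)%E.
  rewrite -KE integral_unit_itv; apply: eq_integral => t _.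
  by rewrite Kt; case: (0 <= t <= 1).
have ie : mu.-integrable `[0, 1]%classic (cst (e / 2)%:E).
  apply/integrableP; split=> //; rewrite (eq_integral (cst `|(e / 2)%:E|%E))//.
  by rewrite integral_cst//= lebesgue_measure_itv/= lte01 oppr0 adde0 mule1 ltry.
have h1 : (\int[mu]_(t in `[0%R, 1%R]) g (grid n t) <= (e / 2 - Lg)%:E)%E.
  rewrite EFinB -KD.
  have -> : (e / 2)%:E = (\int[mu]_(t in `[0%R, 1%R]) (cst (e / 2)%:E t))%E.
    by rewrite integral_cst//= lebesgue_measure_itv/= lte01 oppr0 adde0 mule1.
  rewrite -integralB//.
  apply: ge0_le_integral => //.
  - exact: measurable_grid.
  - by apply: emeasurable_funB => //; exact: measurable_int iKD.
  - move=> t; rewrite /= in_itv/= => t01; have /andP[t0 t1] := t01.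
    rewrite Kt t01; have hS := step_lagrangian_le n a t0 t1.
    have [_ hk] := ha (Num.truncn (n.+1%:R * t)).
    have k1 : grid n t <= 1 by have /andP[h _] := grid_itv n t0; exact: le_trans t1.
    rewrite /g nmE//; apply: le_trans hk _.
    apply: le_trans (leeB (lexx (e / 2)%:E) hS).
    by rewrite -EFinB lee_fin opprK addrC.
apply: le_trans (integral_le_left_sums n g_nd g0) _.
apply: (@le_trans _ _ ((e / 2 - Lg)%:E + (e / 2)%:E)%E).
  apply: leeD => //; have -> : phi delta (nm 1) = C%:E by exact: g1.
  by rewrite -EFinM lee_fin.
by rewrite -EFinD lee_fin; lra.
Qed.

End bounded.
End dual_objective_bounds.

(** * Weak duality for unbounded [Y] *)

Section weak_duality.
Context {d : measure_display} {T : measurableType d} {R : realType}.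
Variables (P : probability T R) (B : R -> T -> R).
Hypothesis P_complete : measure_is_complete P.
Hypothesis B_bm : is_brownian_motion P B.
Local Notation mu := (@lebesgue_measure R).
Local Notation c0 := (@c0 R).
Local Notation F t := (completed_gen P B t).
Variables (p : \bar R) (delta : R).
Hypotheses (p_ge1 : (1 <= p)%E) (q_ge1 : (1 <= hoelder_conjugate p)%E).
Variables (a : R -> T -> R) (aA : admissible P B a).
Variable Y : T -> R.
Hypothesis mY : measurable_fun [set: T] Y.

Lemma LlogL_integrable : (LlogL P Y < +oo)%E -> P.-integrable [set: T] (EFin \o Y).
Proof.
move=> LY; apply/integrableP; split; first exact/measurable_EFinP.
have mL := measurable_LlogL mY; have e0 : 0 <= expR (1 ^+ 2 / 4) :> R by exact: expR_ge0.
apply: (@le_lt_trans _ _ (\int[P]_w (3%:E * (`|Y w| * Num.sqrt (ln (1 + `|Y w|)))%:E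
    + (8 * expR (1 ^+ 2 / 4))%:E))%E).
  apply: ge0_le_integral => //.
  - by apply: measurableT_comp => //; exact/measurable_EFinP.
  - by apply: emeasurable_funD => //; apply: measurable_funeM; exact/measurable_EFinP.
  - by move=> w _; rewrite -EFinM -EFinD lee_fin -[leLHS]mulr1; exact: young_LlogL.
rewrite ge0_integralD//; last by apply: measurable_funeM; exact/measurable_EFinP.
rewrite ge0_integralZl//; last exact/measurable_EFinP.
apply: lte_add_pinfty; first by rewrite lte_mul_pinfty.
by rewrite integral_cst// [X in (_ * X)%E]probability_setT mule1 ltry.
Qed.

Hypothesis LY : (LlogL P Y < +oo)%E.
Hypothesis NY : ('N[P]_(hoelder_conjugate p) [EFin \o Y] <= 1)%E.
Let iY := LlogL_integrable LY.
Local Notation M t := (cond_exp P (F t) Y).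
Local Notation nm t := ('N[P]_(2%:E) [EFin \o M t])%E.
Local Notation X := (state B a 1).
Local Notation m t := (Num.sqrt (ip P (M t) (M t))).

Section before_time_one.
Variable t : R.
Hypotheses (t0 : 0 < t) (t1 : t < 1) (nm_fin : (nm t < +oo)%E).

Let sM (s : R) : 0 <= s -> s <= t -> sqint P (M s).
Proof.
move=> s0 st; have s1 : s <= 1 by rewrite (le_trans st)// ltW.
apply: Lnorm2_lty; first exact: (mart_measurable P_complete B_bm iY).
by apply: le_lt_trans nm_fin; exact: (mart_norm_mono P_complete B_bm iY s0 st (ltW t1)).
Qed.

Let sMt : sqint P (M t). Proof. exact: sM (ltW t0) (lexx t). Qed.

(** Both sides equal [E[M(t) B(t)]]: the left because the increment after [t] has conditional mean
    zero, the right because [B t] is known at time [t]. *)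
Lemma mart_bm : \int[P]_w (M t w * B 1 w) = \int[P]_w (Y w * B t w).
Proof.
have [mMt iMt _] := martP P_complete B_bm iY (ltW t1).
have GM A := @completed_gen_measurable _ _ _ _ _ P_complete B_bm t A (ltW t1).
have sB1 : sqint P (B 1) by apply: (bm_sqint B_bm); rewrite ltr01 lexx.
have sBt : sqint P (B t) by apply: (bm_sqint B_bm); rewrite t0 ltW.
have iYB : P.-integrable [set: T] (EFin \o (fun w => Y w * B t w)).
  by apply: (LlogL_bm_integrable B_bm mY LY); rewrite t0 ltW.
have -> : \int[P]_w (Y w * B t w) = \int[P]_w (B t w * M t w).
  under eq_Rintegral do rewrite mulrC.
  apply: (cond_exp_mul GM iY (martP P_complete B_bm iY (ltW t1))).
  - exact: bm_adapted (ltW t0).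
  - by apply: eq_integrable iYB => // w _; rewrite /= mulrC.
  - exact: sqint_mul.
have sZ := bm_increment_sqint B_bm (ltW t0) t1 (lexx 1).
have : \int[P]_w (M t w * (B 1 w - B t w)) = \int[P]_w (M t w * cst 0 w).
  apply: (cond_exp_mul GM _ (bm_increment_cond_exp P_complete B_bm (ltW t0) t1 (lexx 1))) => //.
  - have := sqint_mul sZ (sqint_cst P 1); apply: eq_integrable => // w _.
    by rewrite /= mulr1.
  - exact: sqint_mul.
  - by under eq_fun do rewrite mulr0; exact: (integrable0 P).
rewrite [RHS](_ : _ = 0); last first.
  by under eq_Rintegral do rewrite mulr0; rewrite Rintegral_cst// mul0r.
under eq_Rintegral do rewrite mulrBr.
rewrite RintegralB//; try exact: sqint_mul.
by move=> /eqP; rewrite subr_eq0 => /eqP ->; apply: eq_Rintegral => w _; rewrite mulrC.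
Qed.

(** The left side is [E[M(t) X]]; by conditional Jensen [M t] stays in the unit ball of the
    conjugate exponent, and Hoelder's inequality applies. *)
Lemma mart_state_le :
  ((\int[P]_w (Y w * B t w) + pairing P a (M t))%:E <= 'N[P]_p [EFin \o X])%E.
Proof.
have [mI iI IE] := state_integral P_complete B_bm aA sMt.
have sB1 : sqint P (B 1) by apply: (bm_sqint B_bm); rewrite ltr01 lexx.
have mX : measurable_fun [set: T] X by apply: measurable_funD mI (proj1 sB1).
have [mMt _] := sMt.
have iMX : P.-integrable [set: T] (EFin \o (M t \* X)%R).
  have := integrableD measurableT iI (sqint_mul sMt sB1).
  by apply: eq_integrable => // w _; rewrite /= /state mulrDr.
have -> : (\int[P]_w (Y w * B t w) + pairing P a (M t))%:E =
    (\int[P]_w (EFin \o (M t \* X)%R) w)%E.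
  rewrite -[RHS]fineK; last exact: integrable_fin_num.
  congr (_%:E); rewrite -mart_bm -IE addrC -RintegralD//; last exact: sqint_mul.
  by apply: eq_Rintegral => w _; rewrite /= /state mulrDr.
apply: le_trans (lee_abs _) _.
apply: le_trans (le_abse_integral _ _ (measurable_int _ iMX)) _ => //.
under eq_integral do rewrite /= mulrC.
have := hoelder_ereal P p_ge1 mX mMt; rewrite Lnorm1 => h.
apply: le_trans h _.
rewrite -[leRHS]mule1; apply: lee_wpmul2l; first exact: Lnorm_ge0.
apply: le_trans _ NY; apply: (cond_exp_Lnorm _ q_ge1 iY (martP P_complete B_bm iY (ltW t1))).
by move=> A; apply: (completed_gen_measurable P_complete B_bm); exact: ltW.
Qed.

(** For [s <= t] the adaptedness of [a s] allows [M t] to be replaced by [M s]. For [s > t] the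
    bound holds with the norm of [M t], and monotonicity of that norm in time raises it to
    [nm s]. *)
Lemma section_lagrangian_ge (s : R) : 0 <= s <= 1 ->
  ('N[P]_(2%:E) [EFin \o a s] <= c0%:E)%E ->
  (- (\int[P]_w (a s w * M t w + delta / 2 * a s w ^+ 2)%:E) <= phi delta (nm s))%E.
Proof.
move=> /andP[s0 s1] na; have ms : measurable_fun [set: T] (a s).
  by apply: (admissible_section P_complete B_bm _ aA); rewrite s0.
have sa : sqint P (a s).
  by apply: Lnorm2_lty => //; apply: le_lt_trans na (ltry _).
set x := Num.sqrt (ip P (a s) (a s)).
have xc : `|x| <= c0.
  by rewrite ger0_norm ?sqrtr_ge0// -lee_fin -Lnorm2_sqint.
have i1 := sqint_mul sa sMt.
have i2 := integrableZl measurableT (delta / 2) (proj2 sa).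
have iK : P.-integrable [set: T] (EFin \o (fun w => a s w * M t w + delta / 2 * a s w ^+ 2)).
  by have := integrableD measurableT i1 i2; apply: eq_integrable.
rewrite -(fineK (integrable_fin_num measurableT iK)).
rewrite -/(Rintegral P setT (fun w => a s w * M t w + delta / 2 * a s w ^+ 2)).
rewrite RintegralD// RintegralZl//; last exact: (proj2 sa).
have -> : \int[P]_w (a s w ^+ 2) = x ^+ 2.
  by rewrite sqr_sqrtr ?ip_ge0//; apply: eq_Rintegral => w _; rewrite expr2.
rewrite -EFinN -/(ip P (a s) (M t)).
have bound r y : (nm y)%E = r%:E -> - ip P (a s) (M t) <= x * r ->
    ((- (ip P (a s) (M t) + delta / 2 * x ^+ 2))%:E <= phi delta (nm y))%E.
  move=> -> h; apply: le_trans (phi_ge _ _ xc); rewrite lee_fin; lra.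
have [st|ts] := leP s t.
  have sMs := sM s0 st; apply: (bound (m s)); first exact: Lnorm2_sqint.
  have -> : ip P (a s) (M t) = ip P (a s) (M s).
    have [mMs iMs _] := martP P_complete B_bm iY s1.
    have [mMt iMt _] := martP P_complete B_bm iY (ltW t1).
    apply: (cond_exp_mul _ iMt (mart_tower P_complete B_bm iY st (ltW t1))).
    - by move=> A; exact: (completed_gen_measurable P_complete B_bm).
    - apply: (progressively_measurable_section _ (proj1 aA)); exact/andP.
    - exact: sqint_mul.
    - exact: sqint_mul.
  by have := ip_norm_le sa sMs; rewrite -/x ler_norml => /andP[h _]; lra.
apply: le_trans (bound (m t) t _ _) _; first exact: Lnorm2_sqint.
  by have := ip_norm_le sa sMt; rewrite -/x ler_norml => /andP[h _]; lra.
exact: (phi_mart_mono P_complete B_bm delta iY (ltW t0) (ltW ts)).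
Qed.

Lemma pairing_mart_ge :
  ((- (pairing P a (M t) + delta / 2 * energy P a))%:E <=
   \int[mu]_(s in `[0%R, 1%R]) phi delta (nm s))%E.
Proof.
have [K [iK KE Kt]] := lagrangian_sections P_complete B_bm (delta / 2) aA sMt.
rewrite EFinN -KE integralE.
have iKp := integrable_pos_fin_num measurableT iK.
have iKn := integrable_neg_fin_num measurableT iK.
(* Keeping only the negative part leaves nonnegative integrands, which can be compared with [phi]
   even if its integral is infinite. *)
apply: (@le_trans _ _ (\int[mu]_s (K^\- s))%E).
  rewrite fin_num_oppeB// -[leRHS]add0e leeD2r// leeNl oppe0.
  exact: integral_ge0.
rewrite integral_unit_itv.
have mK := measurable_int _ iK.
have phi_nd s u := phi_mart_mono P_complete B_bm delta iY s u.
have mphi := nondecreasing_unit_measurable phi_nd.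
apply: ae_ge0_le_integral => //.
- exact: measurable_funeneg.
- by move=> s _; case: ifP => // _; exact: phi_ge0.
- have /(measurable_restrictT _ (measurable_itv _)) := mphi.
  apply: eq_measurable_fun => s _; rewrite patchE.
  have -> // : (s \in `[0, 1]%classic) = (0 <= s <= 1).
  by apply/idP/idP => [/set_mem|h]; rewrite ?inE /= in_itv.
- have [_] := aA; apply: ae_lebesgue_imp => s h _.
  rewrite funenegE Kt; case: ifPn => [s01|_]; last by rewrite oppe0 maxxx.
  rewrite ge_max phi_ge0 andbT; apply: section_lagrangian_ge => //.
  by apply: h; rewrite in_itv.
Qed.

Lemma weak_duality_at :
  ((\int[P]_w (Y w * B t w))%:E <= 'N[P]_p [EFin \o X] + (delta / 2 * energy P a)%:E +
    \int[mu]_(s in `[0%R, 1%R]) phi delta (nm s))%E.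
Proof.
apply: le_trans (leeD (leeD mart_state_le (lexx _)) pairing_mart_ge).
by rewrite -!EFinD lee_fin; lra.
Qed.

End before_time_one.

(** An infinite norm at [t] would stay infinite on [[t, 1]], an interval of positive length. *)
Lemma phi_integral_norm_fin (t : R) : 0 <= t -> t < 1 ->
  (\int[mu]_(s in `[0%R, 1%R]) phi delta (nm s) < +oo)%E -> (nm t < +oo)%E.
Proof.
move=> t0 t1; apply: contraTT; rewrite -!leNgt !leye_eq => /eqP nt.
have phi_nd s u := phi_mart_mono P_complete B_bm delta iY s u.
have mphi := nondecreasing_unit_measurable phi_nd.
rewrite -leye_eq; apply: (@le_trans _ _ (\int[mu]_(s in `[t, 1%R]) (cst +oo s))%E).
  rewrite integral_cst// [X in (_ * X)%E]lebesgue_measure_itv/= lte_fin t1.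
  by rewrite -EFinB gt0_mulye// lte_fin subr_gt0.
have sub : `[t, 1]%classic `<=` (`[0, 1]%classic : set R).
  by move=> s; rewrite /= !in_itv/= => /andP[ts ->]; rewrite (le_trans t0).
apply: (@le_trans _ _ (\int[mu]_(s in `[t, 1%R]) phi delta (nm s))%E).
  apply: ge0_le_integral => //; [by move=> s _; exact: leey|exact: measurable_funS mphi|].
  move=> s /=; rewrite in_itv/= => /andP[ts s1].
  by have := phi_nd _ _ t0 ts s1; rewrite nt.
apply: ge0_subset_integral => //.
by move=> s _; exact: phi_ge0.
Qed.

Lemma weak_duality :
  (dual_objective P B delta Y <= cost P B p delta a)%E.
Proof.
rewrite (cost_energy P_complete B_bm)// /dual_objective unlock.
have i1 : P.-integrable [set: T] (EFin \o (Y \* B 1)%R).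
  by apply: (LlogL_bm_integrable B_bm mY LY); rewrite ltr01 lexx.
rewrite -(fineK (integrable_fin_num measurableT i1)).
set J := (\int[mu]_(_ in _) _)%E.
have J0 : (0 <= J)%E by apply: integral_ge0 => s _; exact: phi_ge0.
have [Jfin|] := ltP J +oo%E; last first.
  by rewrite leye_eq => /eqP ->; rewrite addeNy leNye.
rewrite leeBlDr; last by rewrite ge0_fin_numE.
apply/lee_addgt0Pr => e e0.
have [t [t0 t1 ht]] := LlogL_bm_cvg B_bm mY LY e0.
(* [ht] holds strictly between [t] and 1, and [weak_duality_at] needs a time before 1. *)
pose u := (t + 1) / 2; have tu : t < u by rewrite /u; lra.
have u1 : u < 1 by rewrite /u; lra.
have u0 : 0 < u by exact: lt_trans tu.
apply: (@le_trans _ _ ((\int[P]_w (Y w * B u w))%:E + e%:E)%E).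
  by rewrite -EFinD lee_fin; exact: ht.
apply: leeD => //; apply: weak_duality_at => //.
by apply: phi_integral_norm_fin => //; exact: ltW.
Qed.

End weak_duality.

(** * Strong duality and existence of an optimal control *)

Section strong_duality.
Context {d : measure_display} {T : measurableType d} {R : realType}.
Variables (P : probability T R) (B : R -> T -> R).
Hypothesis P_complete : measure_is_complete P.
Hypothesis B_bm : is_brownian_motion P B.
Local Notation mu := (@lebesgue_measure R).
Local Notation c0 := (@c0 R).

Lemma c0_gt0 : 0 < c0.
Proof. by rewrite sqrtr_gt0 divr_gt0// pi_gt0. Qed.

Lemma Lnorm_mid (q : \bar R) (Y Z : T -> R) : (1 <= q)%E ->
  measurable_fun [set: T] Y -> measurable_fun [set: T] Z ->
  ('N[P]_q [EFin \o Y] <= 1)%E -> ('N[P]_q [EFin \o Z] <= 1)%E ->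
  ('N[P]_q [EFin \o (fun w => 2^-1 * Y w + 2^-1 * Z w)%R] <= 1)%E.
Proof.
move=> q1 mY mZ NY NZ.
have half (X : T -> R) : measurable_fun [set: T] X -> ('N[P]_q [EFin \o X] <= 1)%E ->
    ('N[P]_q [EFin \o (fun w => 2^-1 * X w)%R] <= (2^-1)%:E)%E.
  move=> mX NX.
  pose mXm := isMeasurableFun.Build _ _ _ _ X mX.
  pose X1 : {mfun T >-> R} := HB.pack X mXm.
  have fX : finite_norm P q X1 by apply: le_lt_trans NX (ltry _).
  pose lX := isLfunction.Build _ _ _ _ _ q1 X1 fX.
  pose X2 : LfunType P q1 := HB.pack X mXm lX.
  have := LnormZ X2 2^-1; rewrite [X in _ = (X * _)%E -> _](_ : _ = (2^-1)%:E); last first.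
    by rewrite ger0_norm.
  move=> ->; rewrite -[leRHS]mule1; exact: lee_wpmul2l.
have mh (X : T -> R) : measurable_fun [set: T] X -> measurable_fun [set: T] (fun w => 2^-1 * X w).
  by move=> mX; exact: measurable_funM.
have := eminkowski P (mh _ mY) (mh _ mZ) q1.
move=> h; apply: le_trans h _; apply: le_trans (leeD (half _ mY NY) (half _ mZ NZ)) _.
by rewrite -EFinD lee_fin; lra.
Qed.

Lemma ip_mid (Y Z : T -> R) : sqint P Y -> sqint P Z ->
  ip P (fun w => 2^-1 * Y w + 2^-1 * Z w) (fun w => 2^-1 * Y w + 2^-1 * Z w) =
  (ip P Y Y + ip P Z Z) / 2 - ip P (fun w => Z w - Y w) (fun w => Z w - Y w) / 4.
Proof.
move=> sY sZ; rewrite ip_sqr//.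
have -> : (fun w => Z w - Y w) = (fun w => (-1) * Y w + 1 * Z w).
  by apply/funext => w; lra.
by rewrite ip_sqr//; lra.
Qed.

Lemma zero_admissible : admissible P B (fun _ _ => 0).
Proof.
split; first by move=> t _.
apply: aeW => t _; rewrite [X in ('N[P]_ _ [X])%E](_ : _ = cst 0%E)//.
by rewrite Lnorm0// lee_fin c0_ge0.
Qed.

Lemma sqrt_fast_le n : Num.sqrt (fast n) <= n.+1%:R^-1 :> R.
Proof.
have n0 : 0 < n.+1%:R :> R by rewrite ltr0n.
rewrite -[leRHS]ger0_norm ?invr_ge0//.
rewrite -sqrtr_sqr ler_sqrt ?sqr_ge0// exprVn lef_pV2 ?posrE ?exprn_gt0//.
rewrite -natrX -natrX -natrM ler_nat.
apply: (@leq_trans (4 ^ n)%N).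
  have -> : (4 ^ n = (2 ^ n) ^ 2)%N by rewrite -expnM mulnC expnM.
  by rewrite leq_exp2r// ltn_expl.
by rewrite -[leqLHS]muln1 leq_mul//; case: n {n0} => // k; rewrite leq_exp2r.
Qed.

Variables (p : \bar R) (delta : R).
Hypothesis p_ge1 : (1 <= p)%E.
Hypothesis delta_ge0 : 0 <= delta.
Local Notation q := (hoelder_conjugate p).

(** A convex class fit for both uses: its members are square integrable, as the penalty requires,
    and it contains the tests [g \o X] of the norm duality. *)
Definition bounded_dual : set (T -> R) := [set Y : T -> R |
  [/\ measurable_fun [set: T] Y, exists C, forall w, `|Y w| <= C &
      ('N[P]_q [EFin \o Y] <= 1)%E]].

Let L a Z := ip P Z (B 1) + pairing P a Z.

Let sB1 : sqint P (B 1).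
Proof. by apply: (bm_sqint B_bm); rewrite ltr01 lexx. Qed.

Let sK Y : bounded_dual Y -> sqint P Y.
Proof. by move=> [mY bY _]; apply: bounded_sqint => //; exact: bounded_integrable. Qed.

(** A bounded [Y] meets the [L sqrt(log L)] condition, hence competes in the dual problem. The bound
    stays in the extended reals, so at [Y = 0] it also shows that the dual value is not [-oo]. *)
Lemma lagrangian_dual_value Y (e : R) : bounded_dual Y -> 0 < e ->
  exists2 b, admissible P B b &
    ((L b Y + delta / 2 * energy P b)%:E <= dual_value P B q delta + e%:E)%E.
Proof.
move=> KY e0; have [mY bY NY] := KY.
have iY := bounded_integrable P mY bY.
have [b bA hb] := lagrangian_near_min P_complete B_bm delta_ge0 iY bY e0.
exists b => //.
pose Y1 : {RV P >-> R} := HB.pack Y (isMeasurableFun.Build _ _ _ _ Y mY).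
have Y1A : dual_admissible q Y1 by split=> //; exact: LlogL_bounded.
apply: le_trans (leeD (ereal_sup_ubound _) (lexx e%:E)); last by exists Y1.
rewrite /dual_objective unlock.
have i1 := sqint_mul (sK KY) sB1.
have -> : (\int[P]_w (EFin \o (Y1 \* B 1)%R) w)%E = (ip P Y (B 1))%:E.
  by rewrite /ip /Rintegral fineK//; exact: (integrable_fin_num measurableT i1).
move: hb; set J := (\int[mu]_(_ in _) _)%E => hb.
have J0 : (0 <= J)%E by apply: integral_ge0 => s _; exact: phi_ge0.
have Jf : J \is a fin_num by rewrite ge0_fin_numE// (le_lt_trans hb)// ltry.
move: hb; rewrite -(fineK Jf) -EFinB -EFinD !lee_fin /L; lra.
Qed.

Lemma zero_bounded_dual : bounded_dual (cst 0).
Proof.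
split=> //; first by exists 0 => w; rewrite normr0.
rewrite [X in ('N[P]_ _ [X])%E](_ : _ = cst 0%E)// Lnorm0//.
by rewrite gt_eqF// (lt_le_trans lte01)// hoelder_conj_ge1.
Qed.

Let L_zero a : admissible P B a -> L a (cst 0) = 0.
Proof.
move=> aA; have sY := sK zero_bounded_dual.
have := pairing_linr P_complete B_bm 0 0 aA sY sY.
have := ip_linl 0 0 sY sY sB1.
have -> : (fun w => 0 * cst 0 w + 0 * cst 0 w) = (cst 0 : T -> R).
  by apply/funext => w; rewrite mulr0 addr0.
by rewrite /L => -> ->; lra.
Qed.

Section finite_value.
Variable v : R.
Hypothesis vE : dual_value P B q delta = v%:E.

Lemma lagrangian_minimizer : exists2 b, admissible P B b &
  forall Z, bounded_dual Z -> L b Z + delta / 2 * energy P b <= v.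
Proof.
have c2 : 0 < 4 * c0 ^+ 2 by rewrite mulr_gt0 ?exprn_gt0 ?c0_gt0.
have d2 : 0 <= delta / 2 by rewrite divr_ge0.
have [a [aA aL aD]] : exists a, [/\ forall n, admissible P B (a n),
    forall n Z, bounded_dual Z -> L (a n) Z + delta / 2 * energy P (a n) -
      ip P Z Z / n.+1%:R <= v + n.+1%:R^-1 &
    forall j k, dist P (a j) (a k) <= Num.max (fast j) (fast k)].
  apply: (@minimizing_sequence R _ _ (@mix _ T R) (fun Y Z w => 2^-1 * Y w + 2^-1 * Z w)
    (admissible P B) bounded_dual L (@energy _ _ _ P) (@dist _ _ _ P)
    (fun Y => ip P Y Y) (fun Y Z => ip P (fun w => Z w - Y w) (fun w => Z w - Y w))
    (4 * c0 ^+ 2) (delta / 2) v (fun _ _ => 0) (cst 0)) => //.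
  - exact: zero_admissible.
  - exact: (admissible_mix P_complete B_bm).
  - move=> Y Z [mY [CY hY] NY] [mZ [CZ hZ] NZ]; split.
    + by apply: measurable_funD; exact: measurable_funM.
    + exists (CY + CZ) => w; apply: le_trans (ler_normD _ _) _.
      rewrite !normrM ger0_norm//; apply: lerD.
        by have := hY w; have := normr_ge0 (Y w); lra.
      by have := hZ w; have := normr_ge0 (Z w); lra.
    + by apply: Lnorm_mid => //; exact: hoelder_conj_ge1.
  - move=> s a b Z s01 aA bA KZ; rewrite /L.
    by rewrite (pairing_mixl P_complete B_bm _ aA bA (sK KZ)); lra.
  - move=> a Y Z aA KY KZ; rewrite /L.
    by rewrite (pairing_linr P_complete B_bm _ _ aA (sK KY) (sK KZ)) ip_linl//;
      [lra|exact: sK|exact: sK].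
  - by move=> s a b _ aA bA; exact: (energy_mix P_complete B_bm).
  - by move=> Y Z KY KZ; apply: ip_mid; exact: sK.
  - by move=> a _; exact: ip_ge0.
  - move=> a aA; have := energy_le P_complete B_bm aA; have := sqr_ge0 c0; lra.
  - by move=> a b _ _; exact: dist_ge0.
  - by move=> Y _; exact: ip_ge0.
  - move=> a b Y Z aA bA KY KZ.
    have := pairing_diff_sqr P_complete B_bm aA bA (sK KY) (sK KZ).
    have -> : L b Z - L a Z - (L b Y - L a Y) =
      pairing P b Z - pairing P a Z - (pairing P b Y - pairing P a Y) by rewrite /L; lra.
    move=> h; apply: le_trans h _; apply: ler_wpM2r; first exact: ip_ge0.
    exact: (dist_le P_complete B_bm).
  (* [L a Z <= k * x] for [x] the norm of [Z], and [k * x - eta * x ^+ 2] is largest at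
     [x = k / (2 * eta)]. *)
  - move=> eta eta0; set k := Num.sqrt (ip P (B 1) (B 1)) + c0.
    exists (eta * (k / (2 * eta)) ^+ 2) => a Z aA KZ.
    have h1 := ip_norm_le (sK KZ) sB1.
    have h2 := ip_norm_le (admissible_sqint P_complete B_bm aA) (lift_sqint (sK KZ)).
    have h3 : Num.sqrt (energy P a) <= c0.
      rewrite -[leRHS]ger0_norm ?c0_ge0// -sqrtr_sqr ler_sqrt ?sqr_ge0//.
      exact: (energy_le P_complete B_bm).
    rewrite ip_lift in h2; last exact: sK.
    set x := Num.sqrt (ip P Z Z) in h1 h2.
    have x0 : 0 <= x by exact: sqrtr_ge0.
    have h4 := ler_wpM2r x0 h3.
    have Lk : L a Z <= k * x.
      have := le_trans (ler_norm _) h1; have := le_trans (ler_norm _) h2.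
      rewrite -/(pairing P a Z) /L /k; move: h4; rewrite /energy.
      lra.
    have -> : ip P Z Z = x ^+ 2 by rewrite sqr_sqrtr ?ip_ge0.
    set y := k / (2 * eta); have ky : k = 2 * eta * y.
      by rewrite /y mulrC divfK// gt_eqF// mulr_gt0.
    rewrite ky in Lk; have := mulr_ge0 (ltW eta0) (sqr_ge0 (y - x)); lra.
  - exact: zero_bounded_dual.
  - by rewrite /ip; under eq_Rintegral do rewrite mulr0; rewrite Rintegral_cst// mul0r.
  - move=> Y e KY e0; have [b bA hb] := lagrangian_dual_value KY e0.
    by exists b => //; move: hb; rewrite vE -EFinD lee_fin.
  - exact: fast_gt0.
have [b bA hb] := admissible_complete P_complete B_bm aA aD.
exists b => // Z KZ.
(* Four errors of order [1 / n.+1], for this fixed [Z]: the slack in the value, the penalty, and the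
   passage to the limit in the pairing and in the energy. *)
set k := 1 + ip P Z Z + Num.sqrt (ip P Z Z) + delta * c0.
have k0 : 0 < k.
  have := ip_ge0 P Z; have := sqrtr_ge0 (ip P Z Z).
  have := mulr_ge0 delta_ge0 (@c0_ge0 R); rewrite /k; lra.
apply/ler_addgt0Pr => e e0; pose n := Num.truncn (k / e).
have n0 : 0 < n.+1%:R :> R by rewrite ltr0n.
have kn : k / n.+1%:R <= e.
  rewrite ler_pdivrMr// mulrC -ler_pdivrMr//; apply: ltW; exact: truncnS_gt.
have s1 : Num.sqrt (dist P (a n) b) <= n.+1%:R^-1.
  apply: le_trans (sqrt_fast_le n); rewrite ler_sqrt ?hb//.
  exact/ltW/fast_gt0.
have h1 := pairing_lipschitz P_complete B_bm (aA n) bA (sK KZ).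
have h2 := ler_wpM2l d2 (energy_lsc P_complete B_bm (aA n) bA).
have h3 := ler_wpM2r (sqrtr_ge0 (ip P Z Z)) s1.
have h4 : delta * c0 * Num.sqrt (dist P (a n) b) <= delta * c0 * n.+1%:R^-1.
  by rewrite ler_wpM2l// mulr_ge0// c0_ge0.
move: (aL n Z KZ) kn h1 h2 h3 h4; rewrite /L /k.
move: (n.+1%:R^-1) (energy P (a n)) (Num.sqrt (dist P (a n) b)) => i en s.
lra.
Qed.

(** Each test [g \o X] of the final state is itself a bounded dual variable, so the Lagrangian bound
    for all [Z] at once is exactly a dual test for the norm of the state. *)
Lemma cost_minimizer_le : exists2 b, admissible P B b &
  (cost P B p delta b <= dual_value P B q delta)%E.
Proof.
have [b bA hb] := lagrangian_minimizer; exists b => //.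
rewrite (cost_energy P_complete B_bm)// vE.
pose c := v - delta / 2 * energy P b.
(* The Lagrangian bound at [Z = 0]. *)
have c_ge0 : 0 <= c.
  by have := hb _ zero_bounded_dual; rewrite L_zero// /c; lra.
have [mI iI _] := state_integral P_complete B_bm bA (sqint_cst P 1).
have iX : P.-integrable [set: T] (EFin \o state B b 1).
  have := integrableD measurableT iI (sqint_mul sB1 (sqint_cst P 1)).
  by apply: eq_integrable => // w _; rewrite /= /state mul1r mulr1.
have mX : measurable_fun [set: T] (state B b 1).
  exact/measurable_EFinP/(measurable_int _ iX).
have := @Lnorm_le_dual _ _ _ P (state B b 1) p c p_ge1 c_ge0 iX _.
suff dt : dual_test P p (state B b 1) c.
  move=> /(_ dt) h; apply: le_trans (leeD h (lexx _)) _.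
  by rewrite -EFinD lee_fin /c subrK.
move=> g mg [C gC] Ng; pose Z := g \o state B b 1.
have mZ : measurable_fun [set: T] Z by exact: measurableT_comp.
have KZ : bounded_dual Z by split=> //; exists C => w; exact: gC.
have [_ iZ IZ] := state_integral P_complete B_bm bA (sK KZ).
have := hb _ KZ; rewrite /L -IZ.
have <- : \int[P]_w (state B b 1 w * g (state B b 1 w)) =
    ip P Z (B 1) + \int[P]_w (Z w * \int[mu]_(s in `[0, 1]) b s w).
  rewrite addrC -RintegralD//; last exact: (sqint_mul (sK KZ) sB1).
  by apply: eq_Rintegral => w _; rewrite -mulrDr mulrC.
by rewrite /c; lra.
Qed.

End finite_value.

Lemma dual_value_gtNy : (-oo < dual_value P B q delta)%E.
Proof.
have [b bA] := lagrangian_dual_value zero_bounded_dual ltr01.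
by case: (dual_value P B q delta) => //= r; rewrite ltNyr.
Qed.

End strong_duality.

Unset Implicit Arguments.
Set Strict Implicit.

Theorem theorem5p1 (R : realType) (d : measure_display) (T : measurableType d)
    (P : probability T R) (P_complete : measure_is_complete P)
    (B : R -> T -> R) (B_bm : is_brownian_motion P B)
    (p : \bar R) (p_ge2 : (2%:E <= p)%E) (delta : R) (delta_ge0 : 0 <= delta) :
  value P B p delta = dual_value P B (hoelder_conjugate p) delta /\
  exists2 alpha, admissible P B alpha & cost P B p delta alpha = value P B p delta.
Proof.
have p1 : (1 <= p)%E by apply: le_trans p_ge2; rewrite lee_fin; lra.
have q1 := hoelder_conj_ge1 p1.
have weak a : admissible P B a ->
    (dual_value P B (hoelder_conjugate p) delta <= cost P B p delta a)%E.
  move=> aA; apply: ge_ereal_sup => _ [Y [NY LY] <-].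
  exact: (weak_duality P_complete B_bm delta p1 q1 aA (measurable_funPT Y) LY NY).
have weak_value : (dual_value P B (hoelder_conjugate p) delta <= value P B p delta)%E.
  by apply: le_ereal_inf_tmp => _ [a aA <-]; exact: weak.
have [b bA hb] : exists2 b, admissible P B b &
    (cost P B p delta b <= dual_value P B (hoelder_conjugate p) delta)%E.
  have := dual_value_gtNy P_complete B_bm p1 delta_ge0.
  (* If the dual value is [+oo] the inequality is trivial and any admissible control will do. *)
  case vE : (dual_value _ _ _ _) => [v| |] // _; last first.
    by exists (fun _ _ => 0); [exact: zero_admissible|exact: leey].
  by rewrite -vE; exact: (cost_minimizer_le P_complete B_bm p1 delta_ge0 vE).
have value_b : (value P B p delta <= cost P B p delta b)%E.
  by apply: ereal_inf_lbound; exists b.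
split; first by apply/eqP; rewrite eq_le weak_value andbT (le_trans value_b hb).
by exists b => //; apply/eqP; rewrite eq_le value_b andbT (le_trans hb weak_value).
Qed.
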